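(* For $n\ge1$ let $B_n$ be the braid matroid of rank $n-1$ with its action of $S_n$, let $K_n(t)=H_{B_n}^{S_n}(t)$ be its equivariant characteristic polynomial, $Q_n(t)=P_{B_n}^{S_n}(t)$ its equivariant Kazhdan-Lusztig polynomial, and $\bar Q_n(t)=t^{n-1}Q_n(t^{-1})$. Put $$K(t,z)=\sum_{n\ge1}\dim K_n(t)\frac{z^n}{n!},\quad Q(t,z)=\sum_{n\ge1}\dim Q_n(t)\frac{z^n}{n!},\quad \bar Q(t,z)=\sum_{n\ge1}\dim\bar Q_n(t)\frac{z^n}{n!},$$ $$\mathcal K(t)=\sum_{n\ge1}\operatorname{ch}K_n(t),\quad \mathcal Q(t)=\sum_{n\ge1}\operatorname{ch}Q_n(t),\quad \bar{\mathcal Q}(t)=\sum_{n\ge1}\operatorname{ch}\bar Q_n(t).$$ Then $$\frac1t\,Q(t^{-1},tz)=\bar Q(t,z)=Q\big(t,K(t,z)\big)\qquad\text{and}\qquad \bar{\mathcal Q}(t)=\mathcal Q(t)\big[\mathcal K(t)\big],$$ where square brackets denote plethysm.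
   Context: $B_n$ is the matroid of the complete graph on $n$ vertices: its ground set is the set of 2-element subsets of $[n]$, and its lattice of flats is the lattice of set partitions of $[n]$, the rank of a flat being $n$ minus the number of parts. $\dim$ of an element of $\mathrm{grVRep}(S_n)$ is its graded (virtual) dimension in $\mathbb Z[t]$. $\operatorname{ch}:\mathrm{grVRep}(S_n)\to\Lambda_n[t]$ is the Frobenius characteristic, $\Lambda_n$ being the symmetric functions of degree $n$; infinite sums over $n$ are taken in the completion of the ring of symmetric functions with coefficients involving $t$. Plethysm $f[g]$ is the usual one, extended to virtual graded coefficients: $f\mapsto f[g]$ is a ring homomorphism fixing the coefficient variable $t$ of $f$, and $p_k[g]$ is obtained from $g$ by $p_j\mapsto p_{jk}$, $t\mapsto t^k$ (with $p_k[-g]=-p_k[g]$). An equivariant matroid $W\curvearrowright M$ is a matroid $M$ on a finite ground set $\mathcal I$ together with a finite group $W$ acting on $\mathcal I$ and preserving $M$. $\mathrm{VRep}(W)$ is the Grothendieck ring of finite-dimensional complex representations and $\mathrm{grVRep}(W)=\mathrm{VRep}(W)\otimes_{\mathbb Z}\mathbb Z[t]$. The Orlik-Solomon algebra of $M$ is the quotient of the exterior algebra over $\mathbb C$ on generators $e_i$ ($i\in\mathcal I$) by the ideal generated by $\partial e_C$ for all circuits $C$ ($\partial$ the derivation with $\partial e_i=1$); $W$ acts by permuting generators, and the degree $p$ part is $OS^W_{M,p}$. The equivariant characteristic polynomial is $H^W_M(t)=\sum_{p=0}^{\operatorname{rk}M}(-1)^p t^{\operatorname{rk}M-p}OS^W_{M,p}$.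 For a flat $F$ in the lattice of flats $L$, $W_F$ is its stabilizer, $M_F$ is the matroid on $F$ with lattice of flats $\{G\le F\}$ (usual restriction $M|F$), and $M^F$ is the matroid on $\mathcal I\smallsetminus F$ with lattice of flats $\{G\ge F\}$ (usual contraction $M/F$). The equivariant Kazhdan-Lusztig polynomial is the unique assignment to each equivariant (loopless) matroid $W\curvearrowright M$ of an element $P^W_M(t)\in\mathrm{grVRep}(W)$ such that: (1) if $\operatorname{rk}M=0$, $P^W_M(t)$ is the trivial representation in degree $0$; (2) if $\operatorname{rk}M>0$, $\deg P_M^W(t)<\frac12\operatorname{rk}M$; (3) $t^{\operatorname{rk}M}P^W_M(t^{-1})=\sum_{[F]\in L/W}\operatorname{Ind}_{W_F}^W\big(H^{W_F}_{M_F}(t)\otimes P^{W_F}_{M^F}(t)\big)$ (sum over orbit representatives); (4) $P^{W'}_M(t)=\varphi^*P^W_M(t)$ for every homomorphism $\varphi:W'\to W$. *)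

(* Defs.v *)
From mathcomp Require Import all_boot all_order all_fingroup all_algebra.
From mathcomp Require Import all_solvable all_field all_character.
From mathcomp Require Import finmap monalg.

Set Implicit Arguments.
Unset Strict Implicit.
Unset Printing Implicit Defensive.

Import Order.TTheory GRing.Theory Num.Theory.
Local Open Scope group_scope.
Local Open Scope ring_scope.

(* A matroid whose ground set is a subset of the finite type [I], presented by
   its rank function; the values of [mrank] outside the ground set are junk. *)
Record matroid (I : finType) := Matroid {
  ground : {set I};
  mrank : {set I} -> nat;
  mrank_le_card : forall A : {set I}, A \subset ground -> (mrank A <= #|A|)%N;
  mrank_mono : forall A B : {set I}, A \subset B -> B \subset ground ->
    (mrank A <= mrank B)%N;
  mrank_submod : forall A B : {set I}, A \subset ground -> B \subset ground ->
    (mrank (A :|: B) + mrank (A :&: B) <= mrank A + mrank B)%N }.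

Section MatroidNotions.
Variables (I : finType) (M : matroid I).

Definition mrk : nat := mrank M (ground M).

Definition dependent (A : {set I}) : bool :=
  (A \subset ground M) && (mrank M A < #|A|)%N.

Definition circuit (C : {set I}) : bool := minset dependent C.

Definition flat (F : {set I}) : bool :=
  (F \subset ground M) &&
  [forall x in ground M :\: F, (mrank M F < mrank M (x |: F))%N].

Definition flats : {set {set I}} := [set F | flat F].

Definition loopless : Prop := forall x, x \in ground M -> mrank M [set x] = 1%N.

End MatroidNotions.

Section RestrictContract.
Variables (I : finType) (M : matroid I) (F : {set I}).

Lemma mrestrict_le_card (A : {set I}) :
  A \subset ground M :&: F -> (mrank M A <= #|A|)%N.
Proof. by rewrite subsetI => /andP[sA _]; apply: mrank_le_card. Qed.

Lemma mrestrict_mono (A B : {set I}) : A \subset B -> B \subset ground M :&: F ->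
  (mrank M A <= mrank M B)%N.
Proof. by rewrite subsetI => sAB /andP[sB _]; apply: mrank_mono. Qed.

Lemma mrestrict_submod (A B : {set I}) :
    A \subset ground M :&: F -> B \subset ground M :&: F ->
  (mrank M (A :|: B) + mrank M (A :&: B) <= mrank M A + mrank M B)%N.
Proof.
by rewrite !subsetI => /andP[sA _] /andP[sB _]; apply: mrank_submod.
Qed.

Definition mrestrict : matroid I :=
  Matroid mrestrict_le_card mrestrict_mono mrestrict_submod.

Let EF := ground M :&: F.
Definition contract_rank (A : {set I}) : nat :=
  mrank M (A :|: EF) - mrank M EF.

Let EFsub (A : {set I}) : A \subset ground M :\: F -> A :|: EF \subset ground M.
Proof.
rewrite subsetD => /andP[sA _]; rewrite subUset sA /=; exact: subsetIl.
Qed.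

Let EFle (A : {set I}) : A \subset ground M :\: F ->
  (mrank M EF <= mrank M (A :|: EF))%N.
Proof. by move=> sA; apply: mrank_mono; [apply: subsetUr | apply: EFsub]. Qed.

Lemma mcontract_mono (A B : {set I}) : A \subset B -> B \subset ground M :\: F ->
  (contract_rank A <= contract_rank B)%N.
Proof.
move=> sAB sB; apply: leq_sub2r; apply: mrank_mono; last exact: EFsub.
exact: setSU.
Qed.

Lemma mcontract_le_card (A : {set I}) :
  A \subset ground M :\: F -> (contract_rank A <= #|A|)%N.
Proof.
move=> sA; rewrite leq_subLR addnC.
have sAE : A \subset ground M by case/subsetDP: sA.
have := mrank_submod sAE (subsetIl (ground M) F : EF \subset _).
move/(leq_trans (leq_addr _ _)) => /leq_trans; apply.
by rewrite leq_add2r; apply: mrank_le_card.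
Qed.

Lemma mcontract_submod (A B : {set I}) :
    A \subset ground M :\: F -> B \subset ground M :\: F ->
  (contract_rank (A :|: B) + contract_rank (A :&: B)
     <= contract_rank A + contract_rank B)%N.
Proof.
move=> sA sB; have := mrank_submod (EFsub sA) (EFsub sB).
rewrite -setUIl -setUUl => le.
have sU : A :|: B \subset ground M :\: F by rewrite subUset sA.
have sI : A :&: B \subset ground M :\: F by rewrite (subset_trans _ sA) ?subsetIl.
rewrite /contract_rank.
rewrite -(leq_add2r (mrank M EF + mrank M EF)) !(addnACA _ _ (mrank M EF)).
by rewrite !subnK ?EFle.
Qed.

Definition mcontract : matroid I :=
  Matroid mcontract_le_card mcontract_mono mcontract_submod.

End RestrictContract.

(* The ground set is a subset of the ambient type I, so W acts on it through an
   action on I that stabilizes it; how W acts elsewhere is irrelevant. *)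
Record equivMatroid (gT : finGroupType) (W : {group gT}) (I : finType) :=
  EquivMatroid {
    emat : matroid I;
    eact : action W I;
    eact_ground : [acts W, on ground emat | eact];
    eact_rank : forall (w : gT) (A : {set I}), w \in W -> A \subset ground emat ->
      mrank emat (setact eact A w) = mrank emat A }.

Section Stabilizer.
Variables (gT : finGroupType) (W : {group gT}) (I : finType).
Variables (em : equivMatroid W I) (F : {set I}).

Definition flat_stab : {group gT} := 'N_W(F | eact em)%G.

Definition stab_act : action flat_stab I :=
  (eact em \ subsetIl W 'N(F | eact em))%act.

Let stabW w : w \in flat_stab -> w \in W.
Proof. by case/setIP. Qed.

Let stabE w : w \in flat_stab -> setact (eact em) (ground (emat em)) w = ground (emat em).
Proof.
by move/stabW => Ww; apply: astabs_setact; apply: (subsetP (eact_ground em)).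
Qed.

Let stabF (w : gT) : w \in flat_stab -> setact (eact em) F w = F.
Proof. by case/setIP=> _; apply: astabs_setact. Qed.

Let setactI w (A B : {set I}) : w \in W ->
  setact (eact em) (A :&: B) w = setact (eact em) A w :&: setact (eact em) B w.
Proof.
by move=> Ww; apply: imsetI => x y _ _; apply: act_inj.
Qed.

Let stab_astabs (A : {set I}) : 
  (forall w, w \in flat_stab -> setact (eact em) A w = A) ->
  [acts flat_stab, on A | stab_act].
Proof.
move=> h; apply/subsetP=> w Sw; rewrite /astabs in_setI Sw inE /=.
apply/subsetP=> x Ax; rewrite inE.
by have := mem_setact (eact em) w Ax; rewrite h.
Qed.

Lemma local_ground : [acts flat_stab, on ground (mrestrict (emat em) F) | stab_act].
Proof.
apply: stab_astabs => w Sw.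
by rewrite /= setactI ?stabW // stabE // stabF.
Qed.

Lemma local_rank w (A : {set I}) :
    w \in flat_stab -> A \subset ground (mrestrict (emat em) F) ->
  mrank (mrestrict (emat em) F) (setact stab_act A w)
    = mrank (mrestrict (emat em) F) A.
Proof.
by move=> Sw; rewrite /= subsetI => /andP[sA _]; apply: eact_rank; rewrite ?stabW.
Qed.

(* W_F acting on the restriction M_F *)
Definition em_local : equivMatroid flat_stab I :=
  EquivMatroid local_ground local_rank.

Lemma contr_ground : [acts flat_stab, on ground (mcontract (emat em) F) | stab_act].
Proof.
apply: stab_astabs => w Sw.
apply/eqP; rewrite eqEcard card_setact leqnn andbT; apply/subsetP=> y.
case/imsetP=> x /setDP[Ex nFx] ->; rewrite inE.
have := mem_setact (eact em) w Ex; rewrite stabE // => -> /=; rewrite andbT.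
by apply: contra nFx; rewrite -{1}(stabF Sw) => /imsetP[z Fz /act_inj ->].
Qed.

Lemma contr_rank w (A : {set I}) :
    w \in flat_stab -> A \subset ground (mcontract (emat em) F) ->
  mrank (mcontract (emat em) F) (setact stab_act A w)
    = mrank (mcontract (emat em) F) A.
Proof.
move=> Sw; rewrite /= subsetD => /andP[sA _]; rewrite /contract_rank.
congr (_ - _)%N.
have EFw : setact (eact em) (ground (emat em) :&: F) w = ground (emat em) :&: F.
  by rewrite setactI ?stabW // stabE // stabF.
rewrite -{1}EFw -imsetU; apply: eact_rank; first exact: stabW.
by rewrite subUset sA subsetIl.
Qed.

(* W_F acting on the contraction M^F *)
Definition em_contract : equivMatroid flat_stab I :=
  EquivMatroid contr_ground contr_rank.

End Stabilizer.

Section OrlikSolomon.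
Variables (gT : finGroupType) (W : {group gT}) (I : finType).
Variables (em : equivMatroid W I) (p : nat).
Let M := emat em.

(* The degree p part of the tensor algebra on the e_i has as basis the words of
   length p over the ground set.  The exterior algebra is its quotient by the
   e_i e_j + e_j e_i, and the Orlik-Solomon algebra is the further quotient by
   the partial e_C; both two-sided ideals are divided out at once. *)
Definition gword := {t : p.-tuple I | all (mem (ground M)) t}.

Definition gword_seq (i : 'I_#|{: gword}|) : seq I := val (val (enum_val i)).

(* The word s as an element of the tensor algebra in degree p; it is 0 unless s
   has length p and all its letters lie in the ground set. *)
Definition wordv (s : seq I) : 'rV[algC]_#|{: gword}| :=
  \row_j (gword_seq j == s)%:R.

Definition tens_mx (w : gT) : 'M[algC]_#|{: gword}| :=
  \matrix_i wordv [seq eact em x w | x <- gword_seq i].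

(* e_a (e_i e_j + e_j e_i) e_b; it is 2 e_a e_i e_i e_b when i = j *)
Definition ext_rel (a b : seq I) (i j : I) :=
  wordv (a ++ [:: i; j] ++ b) + wordv (a ++ [:: j; i] ++ b).

(* e_a (partial e_c) e_b, where e_c = e_(c_0) e_(c_1) ... *)
Definition os_rel (a b c : seq I) :=
  \sum_(k < size c) (-1) ^+ k *: wordv (a ++ (take k c ++ drop k.+1 c) ++ b).

(* The degree p part of the two-sided ideal; longer words a, b, c would only
   contribute zero relations in degree p.  Every ordering c of a circuit is
   used, these differing by a sign modulo the exterior relations. *)
Definition os_ideal : 'M[algC]_#|{: gword}| :=
  (\sum_(a : {bseq p of I}) \sum_(b : {bseq p of I})
     ((\sum_(i in ground M) \sum_(j in ground M) <<ext_rel a b i j>>)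
      + \sum_(c : {bseq p.+1 of I} | uniq c && circuit M [set x in c])
          <<os_rel a b c>>))%MS.

Lemma gword_seqP (s : seq I) :
  size s = p -> all (mem (ground M)) s -> {i | gword_seq i = s}.
Proof.
move=> /eqP szs sE.
exists (enum_rank (Sub (Tuple szs) sE : gword)).
by rewrite /gword_seq enum_rankK.
Qed.

Lemma gword_seq_inj : injective gword_seq.
Proof. by move=> i j /val_inj /val_inj /enum_val_inj. Qed.

Lemma size_gword_seq i : size (gword_seq i) = p.
Proof. exact: size_tuple. Qed.

Lemma all_gword_seq i : all (mem (ground M)) (gword_seq i).
Proof. exact: (valP (enum_val i)). Qed.

Lemma wordv_gword i : wordv (gword_seq i) = delta_mx 0 i.
Proof.
by apply/rowP=> j; rewrite !mxE eqxx /= (inj_eq gword_seq_inj).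
Qed.

Lemma wordv_out s : ~~ ((size s == p) && all (mem (ground M)) s) -> wordv s = 0.
Proof.
move=> h; apply/rowP=> j; rewrite !mxE; case: eqP => // def_s.
by case/negP: h; rewrite -def_s size_gword_seq eqxx all_gword_seq.
Qed.

Lemma eact_in w x : w \in W -> (eact em x w \in ground M) = (x \in ground M).
Proof. by move=> Ww; apply: (acts_act (eact_ground em)). Qed.

Lemma wordv_tens w s : w \in W ->
  wordv s *m tens_mx w = wordv [seq eact em x w | x <- s].
Proof.
move=> Ww.
have allw : all (mem (ground M)) [seq eact em x w | x <- s] = all (mem (ground M)) s.
  by rewrite all_map; apply: eq_all => x /=; apply: eact_in.
have [/andP[/eqP szs sE]|h] := boolP ((size s == p) && all (mem (ground M)) s).
  have [i def_s] := gword_seqP szs sE.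
  by rewrite -def_s wordv_gword -rowE rowK.
by rewrite !wordv_out ?mul0mx // size_map allw.
Qed.

Lemma tens_mx_repr : mx_repr W tens_mx.
Proof.
split.
  apply/row_matrixP=> i; rewrite rowK row1 -wordv_gword; congr wordv.
  by rewrite -[RHS]map_id; apply: eq_map => x; apply: act1.
move=> x y Wx Wy; apply/row_matrixP=> i; rewrite row_mul !rowK wordv_tens //.
by rewrite -map_comp; congr wordv; apply: eq_map => z /=; apply: actMin.
Qed.

Definition tens_repr := MxRepresentation tens_mx_repr.

Lemma circuit_act w (C : {set I}) : w \in W -> circuit M C ->
  circuit M (setact (eact em) C w).
Proof.
move=> Ww.
have dep_act u (A : {set I}) : u \in W -> dependent M A ->
    dependent M (setact (eact em) A u).
  move=> Wu /andP[sA dA]; rewrite /dependent card_setact eact_rank // dA andbT.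
  apply/subsetP=> _ /imsetP[x Ax ->]; rewrite eact_in //; exact: (subsetP sA).
case/minsetP=> dC minC; apply/minsetP; split; first exact: dep_act.
move=> B dB sBC.
have Wv : w^-1%g \in W by rewrite groupV.
have BK : setact (eact em) (setact (eact em) B w^-1%g) w = B.
  by have := actKVin (set_action (eact em)) Ww B.
have CK : setact (eact em) (setact (eact em) C w) w^-1%g = C.
  by have := actKin (set_action (eact em)) Ww C.
rewrite -[LHS]BK; congr (setact _ _ _); apply: minC; first exact: dep_act.
by have := imsetS (eact em ^~ w^-1%g) sBC; rewrite -!/(setact _ _ _) CK.
Qed.

Lemma os_ideal_sub (U : 'rV[algC]_#|{: gword}|) :
  (exists (a b : {bseq p of I}),
     (exists i j, [/\ i \in ground M, j \in ground M & U = ext_rel a b i j])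
   \/ (exists c : {bseq p.+1 of I},
         [/\ uniq c, circuit M [set x in c] & U = os_rel a b c])) ->
  (U <= os_ideal)%MS.
Proof.
case=> a [b h]; rewrite /os_ideal.
apply: (sumsmx_sup a) => //; apply: (sumsmx_sup b) => //.
case: h => [[i [j [Ei Ej ->]]]|[c [uc Cc ->]]].
  apply: submx_trans (addsmxSl _ _).
  by apply: (sumsmx_sup i) => //; apply: (sumsmx_sup j) => //; rewrite genmxE.
apply: submx_trans (addsmxSr _ _).
by apply: (sumsmx_sup c); rewrite ?uc // genmxE.
Qed.

Lemma os_ideal_mod : mxmodule tens_repr os_ideal.
Proof.
apply/mxmoduleP=> w Ww; rewrite /= {1}/os_ideal.
pose aw n (s : {bseq n of I}) : {bseq n of I} :=
  insub_bseq n [seq eact em x w | x <- s].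
have awE n (s : {bseq n of I}) : aw n s = [seq eact em x w | x <- s] :> seq I.
  by rewrite /aw /insub_bseq val_insubd size_map size_bseq.
rewrite sumsmxMr; apply/sumsmx_subP=> a _.
rewrite sumsmxMr; apply/sumsmx_subP=> b _.
rewrite addsmxMr addsmx_sub; apply/andP; split.
  rewrite sumsmxMr; apply/sumsmx_subP=> i Ei.
  rewrite sumsmxMr; apply/sumsmx_subP=> j Ej.
  rewrite (eqmxMr _ (genmxE _)); apply: os_ideal_sub.
  exists (aw _ a), (aw _ b); left; exists (eact em i w), (eact em j w).
  rewrite !eact_in //; split=> //.
  by rewrite /ext_rel mulmxDl !wordv_tens // !map_cat !awE.
rewrite sumsmxMr; apply/sumsmx_subP=> c /andP[uc Cc].
rewrite (eqmxMr _ (genmxE _)); apply: os_ideal_sub.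
exists (aw _ a), (aw _ b); right; exists (aw _ c); split.
- by rewrite awE map_inj_uniq //; apply: act_inj.
- have := circuit_act Ww Cc; congr (circuit M _).
  apply/setP=> x; rewrite inE.
  have -> : (x \in aw p.+1 c) = (x \in [seq eact em y w | y <- c]) by rewrite -awE.
  apply/imsetP/mapP => -[y].
    by rewrite inE => cy ->; exists y.
  by move=> cy ->; exists y; rewrite ?inE.
rewrite /os_rel mulmx_suml awE size_map; apply: eq_bigr => k _.
rewrite -scalemxAl wordv_tens //; congr (_ *: wordv _).
by rewrite !map_cat !awE map_take map_drop.
Qed.

Definition os_repr := factmod_repr os_ideal_mod.

Definition os_char : 'CF(W) := cfRepr os_repr.

End OrlikSolomon.

(* grVRep(W) is the subring of {poly 'CF(W)} of polynomials whose coefficients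
   are virtual characters. *)
Definition is_grVRep (gT : finGroupType) (W : {group gT}) (f : {poly 'CF(W)}) :=
  f \is a polyOver 'Z[irr W].

Definition equiv_charpoly (gT : finGroupType) (W : {group gT}) (I : finType)
    (em : equivMatroid W I) : {poly 'CF(W)} :=
  let r := mrk (emat em) in
  \sum_(p < r.+1) ((-1) ^+ p * os_char em p) *: 'X^(r - p).

(* t^r f(t^-1), for f of degree at most r *)
Definition poly_rev (R : nzRingType) (r : nat) (f : {poly R}) : {poly R} :=
  \poly_(i < r.+1) f`_(r - i).

(* f is a homomorphism W' -> W when f @* W' is contained in W. *)
Definition cfPullback (gT' gT : finGroupType) (W' : {group gT'})
    (W : {group gT}) (f : {morphism W' >-> gT}) (chi : 'CF(W)) : 'CF(W') :=
  cfMorph ('Res[f @* W'] chi).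

Definition KL_assignment :=
  forall (gT : finGroupType) (W : {group gT}) (I : finType),
    equivMatroid W I -> {poly 'CF(W)}.

(* The conditions that characterize P uniquely; they concern loopless matroids
   only, and the values of P on matroids with loops are junk. *)
Record is_equivariant_KL (P : KL_assignment) : Prop := IsEquivariantKL {
  eKL_grVRep : forall (gT : finGroupType) (W : {group gT}) (I : finType)
      (em : equivMatroid W I),
    loopless (emat em) -> is_grVRep (P gT W I em);
  eKL_rank0 : forall (gT : finGroupType) (W : {group gT}) (I : finType)
      (em : equivMatroid W I),
    loopless (emat em) -> mrk (emat em) = 0%N -> P gT W I em = 1;
  eKL_degree : forall (gT : finGroupType) (W : {group gT}) (I : finType)
      (em : equivMatroid W I),
    loopless (emat em) -> (0 < mrk (emat em))%N ->
    (2 * (size (P gT W I em)).-1 < mrk (emat em))%N;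
  eKL_recursion : forall (gT : finGroupType) (W : {group gT}) (I : finType)
      (em : equivMatroid W I),
    loopless (emat em) ->
    poly_rev (mrk (emat em)) (P gT W I em) =
      \sum_(F in orbit_transversal (eact em)^* W (flats (emat em)))
         map_poly 'Ind[W, flat_stab em F]
           (equiv_charpoly (em_local em F) * P _ _ _ (em_contract em F));
  eKL_pullback : forall (gT' gT : finGroupType) (W' : {group gT'})
      (W : {group gT}) (I : finType) (em' : equivMatroid W' I)
      (em : equivMatroid W I) (f : {morphism W' >-> gT}),
    loopless (emat em) -> emat em' = emat em -> f @* W' \subset W ->
    (forall w x, w \in W' -> x \in ground (emat em) ->
       eact em' x w = eact em x (f w)) ->
    P gT' W' I em' = map_poly (cfPullback f) (P gT W I em) }.

Section AddEdge.
Variables (T : finType) (e e' : rel T) (a b : T).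
Hypotheses (sym_e : symmetric e) (sym_e' : symmetric e').
Hypothesis e'E : forall x y,
  e' x y = [|| e x y, (x == a) && (y == b) | (x == b) && (y == a)].

Let ce : connect_sym e := sym_connect_sym sym_e.
Let ce' : connect_sym e' := sym_connect_sym sym_e'.

Let sub_ee' : subrel (connect e) (connect e').
Proof. by apply: connect_sub => x y exy; apply: connect1; rewrite e'E exy. Qed.

Let ab' : connect e' a b.
Proof. by apply: connect1; rewrite e'E !eqxx orbT. Qed.

Let e'_connect x y : connect e' x y =
  [|| connect e x y, connect e x a && connect e b y
    | connect e x b && connect e a y].
Proof.
apply/idP/idP; last first.
  case/or3P=> [|/andP[xa b_y]|/andP[xb ay]]; first exact: sub_ee'.
    by apply: connect_trans (sub_ee' xa) (connect_trans ab' (sub_ee' b_y)).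
  apply: connect_trans (sub_ee' xb) (connect_trans _ (sub_ee' ay)).
  by rewrite ce'.
case/connectP=> p e'p ->; elim: p x e'p => [|z p IHp] x /=.
  by rewrite connect0.
case/andP; rewrite e'E => /or3P[exz|/andP[/eqP-> /eqP->]|/andP[/eqP-> /eqP->]] /IHp.
- have xz := connect1 exz.
  by case/or3P=> [zy|/andP[za ->]|/andP[zb ->]];
    rewrite ?(connect_trans xz zy) ?(connect_trans xz za) ?(connect_trans xz zb) ?orbT.
- rewrite !connect0 /=; case/or3P=> [->|/andP[_ ->]|->];
    by rewrite ?orbT.
rewrite !connect0 /=; case/or3P=> [->|->|/andP[_ ->]];
  by rewrite ?orbT.
Qed.

Lemma n_comp_add_edge : n_comp e T = (n_comp e' T + ~~ connect e a b)%N.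
Proof.
have [eab|neab] := boolP (connect e a b).
  rewrite addn0; apply: eq_n_comp => x y; rewrite e'_connect.
  apply/idP/idP=> [->//|/or3P[//|/andP[xa b_y]|/andP[xb ay]]].
    by apply: connect_trans xa (connect_trans eab b_y).
  by apply: connect_trans xb (connect_trans _ ay); rewrite ce.
pose C := connect e' a.
have CE x : (x \in C) = connect e a x || connect e b x.
  rewrite [LHS]e'_connect connect0 /= (negPf neab) /= orbF.
  by [].
rewrite (n_compC C e) (n_compC C e') (n_comp_connect ce' a).
have -> : n_comp e C = 2%N.
  have -> : n_comp e C = n_comp e (closure e (pred2 a b)).
    apply: eq_n_comp_r => x; rewrite CE.
    apply/orP/pred0Pn => [[ax|bx]|[y /andP[xy /pred2P[] ey]]].
    - by exists a; rewrite /= !inE eqxx andbT ce.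
    - by exists b; rewrite /= !inE eqxx orbT andbT ce.
    - by left; rewrite ce -ey.
    by right; rewrite ce -ey.
  by rewrite (n_comp_closure2 ce) (negPf neab).
rewrite addnAC; congr (_ + _)%N.
apply: eq_card => x; rewrite !inE -![C x]/(x \in C).
case Cx: (x \in C); rewrite ?andbF //= !andbT /roots /root.
have /negbT := Cx; rewrite CE negb_or => /andP[nax nbx].
congr (odflt x _ == x); apply: eq_pick => y /=.
by rewrite e'_connect (ce x a) (ce x b) (negPf nax) (negPf nbx) /= orbF.
Qed.

End AddEdge.

Section Braid.
Variable n : nat.
Implicit Types (A B C : {set {set 'I_n}}) (i j : 'I_n).

Definition edges : {set {set 'I_n}} := [set e : {set 'I_n} | #|e| == 2].

Definition adjacent A : rel 'I_n := fun i j => [set i; j] \in A.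

(* The parts of the flat spanned by A are the connected components of ([n], A). *)
Definition graph_rank A : nat := n - n_comp (adjacent A) 'I_n.

Lemma adjacent_sym A : symmetric (adjacent A).
Proof. by move=> i j; rewrite /adjacent setUC. Qed.

Lemma n_comp_le A : (n_comp (adjacent A) 'I_n <= n)%N.
Proof. by rewrite -[X in (_ <= X)%N]card_ord max_card. Qed.

Lemma graph_rank_set0 : graph_rank set0 = 0%N.
Proof.
apply/eqP; rewrite subn_eq0 -[X in (X <= _)%N]card_ord; apply: subset_leq_card.
apply/subsetP=> i _; rewrite !inE andbT.
have /connectP[[|k p] /=] := connect_root (adjacent set0) i.
  by move=> _ ri; rewrite /roots ri.
by rewrite /adjacent in_set0.
Qed.

Lemma graph_rank_setU1 A i j : i != j ->
  graph_rank ([set i; j] |: A)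
    = (graph_rank A + ~~ connect (adjacent A) i j)%N.
Proof.
move=> ij; have := n_comp_le A; rewrite /graph_rank.
rewrite (@n_comp_add_edge _ (adjacent A) (adjacent ([set i; j] |: A)) i j).
- move=> le; rewrite subnDA subnK // leq_subRL ?(leq_trans _ le) ?leq_addr //.
- exact: adjacent_sym.
- exact: adjacent_sym.
move=> x y; rewrite /adjacent in_setU1 orbC; congr (_ || _).
apply/eqP/orP => [def|]; last first.
  by case=> /andP[/eqP-> /eqP->] //; rewrite setUC.
have xij : x \in [set i; j] by rewrite -def set21.
have yij : y \in [set i; j] by rewrite -def set22.
have ixy : i \in [set x; y] by rewrite def set21.
have jxy : j \in [set x; y] by rewrite def set22.
case/set2P: xij ixy jxy => ->; case/set2P: yij => ->;
  rewrite !inE ?eqxx ?orbb ?andbT; auto.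
- by move=> _ /eqP ji; rewrite ji eqxx in ij.
- by move=> /eqP ji; rewrite ji eqxx in ij.
Qed.

Lemma edgesP e : e \in edges -> exists i j, i != j /\ e = [set i; j].
Proof. by rewrite inE => /cards2P[i [j [ij ->]]]; exists i, j. Qed.

Lemma graph_rankU1 A e : e \in edges ->
  (graph_rank A <= graph_rank (e |: A) <= (graph_rank A).+1)%N.
Proof.
case/edgesP=> i [j [ij ->]]; rewrite graph_rank_setU1 // leq_addr.
by rewrite -addn1 leq_add2l leq_b1.
Qed.

Lemma graph_rank_diminish A B e : A \subset B -> e \in edges ->
  (graph_rank (e |: B) + graph_rank A <= graph_rank (e |: A) + graph_rank B)%N.
Proof.
move=> sAB /edgesP[i [j [ij ->]]]; rewrite !graph_rank_setU1 //.
rewrite addnAC addnC [X in (_ <= X)%N]addnAC [X in (_ <= X)%N]addnC.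
rewrite [(graph_rank B + _)%N]addnC leq_add2r.
case cA: (connect (adjacent A) i j); rewrite ?leq_b1 //.
suff -> : connect (adjacent B) i j by [].
apply: connect_sub cA => x y Axy; apply: connect1.
exact: (subsetP sAB) Axy.
Qed.

Lemma graph_rank_ind A (P : {set {set 'I_n}} -> Prop) : A \subset edges ->
  P set0 -> (forall B e, e \in edges -> e \notin B -> P B -> P (e |: B)) -> P A.
Proof.
move=> + P0 PU; elim: {A}_.+1 {-2}A (ltnSn #|A|) => // m IHm A leAm sA.
have [->//|[e Ae]] := set_0Vmem A.
have Ee := subsetP sA e Ae.
rewrite -(setD1K Ae); apply: PU; rewrite ?setD11 //; apply: IHm.
  by move: leAm; rewrite (cardsD1 e A) Ae ltnS.
exact: subset_trans (subD1set A e) sA.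
Qed.

Lemma graph_rank_le_card A : A \subset edges -> (graph_rank A <= #|A|)%N.
Proof.
move=> sA; apply: (graph_rank_ind (P := fun A => graph_rank A <= #|A|)%N sA); first by rewrite graph_rank_set0.
move=> B e Ee nBe IH; rewrite cardsU1 nBe add1n.
by case/andP: (graph_rankU1 B Ee) => _ /leq_trans; apply.
Qed.

Lemma graph_rank_mono A B : A \subset B -> B \subset edges ->
  (graph_rank A <= graph_rank B)%N.
Proof.
move=> sAB sB; rewrite -(setUidPr sAB) setUC.
apply: (graph_rank_ind (P := fun B => graph_rank A <= graph_rank (B :|: A))%N sB);
  first by rewrite set0U.
move=> C e Ee _ IH; rewrite -setUA; apply: leq_trans IH _.
by case/andP: (graph_rankU1 (C :|: A) Ee).
Qed.

Lemma graph_rank_submod A B : A \subset edges -> B \subset edges ->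
  (graph_rank (A :|: B) + graph_rank (A :&: B)
     <= graph_rank A + graph_rank B)%N.
Proof.
move=> _ sB; suff : forall C, C \subset edges ->
    (graph_rank (C :|: A) + graph_rank (A :&: B)
       <= graph_rank A + graph_rank (C :|: A :&: B))%N.
  move/(_ B sB); rewrite [B :|: A]setUC.
  by rewrite (setUidPl (subsetIr A B)).
move=> C sC; pose P D := (graph_rank (D :|: A) + graph_rank (A :&: B)
  <= graph_rank A + graph_rank (D :|: A :&: B))%N.
apply: (graph_rank_ind (P := P) sC); rewrite /P; first by rewrite !set0U.
move=> D e Ee _ IH; rewrite -!setUA.
have sD : D :|: A :&: B \subset D :|: A by rewrite setUS ?subsetIl.
have := graph_rank_diminish sD Ee.
rewrite -(leq_add2r (graph_rank (A :&: B))) => le1.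
rewrite -(leq_add2r (graph_rank (e |: (D :|: A :&: B)))) in IH.
rewrite -(leq_add2r (graph_rank (D :|: A :&: B))) addnAC.
apply: leq_trans le1 _; rewrite -addnA addnC; apply: leq_trans IH _.
by rewrite addnAC.
Qed.

Definition braid_matroid : matroid {set 'I_n} :=
  Matroid graph_rank_le_card graph_rank_mono graph_rank_submod.

Definition edge_act : action [set: 'S_n]%G {set 'I_n} :=
  ((perm_action 'I_n)^*)%act.

Lemma edge_act_ground :
  [acts [set: 'S_n]%G, on ground braid_matroid | edge_act].
Proof.
apply/subsetP=> w _; rewrite /astabs in_setI in_setT inE /=.
by apply/subsetP=> e; rewrite !inE card_setact.
Qed.

Lemma adjacent_act A (w : 'S_n) i j :
  adjacent (setact edge_act A w) (w i) (w j) = adjacent A i j.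
Proof.
have -> : adjacent A i j = (edge_act [set i; j] w \in setact edge_act A w).
  by rewrite -[RHS]/(edge_act^~ w [set i; j] \in edge_act^~ w @: A) mem_imset //;
    apply: act_inj.
by rewrite /adjacent /= /setact imsetU !imset_set1.
Qed.

Lemma edge_act_rank (w : 'S_n) A :
    w \in [set: 'S_n]%G -> A \subset ground braid_matroid ->
  mrank braid_matroid (setact edge_act A w) = mrank braid_matroid A.
Proof.
move=> _ _ /=; rewrite /graph_rank; congr (n - _)%N.
have sym B : connect_sym (adjacent B) := sym_connect_sym (@adjacent_sym B).
have cl : closed (adjacent (setact edge_act A w)) (mem 'I_n) by [].
rewrite (@adjunction_n_comp _ _ (fun i => w i) _ (adjacent A) (sym _) (sym A) _ cl) //.
apply: strict_adjunction => //; first exact: perm_inj.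
  by apply/subsetP=> i _; rewrite -[i](permKV w) codom_f.
by move=> i j _ /=; rewrite adjacent_act.
Qed.

Definition braid : equivMatroid [set: 'S_n]%G {set 'I_n} :=
  EquivMatroid edge_act_ground edge_act_rank.

End Braid.

(* Lambda[t], with scalars extended to algC, as the polynomial ring
   algC[t][p_1, p_2, ...] in the power sums; the variable of index i : nat
   is p_(i+1). *)
Definition symf := {malg {poly algC}[{cmonom nat}]}.

Definition psum (k : nat) : symf := << ucm k.-1 >>.

Definition monom_degree (m : {cmonom nat}) : nat :=
  \sum_(i <- finsupp m) m i * i.+1.

Definition symf_part (n : nat) (f : symf) : symf :=
  \sum_(m <- msupp f | monom_degree m == n) << f@_m *g m >>.

Definition monom_eval (S : comNzRingType) (v : nat -> S) (m : {cmonom nat}) : S :=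
  \prod_(i <- finsupp m) v i ^+ m i.

(* p_k[g]: the substitution p_j := p_(jk), t := t^k *)
Definition psum_plethysm (k : nat) (g : symf) : symf :=
  mmap (fun c : {poly algC} => (c \Po 'X^k)%:MP)
       (monom_eval (fun i => psum (i.+1 * k))) g.

Definition plethysm (f g : symf) : symf :=
  mmap (fun c : {poly algC} => c%:MP)
       (monom_eval (fun i => psum_plethysm i.+1 g)) f.

(* The completion of symf for the grading: an element is the sequence of its
   homogeneous components. *)
Definition csymf := nat -> symf.

(* f[g] for g without constant term: f_i[g] starts in degree i, and the
   components of g of degree > n do not affect degrees <= n. *)
Definition cplethysm (f g : csymf) : csymf := fun n =>
  symf_part n (plethysm (\sum_(i < n.+1) f i) (\sum_(i < n.+1) g i)).

Definition gr_value (gT : finGroupType) (W : {group gT}) (w : gT)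
    (f : {poly 'CF(W)}) : {poly algC} :=
  map_poly (fun chi : 'CF(W) => chi w) f.

(* (1 / n!) times the sum over w of chi(w) p_(cycle type of w) *)
Definition frob_ch (n : nat) (f : {poly 'CF([set: 'S_n])}) : symf :=
  ((n`!%:R : algC)^-1)%:P *:
    \sum_(w : 'S_n) gr_value w f *: \prod_(c in porbits w) psum #|c|.

Definition ch_series (f : forall n, {poly 'CF([set: 'S_n])}) : csymf := fun n =>
  if n == 0%N then 0 else frob_ch (f n).

Definition gr_dim (gT : finGroupType) (W : {group gT}) (f : {poly 'CF(W)}) :
    {poly algC} := gr_value 1%g f.

Definition ratfun := {fraction {poly algC}}.

Definition tvar : ratfun := tofrac 'X.

(* Power series in z, as sequences of coefficients *)
Definition fps (R : nzRingType) := nat -> R.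

(* f(g(z)), for g without constant term *)
Definition fps_comp (R : nzRingType) (f g : fps R) : fps R := fun n =>
  ((\poly_(i < n.+1) f i) \Po (\poly_(i < n.+1) g i))`_n.

(* The series c z *)
Definition fps_cz (R : nzRingType) (c : R) : fps R := fun n =>
  if n == 1%N then c else 0.

Definition fps_scale (R : nzRingType) (c : R) (f : fps R) : fps R := fun n =>
  c * f n.

(* The sum of a_n(u) z^n / n! over n >= 1, where a_n(u) is the value at t = u of
   the graded dimension a_n(t) of f n *)
Definition dim_egf (f : forall n, {poly 'CF([set: 'S_n])}) (u : ratfun) :
    fps ratfun := fun n =>
  if n == 0%N then 0
  else (map_poly (fun c : algC => tofrac c%:P) (gr_dim (f n))).[u] / n`!%:R.

Definition braid_K (n : nat) : {poly 'CF([set: 'S_n])} :=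
  equiv_charpoly (braid n).

Definition braid_Q (P : KL_assignment) (n : nat) : {poly 'CF([set: 'S_n])} :=
  P _ _ _ (braid n).

Definition braid_Qbar (P : KL_assignment) (n : nat) : {poly 'CF([set: 'S_n])} :=
  poly_rev n.-1 (braid_Q P n).

(* Main.v *)
Require Import Defs.
From HB Require Import structures.
From mathcomp Require Import all_boot all_order all_fingroup all_algebra.
From mathcomp Require Import all_solvable all_field all_character.

(* The Orlik-Solomon complex of a loopless matroid of positive rank is exact
   (multiplication by e_x is a contraction), and the Orlik-Solomon algebra is the
   direct sum over the flats F of the top degree parts for M_F.  Taking traces of
   w, the coefficients of the equivariant characteristic polynomial at w are the
   Moebius numbers mu(0, F) of the lattice of w-stable flats.  So the
   characteristic polynomial, and by uniqueness in the recursion also the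
   Kazhdan-Lusztig polynomial, evaluated at w only depend on the lattice of flats
   with its automorphism w; the contraction of B_n by a partition into k parts
   can be replaced by B_k.

   For a set C with a permutation g such that g^d has q^d fixed points, Moebius
   inversion shows that q^k H(q), for H the characteristic polynomial of the
   restriction of B_n to the kernel of a surjection f : [n] -> [k] evaluated at w,
   is the number of maps phi : [n] -> C with phi w = g phi for which (f, phi) is
   injective.  If f w = u f, then (f, phi) identifies [n] with a subset of
   [k] x C stable under u x g and meeting all fibers over [k], and w with the
   restriction of u x g to this subset.  Such a subset amounts to the choice,
   for each cycle c of u, of a nonempty g^|c|-stable subset of C; the product over
   the cycles of u is the plethystic side evaluated at t = q. *)

(** Frobenius characteristics and graded dimensions only see values at group elements, and the
    coefficients to be compared are polynomials in t; it therefore suffices to evaluate them at the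
    positive integers q, where both sides count the same sets. The number q^k H(q) is a twisted
    chromatic polynomial: the graph of all pairs inside the fibers of f has k components, whence the
    power q^k, of which each cycle c of u absorbs q^|c|. A cycle of length d of u calls for the
    substitutions t -> t^d and p_j -> p_(jd) of plethysm. The former is the passage from g to g^d,
    provided that g^d has q^d fixed points; the latter comes from the return time d to a point of
    the cycle. Words of length N over q letters under the cyclic shift provide such a g for all d
    dividing N. The choice N = n!^2 makes N/d a period of all permutations of at most n letters as
    well, for every d up to n. Flats are summed over as labelled partitions because the labels turn
    w into an explicit permutation u of the parts, at which Q_k can be evaluated. The composition
    formula for dimensions is the image of the plethystic one under p_1 = z and p_k = 0 for k >
    1. *)

Set Implicit Arguments.
Unset Strict Implicit.
Unset Printing Implicit Defensive.
Import Order.TTheory GRing.Theory Num.Theory.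
Local Open Scope ring_scope.

(** * Orlik-Solomon algebras *)

Section QuotientMap.
Variable F : fieldType.

(* The map V/A -> W/B induced by f, in coordinates of the quotients. *)
Definition qmx m n (A : 'M[F]_m) (B : 'M[F]_n) (f : 'M[F]_(m, n)) :=
  in_factmod B (val_factmod (1%:M : 'M_(\rank (cokermx A))) *m f).

Lemma val_in_factmod_sub m (A : 'M[F]_m) k (x : 'M_(k, m)) :
  (val_factmod (in_factmod A x) - x <= A)%MS.
Proof. by rewrite -in_factmod_eq0 linearB /= val_factmodK subrr. Qed.

(** Passing to [W/B] and back moves a vector by an element of [B], which [g] sends into [C]. *)
Lemma qmxM m n p (A : 'M_m) (B : 'M_n) (C : 'M_p) (f : 'M_(m, n)) (g : 'M_(n, p)) :
  (B *m g <= C)%MS -> qmx A B f *m qmx B C g = qmx A C (f *m g).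
Proof.
move=> sBg; rewrite /qmx; set x := val_factmod 1%:M.
have -> : in_factmod B (x *m f) *m in_factmod C (val_factmod 1%:M *m g)
    = in_factmod C (val_factmod (in_factmod B (x *m f)) *m g).
  by rewrite [in RHS]val_factmodE [LHS]mulmxA mulmxA -[RHS]mulmxA /in_factmod /= !mulmxA.
apply/eqP; rewrite -subr_eq0 -linearB /= mulmxA -mulmxBl in_factmod_eq0.
by apply: submx_trans sBg; apply: submxMr; apply: val_in_factmod_sub.
Qed.

Lemma qmx_eq m n (A : 'M_m) (B : 'M_n) (f g : 'M_(m, n)) :
  (f - g <= B)%MS -> qmx A B f = qmx A B g.
Proof.
move=> sfg; apply/eqP; rewrite -subr_eq0 -linearB /= -mulmxBr in_factmod_eq0.
exact: submx_trans (submxMl _ _) sfg.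
Qed.

Lemma qmx1 m (A : 'M_m) : qmx A A 1%:M = 1%:M.
Proof. by rewrite /qmx mulmx1 val_factmodK. Qed.

Lemma qmxD m n (A : 'M_m) (B : 'M_n) (f g : 'M_(m, n)) :
  qmx A B (f + g) = qmx A B f + qmx A B g.
Proof. by rewrite /qmx mulmxDr linearD. Qed.

Lemma qmx0 m n (A : 'M_m) (B : 'M_n) : qmx A B 0 = 0.
Proof. by rewrite /qmx mulmx0 linear0. Qed.

Lemma qmx_sum m n (A : 'M_m) (B : 'M_n) (I : Type) (r : seq I) (Q : pred I)
    (f : I -> 'M_(m, n)) :
  qmx A B (\sum_(i <- r | Q i) f i) = \sum_(i <- r | Q i) qmx A B (f i).
Proof. by rewrite /qmx mulmx_sumr linear_sum. Qed.

End QuotientMap.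

(** * The boundary on words *)

Section Boundary.
Variables (R : comNzRingType) (I : eqType).

(* The transpose of the boundary on words: [bd f s] is the alternating sum of
   the values of f at s with one letter deleted. *)
Fixpoint bd (V : lmodType R) (f : seq I -> V) (s : seq I) : V :=
  if s is x :: s' then f s' - bd (fun u => f (x :: u)) s' else 0.

Variable V : lmodType R.
Implicit Types (f g : seq I -> V) (s a b : seq I).

Lemma eq_bd f g s : f =1 g -> bd f s = bd g s.
Proof.
elim: s f g => //= x s IH f g fg; rewrite fg; congr (_ - _); apply: IH => u; exact: fg.
Qed.

Lemma bdE f s :
  bd f s = \sum_(k < size s) (-1) ^+ k *: f (take k s ++ drop k.+1 s).
Proof.
elim: s f => [|x s IH] f /=; first by rewrite big_ord0.
rewrite big_ord_recl /= expr0 scale1r drop0 IH -sumrN; congr (_ + _).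
by apply: eq_bigr => k _; rewrite exprS mulN1r scaleNr.
Qed.

Lemma bd_cat f a b : bd f (a ++ b) =
  bd (fun u => f (u ++ b)) a + (-1) ^+ size a *: bd (fun u => f (a ++ u)) b.
Proof.
elim: a f => [|x a IH] f /=; first by rewrite expr0 scale1r add0r; apply: eq_bd.
rewrite IH opprD addrA exprS mulN1r scaleNr; congr (_ - _ *: _); exact: eq_bd.
Qed.

Lemma bdD f g s : bd (fun u => f u + g u) s = bd f s + bd g s.
Proof.
elim: s f g => [|x s IH] f g /=; first by rewrite addr0.
by rewrite IH opprD addrACA.
Qed.

Lemma bdN f s : bd (fun u => - f u) s = - bd f s.
Proof. by elim: s f => [|x s IH] f /=; rewrite ?oppr0 // IH opprB opprK addrC. Qed.

Lemma bdZ c f s : bd (fun u => c *: f u) s = c *: bd f s.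
Proof. by elim: s f => [|x s IH] f /=; rewrite ?scaler0 // IH scalerBr. Qed.

Lemma bd_bd f s : bd (bd f) s = 0.
Proof.
elim: s f => //= x s IH f.
by rewrite bdD bdN IH oppr0 addr0 subrr.
Qed.

(** Deletions in two separate factors of a word commute. This lets the boundary of a relation pass
    the boundary of the word before or after it. *)
Lemma bd_exchange (f : seq I -> seq I -> V) a b :
  bd (fun u => bd (f u) b) a = bd (fun v => bd (fun u => f u v) a) b.
Proof.
rewrite !bdE (eq_bigr (fun k : 'I_(size a) => \sum_(l < size b)
  (-1) ^+ k *: ((-1) ^+ l *: f (take k a ++ drop k.+1 a) (take l b ++ drop l.+1 b)))).
  rewrite exchange_big; apply: eq_bigr => l _; rewrite bdE scaler_sumr.
  by apply: eq_bigr => k _; rewrite !scalerA mulrC.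
by move=> k _; rewrite bdE scaler_sumr.
Qed.

Lemma size_del s (k : 'I_(size s)) : size (take k s ++ drop k.+1 s) = (size s).-1.
Proof.
rewrite size_cat size_takel ?size_drop 1?ltnW //.
by case: (size s) k => [|m] [k /= lek] //; rewrite subSS subnKC.
Qed.

Lemma eq_bd_del f g s :
  (forall u, size u = (size s).-1 -> {subset u <= s} -> f u = g u) -> bd f s = bd g s.
Proof.
move=> fg; rewrite !bdE; apply: eq_bigr => k _; rewrite fg ?size_del // => y.
by rewrite mem_cat => /orP[/mem_take|/mem_drop].
Qed.

End Boundary.

Lemma bd_linear (R : comNzRingType) (I : eqType) (V V' : lmodType R)
    (h : {linear V -> V'}) (f : seq I -> V) s :
  h (bd f s) = bd (fun u => h (f u)) s.
Proof.
elim: s f => [|x s IH] f /=; first by rewrite linear0.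
by rewrite linearB IH.
Qed.

Lemma bd_in (R : comNzRingType) (I : eqType) (V : lmodType R) (S : V -> Prop)
    (f : seq I -> V) s :
  S 0 -> (forall u v, S u -> S v -> S (u - v)) ->
  (forall k, (k < size s)%N -> S (f (take k s ++ drop k.+1 s))) -> S (bd f s).
Proof.
move=> S0 SB; elim: s f => //= x s IH f Sf; apply: SB.
  by have := Sf 0%N isT; rewrite /= drop0.
by apply: IH => k lks; apply: (Sf k.+1).
Qed.

(** * Rank, closure and circuits *)

Section MatroidClosure.
Variables (I : finType) (M : matroid I).
Implicit Types (A B C F X : {set I}).

Local Notation E := (ground M).
Local Notation r := (mrank M).

Lemma mrank_setU_eq A B X : A \subset B -> B \subset E -> X \subset E ->
  r A = r B -> r (X :|: A) = r (X :|: B).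
Proof.
move=> sAB sB sX eqr; have sA := subset_trans sAB sB.
apply/eqP; rewrite eqn_leq mrank_mono ?setUS ?subUset ?sX //=.
have sXA : X :|: A \subset E by rewrite subUset sX.
have := mrank_submod sXA sB; rewrite -setUA (setUidPr sAB) -eqr => le.
have : (r A <= r ((X :|: A) :&: B))%N.
  by apply: mrank_mono; rewrite ?subsetI ?sAB ?subsetUr // (subset_trans (subsetIr _ _)).
by move=> le'; rewrite -(leq_add2r (r A)); apply: leq_trans le; rewrite leq_add2l.
Qed.

Lemma flatP F : reflect (F \subset E /\
  forall x, x \in E -> x \notin F -> (r F < r (x |: F))%N) (flat M F).
Proof.
apply: (iffP andP) => -[sF hF]; split=> //.
  by move=> x Ex nFx; apply: (forall_inP hF); rewrite inE nFx.
by apply/forall_inP=> x; rewrite inE => /andP[nFx Ex]; apply: hF.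
Qed.

Lemma flat_sub F : flat M F -> F \subset E. Proof. by case/andP. Qed.

Lemma flat_ground : flat M E.
Proof. by apply/flatP; split=> // x ->. Qed.

Lemma mem_flat F A x : flat M F -> A \subset F -> x \in E ->
  r (x |: A) = r A -> x \in F.
Proof.
move=> /flatP[sF hF] sAF Ex eqr; apply: contraT => /(hF x Ex).
have sxA : x |: A \subset E by rewrite subUset sub1set Ex (subset_trans sAF).
have := mrank_setU_eq (subsetUr [set x] A) sxA sF (esym eqr).
rewrite (setUidPl sAF) setUCA (setUidPl sAF) => <-.
by rewrite ltnn.
Qed.

Definition mclosure A : {set I} := [set x in E | r (x |: A) == r A].

Lemma sub_mclosure A : A \subset E -> A \subset mclosure A.
Proof.
move=> sA; apply/subsetP=> x Ax.
by rewrite inE (subsetP sA) // (setUidPr _) ?sub1set //=.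
Qed.

Lemma mclosure_sub A : mclosure A \subset E.
Proof. by apply/subsetP=> x; rewrite inE => /andP[]. Qed.

Lemma mrank_mclosure A : A \subset E -> r (mclosure A) = r A.
Proof.
move=> sA; rewrite -(setUidPr (sub_mclosure sA)).
suff : forall s : seq I, {subset s <= mclosure A} -> r (A :|: [set x in s]) = r A.
  move/(_ (enum (mclosure A))) => <-; last by move=> x; rewrite mem_enum.
  by congr (r (_ :|: _)); apply/setP=> x; rewrite inE mem_enum.
elim=> [|x s IH] ss; first by rewrite set_nil setU0.
have sub y : y \in x :: s -> y \in mclosure A by apply: ss.
have := sub x (mem_head _ _); rewrite inE => /andP[Ex /eqP rx].
have ssE : [set y in s] \subset E.
  apply/subsetP=> y; rewrite inE => sy.
  by apply: (subsetP (mclosure_sub A)); apply: sub; rewrite inE sy orbT.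
rewrite set_cons setUCA -[RHS]IH; last by move=> y sy; apply: sub; rewrite inE sy orbT.
rewrite setUA [in RHS]setUC setUC; apply: esym; apply: mrank_setU_eq => //.
- exact: subsetUr.
- by rewrite subUset sub1set Ex.
Qed.

Lemma mclosure_flat A : A \subset E -> flat M (mclosure A).
Proof.
move=> sA; apply/flatP; split=> [|x Ex]; first exact: mclosure_sub.
rewrite inE Ex mrank_mclosure //= eq_sym => ner.
have le1 : (r A <= r (x |: A))%N.
  by rewrite mrank_mono ?subsetUr // subUset sub1set Ex.
apply: (@leq_trans (r (x |: A))); first by rewrite ltn_neqAle ner.
rewrite mrank_mono ?setUS ?sub_mclosure // subUset sub1set Ex; exact: mclosure_sub.
Qed.

Lemma mclosureE F A : flat M F -> A \subset F -> r A = r F -> mclosure A = F.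
Proof.
move=> fF sAF eqr; have sF := flat_sub fF; apply/setP=> x; apply/idP/idP.
  by rewrite inE => /andP[Ex /eqP]; apply: mem_flat.
move=> Fx; rewrite inE (subsetP sF) //= eqn_leq {1}eqr.
rewrite !mrank_mono ?subsetUr // ?subUset ?sub1set ?Fx ?sAF ?(subsetP sF) //.
exact: subset_trans sF.
Qed.

Lemma mclosure_eq A B : A \subset B -> B \subset E -> r A = r B ->
  mclosure A = mclosure B.
Proof.
move=> sAB sB eqr; apply: mclosureE; first exact: mclosure_flat.
  by apply: subset_trans sAB _; apply: sub_mclosure.
by rewrite mrank_mclosure.
Qed.

Lemma flat_mclosure F : flat M F -> mclosure F = F.
Proof. by move=> fF; apply: mclosureE. Qed.

Lemma circuit_sub C : circuit M C -> C \subset E.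
Proof. by case/minsetP=> /andP[]. Qed.

Lemma circuit_neq0 C : circuit M C -> C != set0.
Proof.
case/minsetP=> /andP[sC dC] _; apply: contraTneq dC => ->.
by rewrite cards0 ltn0.
Qed.

Lemma mrank_circuitD1 C x : circuit M C -> x \in C -> r (C :\ x) = r C.
Proof.
move=> cC Cx; have sC := circuit_sub cC.
apply/eqP; rewrite eqn_leq mrank_mono ?subD1set //=.
case/minsetP: cC => /andP[_ dC] minC.
rewrite -ltnS (leq_trans dC) // (cardsD1 x) Cx add1n ltnS leqNgt.
apply: contraT; rewrite negbK => dCx.
have := minC (C :\ x); rewrite /dependent dCx andbT (subset_trans (subD1set _ _) sC).
move/(_ isT (subD1set _ _)) => eqC.
by have := Cx; rewrite -eqC setD11.
Qed.

Lemma mclosure_circuitD1 A C x : A \subset E -> circuit M C -> x \in C ->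
  mclosure (A :|: C :\ x) = mclosure (A :|: C).
Proof.
move=> sA cC Cx; have sC := circuit_sub cC.
apply: mclosure_eq; rewrite ?setUS ?subUset ?sA ?subD1set //.
by apply: mrank_setU_eq; rewrite ?subD1set ?mrank_circuitD1.
Qed.

Lemma dependent_circuit A : dependent M A -> exists2 C : {set I}, circuit M C & C \subset A.
Proof. by move=> dA; have [C] := minset_exists dA; exists C. Qed.

Lemma flatI F G : flat M F -> flat M G -> flat M (F :&: G).
Proof.
move=> fF fG; have sF := flat_sub fF; apply/flatP; split=> [|x Ex].
  exact: subset_trans (subsetIl _ _) sF.
have sFG : F :&: G \subset E by exact: subset_trans (subsetIl _ _) sF.
rewrite ltn_neqAle mrank_mono ?subsetUr ?subUset ?sub1set ?Ex // andbT.
apply: contraNneq => eqr; rewrite inE.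
by rewrite (mem_flat fF (subsetIl F G)) ?(mem_flat fG (subsetIr F G)).
Qed.

End MatroidClosure.

(** * Words modulo the Orlik-Solomon ideal *)

Section Words.
Variables (gT : finGroupType) (W : {group gT}) (I : finType).
Variables (em : equivMatroid W I) (p : nat).
Implicit Types (a b c s : seq I) (i j : I).

Local Notation E := (ground (emat em)).
Local Notation word := (wordv em p).
Local Notation ideal := (os_ideal em p).

Definition wvalid s := (size s == p) && all (mem E) s.

Lemma wordv_invalid s : ~~ wvalid s -> word s = 0.
Proof. exact: wordv_out. Qed.

Lemma gword_valid k : wvalid (@gword_seq _ _ _ em p k).
Proof. by rewrite /wvalid size_gword_seq eqxx all_gword_seq. Qed.

Definition wmap m (phi : seq I -> 'rV[algC]_m) : 'M_(#|{: gword em p}|, m) :=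
  \matrix_k phi (@gword_seq _ _ _ em p k).

Lemma wordv_wmap m (phi : seq I -> 'rV[algC]_m) s :
  word s *m wmap phi = if wvalid s then phi s else 0.
Proof.
case: ifPn => [/andP[/eqP szs sE]|/wordv_invalid->]; last by rewrite mul0mx.
by have [k <-] := gword_seqP szs sE; rewrite wordv_gword -rowE rowK.
Qed.

Lemma wordv_wmap_total m (phi : seq I -> 'rV[algC]_m) s :
  (~~ wvalid s -> phi s = 0) -> word s *m wmap phi = phi s.
Proof. by rewrite wordv_wmap; case: ifPn => // _ ->. Qed.

Lemma eq_words m (f g : 'M[algC]_(#|{: gword em p}|, m)) :
  (forall s, wvalid s -> word s *m f = word s *m g) -> f = g.
Proof.
move=> fg; apply/row_matrixP=> k; rewrite !rowE -!wordv_gword; apply: fg.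
exact: gword_valid.
Qed.

Lemma sub_words m (f : 'M[algC]_(#|{: gword em p}|, m)) (V : 'M_m) :
  (forall s, wvalid s -> (word s *m f <= V)%MS) -> (f <= V)%MS.
Proof.
move=> fV; apply/row_subP=> k; rewrite !rowE -!wordv_gword; apply: fV.
exact: gword_valid.
Qed.

Lemma os_relE a b c : os_rel em p a b c = bd (fun u => word (a ++ u ++ b)) c.
Proof. by rewrite bdE. Qed.

Lemma wvalid_cat a s b : wvalid (a ++ s ++ b) =
  [&& (size a + size s + size b == p)%N, all (mem E) a, all (mem E) s & all (mem E) b].
Proof. by rewrite /wvalid !size_cat !all_cat addnA. Qed.

Lemma ext_rel_ideal a b i j : (ext_rel em p a b i j <= ideal)%MS.
Proof.
have swp : wvalid (a ++ [:: j; i] ++ b) = wvalid (a ++ [:: i; j] ++ b).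
  by rewrite !wvalid_cat /= ; congr [&& _, _ & _]; rewrite !andbA [in LHS](andbC (j \in E)).
have [v|nv] := boolP (wvalid (a ++ [:: i; j] ++ b)); last first.
  by rewrite /ext_rel !wordv_invalid ?swp // addr0 sub0mx.
move: v; rewrite wvalid_cat => /and4P[/eqP szp _ /and3P[Ei Ej _] _].
have sza : (size a <= p)%N by rewrite -szp -addnA leq_addr.
have szb : (size b <= p)%N by rewrite -szp leq_addl.
by apply: os_ideal_sub; exists (Bseq sza), (Bseq szb); left; exists i, j.
Qed.

Lemma os_rel_ideal a b c : uniq c -> circuit (emat em) [set x in c] ->
  (os_rel em p a b c <= ideal)%MS.
Proof.
move=> uc cc.
have [szp|szp] := eqVneq (size a + (size c).-1 + size b)%N p; last first.
  rewrite os_relE bdE big1 ?sub0mx // => k _; rewrite wordv_invalid ?scaler0 //.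
  have szk := size_del k.
  by rewrite wvalid_cat szk (negPf szp).
have sza : (size a <= p)%N by rewrite -szp -addnA leq_addr.
have szb : (size b <= p)%N by rewrite -szp leq_addl.
have szc : (size c <= p.+1)%N.
  by rewrite -szp (leq_trans (leqSpred _)) // ltnS addnAC addnC leq_addr.
by apply: os_ideal_sub; exists (Bseq sza), (Bseq szb); right; exists (Bseq szc).
Qed.

(** The generators of the ideal involve arbitrary words [a] and [b]; those with a letter outside the
    ground set give zero relations, so only relations over the ground set have to be tested. *)
Lemma os_ideal_map m (f : 'M[algC]_(#|{: gword em p}|, m)) (V : 'M_m) :
  (forall a b i j, all (mem E) a -> all (mem E) b -> i \in E -> j \in E ->
     (ext_rel em p a b i j *m f <= V)%MS) ->
  (forall a b c, all (mem E) a -> all (mem E) b ->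
     uniq c -> circuit (emat em) [set x in c] ->
     (os_rel em p a b c *m f <= V)%MS) ->
  (ideal *m f <= V)%MS.
Proof.
move=> fext fos; rewrite /os_ideal.
rewrite sumsmxMr_gen; apply/sumsmx_subP=> a _; rewrite genmxE.
rewrite sumsmxMr_gen; apply/sumsmx_subP=> b _; rewrite genmxE.
have [Eab|nEab] := boolP (all (mem E) a && all (mem E) b); last first.
  have w0 u : word (a ++ u ++ b) = 0.
    apply: wordv_invalid; rewrite wvalid_cat; apply: contra nEab.
    by case/and4P=> _ -> _ ->.
  have gen0 (x : 'rV[algC]_#|{: gword em p}|) : x = 0 -> (<<x>> *m f <= V)%MS.
    by move=> ->; rewrite (eqmxMr _ (genmxE _)) mul0mx sub0mx.
  rewrite addsmxMr addsmx_sub; apply/andP; split.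
    rewrite sumsmxMr_gen; apply/sumsmx_subP=> i _; rewrite genmxE.
    rewrite sumsmxMr_gen; apply/sumsmx_subP=> j _; rewrite genmxE.
    by apply: gen0; rewrite /ext_rel !w0 addr0.
  rewrite sumsmxMr_gen; apply/sumsmx_subP=> c _; rewrite genmxE; apply: gen0.
  by rewrite /os_rel big1 // => k _; rewrite w0 scaler0.
case/andP: Eab => Ea Eb.
rewrite addsmxMr addsmx_sub; apply/andP; split.
  rewrite sumsmxMr_gen; apply/sumsmx_subP=> i Ei; rewrite genmxE.
  rewrite sumsmxMr_gen; apply/sumsmx_subP=> j Ej; rewrite genmxE.
  by rewrite (eqmxMr _ (genmxE _)); apply: fext.
rewrite sumsmxMr_gen; apply/sumsmx_subP=> c /andP[uc cc]; rewrite genmxE.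
by rewrite (eqmxMr _ (genmxE _)); apply: fos.
Qed.

Local Notation inI s := (word s <= ideal)%MS.

Lemma inI_swap a b i j : inI (a ++ i :: j :: b) -> inI (a ++ j :: i :: b).
Proof.
move=> h; have -> : word (a ++ j :: i :: b)
    = ext_rel em p a b i j - word (a ++ i :: j :: b) by rewrite /ext_rel addrC addKr.
by rewrite addmx_sub ?ext_rel_ideal // eqmx_opp.
Qed.

Lemma inI_move a b d x : inI (d ++ x :: a ++ b) -> inI (d ++ a ++ x :: b).
Proof.
elim: a d => [|y a IH] d //= h.
by rewrite -cat_rcons; apply: IH; rewrite cat_rcons; apply: inI_swap.
Qed.

Lemma inI_perm s s' : perm_eq s s' -> inI s -> inI s'.
Proof.
suff gen d : perm_eq s s' -> inI (d ++ s) -> inI (d ++ s') by apply: (gen [::]).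
elim: s s' d => [|x s IH] s' d.
  by rewrite perm_sym => /perm_nilP->.
move=> pss h; have /path.splitPr def : x \in s' by rewrite -(perm_mem pss) mem_head.
case: def pss => a b; rewrite -[x :: b]cat1s perm_sym perm_catCA /= perm_cons => pab.
apply: inI_move; rewrite -cat_rcons; apply: IH; first by rewrite perm_sym.
by rewrite cat_rcons.
Qed.

(** The exterior relation for [i = j] is 2 e_a e_x e_x e_b, and 2 is invertible. *)
Lemma inI_dup a x b : inI (a ++ x :: x :: b).
Proof.
have := ext_rel_ideal a b x x; rewrite /ext_rel -mulr2n -scaler_nat.
by rewrite eqmx_scale // pnatr_eq0.
Qed.

Lemma inI_nuniq s : ~~ uniq s -> inI s.
Proof.
case: s => [//|z s] /(uniqPn z) [i [j [ltij ltj eqij]]].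
set s1 := z :: s in ltij ltj eqij *; set x := nth z s1 i.
have si : (i < size s1)%N by apply: ltn_trans ltj.
have xj : x \in drop i.+1 s1.
  apply/(nthP z); exists (j - i.+1)%N; first by rewrite size_drop ltn_sub2r // (leq_ltn_trans ltij).
  by rewrite nth_drop subnKC.
apply: (@inI_perm (x :: x :: take i s1 ++ rem x (drop i.+1 s1))); last exact: (inI_dup [::]).
rewrite -{3}[s1](cat_take_drop i) (drop_nth z si) -/x.
rewrite perm_sym -[x :: drop _ _]cat1s perm_catCA /= perm_cons.
by rewrite -[x :: _ ++ _]cat1s perm_sym perm_catCA perm_cat2l /= perm_sym perm_to_rem.
Qed.

(** The letters contain a circuit [x :: c'] up to order, and e_x times the boundary of e_x e_c' is
    e_x e_c' up to terms in which x occurs twice. *)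
Lemma inI_dependent s : (mrank (emat em) [set x in s] < size s)%N -> inI s.
Proof.
have [v ds|/wordv_invalid->] := boolP (wvalid s); last by rewrite sub0mx.
have [us|/inI_nuniq//] := boolP (uniq s).
have dep : dependent (emat em) [set x in s].
  rewrite /dependent cardsE (card_uniqP us) ds andbT.
  by apply/subsetP=> x; rewrite inE; case/andP: v => _ /allP; apply.
have [C cC sCs] := dependent_circuit dep.
pose c := enum C; pose b := filter [predC C] s.
have uc : uniq c := enum_uniq _.
have cE : [set x in c] = C by apply/setP=> x; rewrite inE mem_enum.
apply: (@inI_perm (c ++ b)).
  have /permPl := perm_filterC (mem C) s; apply: perm_trans.
  rewrite perm_cat2r; apply: uniq_perm => //.
    exact: filter_uniq.
  move=> x; rewrite mem_enum mem_filter; apply/idP/andP=> [Cx|[]//].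
  by split=> //; have := subsetP sCs x Cx; rewrite inE.
case def_c: c => [|x c'].
  by have /negP[] := circuit_neq0 cC; rewrite -cE def_c set_nil.
have /= : (os_rel em p [:: x] b (x :: c') <= ideal)%MS.
  by apply: os_rel_ideal; rewrite -?def_c ?cE.
rewrite os_relE /=; set w := word _; set y := bd _ _ => h.
have -> : w = (w - y) + y by rewrite subrK.
apply: addmx_sub => //; rewrite {h}/y.
apply: (@bd_in _ _ _ (fun u => (u <= ideal)%MS)) => [|u u' hu hu'|k _].
- exact: sub0mx.
- by rewrite addmx_sub ?eqmx_opp.
- exact: (inI_dup [::]).
Qed.

Lemma os_char_qmx w : w \in W -> os_char em p w = \tr (qmx ideal ideal (tens_mx em p w)).
Proof. by move=> Ww; rewrite /os_char cfunE Ww mulr1n. Qed.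

End Words.

(** The cancellation in the boundary of e_i e_j + e_j e_i: the terms [A] and [B], where one of the
    two letters is deleted, drop out, while [C] and [D] come from deletions further to the right. *)
Lemma zmod_cross (V : zmodType) (A B C D : V) :
  (A - (B - C)) + (B - (A - D)) = C + D.
Proof.
by rewrite !opprB addrACA [C - B + _]addrACA -opprD [B + A]addrC addrCA subrr addr0.
Qed.

Lemma bd_mulmx (I : eqType) m n (f : seq I -> 'rV[algC]_m) (A : 'M_(m, n)) s :
  bd f s *m A = bd (fun u => f u *m A) s.
Proof. exact: (bd_linear (mulmxr A)). Qed.

(** * Exactness of the Orlik-Solomon complex *)

Section Acyclicity.
Variables (gT : finGroupType) (W : {group gT}) (I : finType).
Variables (em : equivMatroid W I) (x : I).
Local Notation E := (ground (emat em)).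
Hypothesis Ex : x \in E.
Implicit Types (p : nat) (a b c s : seq I) (i j : I).

Definition os_cons p := wmap em p (fun s => wordv em p.+1 (x :: s)) : 'M_(#|{: gword em p}|, _).
Definition os_bd p := wmap em p.+1 (bd (wordv em p)) : 'M_(#|{: gword em p.+1}|, _).

Lemma wordv_cons p s : wordv em p s *m os_cons p = wordv em p.+1 (x :: s).
Proof.
apply: wordv_wmap_total => nv; apply: wordv_invalid; apply: contra nv.
by rewrite /wvalid /= eqSS => /and3P[-> _ ->].
Qed.

Lemma wordv_bd p s : all (mem E) s -> wordv em p.+1 s *m os_bd p = bd (wordv em p) s.
Proof.
move=> Es; apply: wordv_wmap_total; rewrite /wvalid Es andbT => szs.
rewrite bdE big1 // => k _; rewrite wordv_invalid ?scaler0 //.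
rewrite /wvalid negb_and size_cat size_takel ?size_drop 1?ltnW //.
apply/orP; left; apply: contra szs => /eqP <-.
by rewrite -addnS -subSn // subSS subnKC // ltnW.
Qed.

Lemma os_cons_ideal p : (os_ideal em p *m os_cons p <= os_ideal em p.+1)%MS.
Proof.
apply: os_ideal_map => [a b i j _ _ _ _|a b c _ _ uc cc].
  by rewrite /ext_rel mulmxDl !wordv_cons; apply: (ext_rel_ideal em _ (x :: a)).
have := os_rel_ideal p.+1 (x :: a) b uc cc; congr (_ <= _)%MS.
rewrite /os_rel mulmx_suml; apply: eq_bigr => k _.
by rewrite -scalemxAl wordv_cons.
Qed.

Lemma ideal_bd p (f : seq I -> 'rV[algC]_#|{: gword em p}|) s :
  (forall u, (f u <= os_ideal em p)%MS) -> (bd f s <= os_ideal em p)%MS.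
Proof.
move=> fI; apply: (@bd_in _ _ _ (fun u => (u <= os_ideal em p)%MS)) => // [|u v hu hv].
  exact: sub0mx.
by rewrite addmx_sub ?eqmx_opp.
Qed.

(** The boundary of a relation is computed by the Leibniz rule: deletions inside the circuit cancel
    by [bd_bd], those before and after it yield relations again. *)
Lemma os_bd_ideal p : (os_ideal em p.+1 *m os_bd p <= os_ideal em p)%MS.
Proof.
apply: os_ideal_map => [a b i j Ea Eb Ei Ej|a b c Ea Eb uc cc].
  rewrite /ext_rel mulmxDl !wordv_bd ?all_cat ?Ea ?Eb /= ?Ei ?Ej //.
  rewrite !bd_cat /= addrACA -bdD -scalerDr.
  apply: addmx_sub; first by apply: ideal_bd => u; apply: ext_rel_ideal.
  apply: scalemx_sub; rewrite zmod_cross -bdD.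
  by apply: ideal_bd => u; apply: ext_rel_ideal.
have cE : all (mem E) c.
  by apply/allP=> y cy; apply: (subsetP (circuit_sub cc)); rewrite inE.
have step : os_rel em p.+1 a b c *m os_bd p =
    bd (fun a' => os_rel em p a' b c) a
    + (-1) ^+ (size a + (size c).-1) *: bd (fun b' => os_rel em p a b' c) b.
  transitivity (bd (fun c' => bd (wordv em p) (a ++ c' ++ b)) c).
    rewrite os_relE bd_mulmx; apply: eq_bd_del => u _ uc' /=.
    by rewrite wordv_bd // !all_cat Ea Eb andbT; apply/allP=> y /uc' /(allP cE).
  rewrite (eq_bd _ (fun u => bd_cat _ _ _)) bdD bdZ.
  rewrite (eq_bd _ (fun u => bd_cat _ _ _)) bdD bd_bd add0r bd_exchange.
  congr (_ + _); first by apply: eq_bd => u; rewrite os_relE.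
  under eq_bd_del => u szu _ do rewrite szu.
  rewrite bdZ scalerA -exprD bd_exchange; congr (_ *: _).
  by apply: eq_bd => u; rewrite os_relE.
rewrite step; apply: addmx_sub; last apply: scalemx_sub;
  by apply: ideal_bd => u; apply: os_rel_ideal.
Qed.

Lemma os_cons_bd0 : os_cons 0 *m os_bd 0 = 1%:M.
Proof.
apply: (@eq_words _ _ _ em) => s /andP[/nilP-> _].
by rewrite mulmxA wordv_cons wordv_bd /= ?Ex //= subr0 mulmx1.
Qed.

Lemma os_cons_bd p : os_cons p.+1 *m os_bd p.+1 + os_bd p *m os_cons p = 1%:M.
Proof.
apply: (@eq_words _ _ _ em) => s /andP[_ Es].
rewrite mulmxDr !mulmxA wordv_cons !wordv_bd /= ?Ex // mulmx1.
rewrite bd_mulmx /= (eq_bd _ (wordv_cons p)).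
by rewrite subrK.
Qed.

Section Trace.
Variable w : gT.
Hypothesis Ww : w \in W.

Lemma os_bd_tens p : os_bd p *m tens_mx em p w = tens_mx em p.+1 w *m os_bd p.
Proof.
apply: (@eq_words _ _ _ em) => s /andP[_ Es].
rewrite !mulmxA wordv_bd // wordv_tens // wordv_bd; last first.
  by rewrite all_map; apply/allP=> y /(allP Es); rewrite /= eact_in.
rewrite bd_mulmx /= !bdE size_map.
apply: eq_bigr => k _; rewrite wordv_tens //; congr (_ *: wordv _ _ _).
by rewrite map_cat map_take map_drop.
Qed.

Lemma tens_ideal p : (os_ideal em p *m tens_mx em p w <= os_ideal em p)%MS.
Proof. exact: (mxmoduleP (os_ideal_mod em p)). Qed.

(** Modulo the ideal, sending v to the boundary of e_x v is a projection onto the image of the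
    boundary in degree [p], so this is the trace of [w] on that image. *)
Let s p := \tr (qmx (os_ideal em p) (os_ideal em p)
  (tens_mx em p w *m os_cons p *m os_bd p)).

Lemma os_char0 : os_char em 0 w = s 0.
Proof. by rewrite os_char_qmx // /s -mulmxA os_cons_bd0 mulmx1. Qed.

(** The homotopy formula splits the identity in degree [p.+1]. Multiplication by e_x need not
    commute with [w], but the boundary does, and cyclicity of the trace carries the second summand
    to degree [p]. *)
Lemma os_charS p : os_char em p.+1 w = s p.+1 + s p.
Proof.
rewrite os_char_qmx // -[tens_mx em p.+1 w]mulmx1 -os_cons_bd mulmxDr qmxD linearD /=.
congr (_ + _); first by rewrite /s mulmxA.
rewrite mulmxA -os_bd_tens -mulmxA -(qmxM _ _ (B := os_ideal em p)); last first.
  by rewrite mulmxA (submx_trans (submxMr _ (tens_ideal p))) ?os_cons_ideal.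
by rewrite mxtrace_mulC qmxM // os_bd_ideal.
Qed.

(** The sum telescopes to [s n] up to sign, and the map whose trace is [s n] factors through degree
    [n.+1], which is zero by hypothesis. *)
Lemma os_char_alternating n :
  (forall u, wvalid em n.+1 u -> (wordv em n.+1 u <= os_ideal em n.+1)%MS) ->
  \sum_(p < n.+1) (-1) ^+ p * os_char em p w = 0.
Proof.
move=> dep; have -> : \sum_(p < n.+1) (-1) ^+ p * os_char em p w = (-1) ^+ n * s n.
  elim: n {dep} => [|n IH]; first by rewrite big_ord1 os_char0.
  by rewrite big_ord_recr /= IH os_charS exprS mulN1r !mulNr mulrDr opprD addrCA subrr addr0.
rewrite /s -(qmxM _ _ (B := os_ideal em n.+1)) ?os_bd_ideal //.
rewrite (@qmx_eq _ _ _ _ (os_ideal em n.+1) _ 0) ?qmx0 ?mul0mx ?linear0 ?mulr0 //.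
rewrite addr0; apply: submx_trans (submxMl _ _) _; apply: sub_words => u uv.
by rewrite wordv_cons; apply: dep; rewrite /wvalid /= eqSS Ex.
Qed.

End Trace.
End Acyclicity.

Section EquivariantClosure.
Variables (gT : finGroupType) (W : {group gT}) (I : finType).
Variables (em : equivMatroid W I) (w : gT).
Hypothesis Ww : w \in W.
Local Notation M := (emat em).
Local Notation E := (ground M).
Local Notation act A := (setact (eact em) A w).

Lemma setact_ground : act E = E.
Proof. by apply: astabs_setact; apply: (subsetP (eact_ground em)). Qed.

Lemma mem_setact_act (A : {set I}) x : (eact em x w \in act A) = (x \in A).
Proof. by rewrite -[act A]/((eact em)^~ w @: A) (mem_imset _ _ (act_inj _ w)). Qed.

Lemma setact_subset (A B : {set I}) : (act A \subset act B) = (A \subset B).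
Proof.
apply/idP/idP=> [/subsetP sAB|]; last exact: imsetS.
by apply/subsetP=> x Ax; rewrite -mem_setact_act sAB ?mem_setact_act.
Qed.

Lemma setact_sub_ground (A : {set I}) : (act A \subset E) = (A \subset E).
Proof. by rewrite -{1}setact_ground setact_subset. Qed.

Lemma mem_setactP (A : {set I}) y : y \in act A -> exists2 x, x \in A & y = eact em x w.
Proof. by case/imsetP=> x; exists x. Qed.

Lemma ground_actP y : y \in E -> exists2 x, x \in E & y = eact em x w.
Proof. by rewrite -{1}setact_ground => /mem_setactP. Qed.

Lemma setactU1 x (A : {set I}) : act (x |: A) = eact em x w |: act A.
Proof. by rewrite /setact imsetU imset_set1. Qed.

Lemma setact_mclosure (A : {set I}) : A \subset E ->
  act (mclosure M A) = mclosure M (act A).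
Proof.
move=> sA; apply/setP=> y; have [Ey|nEy] := boolP (y \in E); last first.
  rewrite [RHS]inE (negPf nEy) /=; apply: contraNF nEy; apply: subsetP.
  by rewrite setact_sub_ground mclosure_sub.
have [x Ex ->] := ground_actP Ey.
rewrite mem_setact_act !inE Ex eact_in // Ex /= -setactU1 !eact_rank //.
by rewrite subUset sub1set Ex.
Qed.

Lemma setact_flat (F : {set I}) : flat M F -> flat M (act F).
Proof.
move=> fF; rewrite -(flat_mclosure fF) setact_mclosure ?flat_sub //.
by apply: mclosure_flat; rewrite setact_sub_ground flat_sub.
Qed.

End EquivariantClosure.

(** * The decomposition of the Orlik-Solomon algebra by flats *)

Section Brieskorn.
Variables (gT : finGroupType) (W : {group gT}) (I : finType).
Variables (em : equivMatroid W I) (p : nat).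
Local Notation M := (emat em).
Local Notation E := (ground M).
Implicit Types (F G A C : {set I}) (s a b c : seq I).

Local Notation cl s := (mclosure M [set y in s]).

Definition os_proj F :=
  wmap em p (fun s => if cl s == F then wordv em p s else 0).

Lemma wordv_proj F s :
  wordv em p s *m os_proj F = if cl s == F then wordv em p s else 0.
Proof.
by apply: wordv_wmap_total => nv; rewrite wordv_invalid // if_same.
Qed.

Lemma valid_sub s : all (mem E) s -> [set y in s] \subset E.
Proof. by move/allP=> Es; apply/subsetP=> y; rewrite inE => /Es. Qed.

Lemma sum_proj : \sum_(F in flats M) os_proj F = 1%:M.
Proof.
apply: eq_words => s /andP[_ /valid_sub Es].
rewrite mulmx1 mulmx_sumr (bigD1 (cl s)) /= ?inE ?mclosure_flat //.
rewrite wordv_proj eqxx big1 ?addr0 // => F /andP[_ nF].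
by rewrite wordv_proj eq_sym (negPf nF).
Qed.

Lemma projM F G : os_proj F *m os_proj G = if F == G then os_proj F else 0.
Proof.
apply: eq_words => s _; rewrite mulmxA wordv_proj.
case: (F =P G) => [<-|neFG]; first by rewrite wordv_proj; case: ifP => eq; rewrite ?mul0mx // wordv_proj eq.
rewrite mulmx0; case: eqP => [eqF|_]; last by rewrite mul0mx.
by rewrite wordv_proj eqF; case: eqP.
Qed.

Lemma cl_ext a b i j : cl (a ++ [:: j; i] ++ b) = cl (a ++ [:: i; j] ++ b).
Proof. by congr mclosure; apply/setP=> y; rewrite !inE !mem_cat !inE [in LHS](orbC (y == j)). Qed.

(** A circuit is spanned by what remains after removing any one element, so all monomials of a
    relation span the same flat. Hence [os_proj] either keeps a relation whole or kills it, and the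
    ideal is graded by flats. *)
Lemma cl_circuit a b c u : all (mem E) a -> all (mem E) b ->
  uniq c -> circuit M [set x in c] ->
  size u = (size c).-1 -> uniq u -> {subset u <= c} ->
  cl (a ++ u ++ b) = cl (a ++ c ++ b).
Proof.
move=> Ea Eb uc cc szu uu suc.
have [x cx def_u] : exists2 x, x \in c & [set y in u] = [set y in c] :\ x.
  have lt : (size u < size c)%N.
    rewrite szu prednK // lt0n size_eq0; apply: contraTneq cc => ->.
    by rewrite set_nil; apply: contraTN isT => /circuit_neq0; rewrite eqxx.
  have /allPn[x cx nux] : ~~ all (mem u) c.
    by apply: contraTN lt => /allP; rewrite -leqNgt; apply: uniq_leq_size.
  exists x => //; apply/eqP; rewrite eqEcard; apply/andP; split.
    apply/subsetP=> y; rewrite !inE => uy; rewrite suc // andbT.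
    by apply: contraNneq nux => <-.
  rewrite [X in (_ <= X)%N]cardsE (card_uniqP uu) szu.
  have := cardsD1 x [set y in c]; rewrite inE cx cardsE (card_uniqP uc) => ->.
  by [].
pose A : {set I} := [set y in a ++ b].
have sA : A \subset E by apply: valid_sub; rewrite all_cat Ea Eb.
have eqA v : [set y in a ++ v ++ b] = A :|: [set y in v].
  by apply/setP=> y; rewrite !inE !mem_cat orbCA orbC.
by rewrite !eqA def_u mclosure_circuitD1 ?inE.
Qed.

Lemma proj_ideal F : (os_ideal em p *m os_proj F <= os_ideal em p)%MS.
Proof.
apply: os_ideal_map => [a b i j _ _ _ _|a b c Ea Eb uc cc].
  rewrite /ext_rel mulmxDl !wordv_proj cl_ext; case: eqP => _; last by rewrite addr0 sub0mx.
  exact: ext_rel_ideal.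
rewrite /os_rel mulmx_suml.
rewrite (eq_bigr (fun k : 'I_(size c) => (-1) ^+ k *: if cl (a ++ c ++ b) == F
  then wordv em p (a ++ (take k c ++ drop k.+1 c) ++ b) else 0)) => [|k _].
  case: eqP => _; first exact: os_rel_ideal.
  by rewrite big1 ?sub0mx // => k _; rewrite scaler0.
rewrite -scalemxAl wordv_proj (@cl_circuit a b c) ?size_del //.
  have := uc; rewrite -{1}(cat_take_drop k c) !cat_uniq => /and3P[-> h1 h2].
  rewrite (subseq_uniq _ h2) ?andbT /=.
    apply: contra h1 => /hasP[y y1 y2]; apply/hasP; exists y => //.
    by have := y1; rewrite -addn1 addnC -drop_drop => /mem_drop.
  by rewrite -addn1 addnC -drop_drop drop_subseq.
by move=> y; rewrite mem_cat => /orP[/mem_take|/mem_drop].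
Qed.

(** A word of length [p] spanning a flat of rank other than [p] is dependent. *)
Lemma proj_rank F : flat M F -> mrank M F != p -> (os_proj F <= os_ideal em p)%MS.
Proof.
move=> fF neFp; apply: sub_words => s /andP[/eqP szs Es].
rewrite wordv_proj; case: eqP => [clF|_]; last exact: sub0mx.
apply: inI_dependent; have rF := mrank_mclosure (valid_sub Es).
rewrite ltn_neqAle -rF clF szs neFp -szs -clF rF /=.
by rewrite (leq_trans (mrank_le_card (valid_sub Es))) // cardsE card_size.
Qed.

Section Restriction.
Variables (gT' : finGroupType) (W' : {group gT'}) (em' : equivMatroid W' I).
Variables (F : {set I}) (w : gT) (w' : gT').
Hypotheses (Ww : w \in W) (Ww' : w' \in W') (fF : flat M F).
Hypothesis ground' : ground (emat em') = F.
Hypothesis rank' : forall A, A \subset F -> mrank (emat em') A = mrank M A.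
Hypothesis act' : forall x, x \in F -> eact em' x w' = eact em x w.
Hypothesis rkF : mrank M F = p.

Let sF : F \subset E. Proof. exact: flat_sub. Qed.

Let circuit' C : C \subset F -> circuit (emat em') C = circuit M C.
Proof.
have dep A : A \subset F -> dependent (emat em') A = dependent M A.
  by move=> sA; rewrite /dependent ground' rank' // sA (subset_trans sA sF).
move=> sC; apply/minsetP/minsetP=> -[dC minC]; split; rewrite ?dep // in dC * => B dB sB;
  by apply: minC => //; rewrite ?dep // in dB *; rewrite ?(subset_trans sB).
Qed.

Let incl := wmap em' p (wordv em p).
Let restr := wmap em p (fun s => if cl s == F then wordv em' p s else 0).

Let word_incl s : all (mem F) s -> wordv em' p s *m incl = wordv em p s.
Proof.
move=> Fs; apply: wordv_wmap_total; rewrite /wvalid ground' Fs andbT => szs.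
by rewrite wordv_invalid // /wvalid (negPf szs).
Qed.

Let cl_mem s : all (mem E) s -> cl s = F -> all (mem F) s.
Proof.
move=> Es clF; apply/allP=> x sx; rewrite -clF.
by apply: (subsetP (sub_mclosure (valid_sub Es))); rewrite inE.
Qed.

Let word_restr s : all (mem E) s ->
  wordv em p s *m restr = if cl s == F then wordv em' p s else 0.
Proof.
move=> Es; apply: wordv_wmap_total; case: eqP => // clF.
rewrite /wvalid Es andbT => szs.
by rewrite wordv_invalid // /wvalid (negPf szs).
Qed.

Let incl_ideal : (os_ideal em' p *m incl <= os_ideal em p)%MS.
Proof.
apply: os_ideal_map => [a b i j Fa Fb Fi Fj|a b c Fa Fb uc cc];
  rewrite ?ground' in Fa Fb.
  rewrite ?ground' in Fi Fj.
  rewrite /ext_rel mulmxDl !word_incl ?all_cat ?Fa ?Fb /= ?Fi ?Fj //.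
  exact: ext_rel_ideal.
have sc : [set x in c] \subset F by rewrite -ground'; apply: circuit_sub.
rewrite os_relE bd_mulmx (@eq_bd_del _ _ _ _ (fun u => wordv em p (a ++ u ++ b))).
  by rewrite -os_relE os_rel_ideal // -circuit'.
move=> u _ uc'; rewrite word_incl // !all_cat Fa Fb andbT /=.
by apply/allP=> y /uc' cy; apply: (subsetP sc); rewrite inE.
Qed.

Let restr_ideal : (os_ideal em p *m restr <= os_ideal em' p)%MS.
Proof.
apply: os_ideal_map => [a b i j Ea Eb Ei Ej|a b c Ea Eb uc cc].
  rewrite /ext_rel mulmxDl !word_restr ?all_cat ?Ea ?Eb /= ?Ei ?Ej //.
  rewrite [cl (a ++ [:: j, i & b])]cl_ext /=; case: eqP => _; last by rewrite addr0 sub0mx.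
  exact: ext_rel_ideal.
have Ec : all (mem E) c.
  by apply/allP=> x cx; apply: (subsetP (circuit_sub cc)); rewrite inE.
have Edel k : all (mem E) (take k c ++ drop k.+1 c).
  by apply/allP=> y; rewrite mem_cat => /orP[/mem_take|/mem_drop] /(allP Ec).
rewrite /os_rel mulmx_suml.
rewrite (eq_bigr (fun k : 'I_(size c) => (-1) ^+ k *: if cl (a ++ c ++ b) == F
  then wordv em' p (a ++ (take k c ++ drop k.+1 c) ++ b) else 0)) => [|k _]; last first.
  rewrite -scalemxAl word_restr ?all_cat ?Ea ?Eb ?andbT ?Edel //; last first.
    by rewrite -all_cat Edel.
  rewrite (@cl_circuit a b c) ?size_del //.
    have := uc; rewrite -{1}(cat_take_drop k c) !cat_uniq => /and3P[-> h1 h2].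
    rewrite (subseq_uniq _ h2) ?andbT /=.
      apply: contra h1 => /hasP[y y1 y2]; apply/hasP; exists y => //.
      by have := y1; rewrite -addn1 addnC -drop_drop => /mem_drop.
    by rewrite -addn1 addnC -drop_drop drop_subseq.
  by move=> y; rewrite mem_cat => /orP[/mem_take|/mem_drop].
case: eqP => [clF|_]; last by rewrite big1 ?sub0mx // => k _; rewrite scaler0.
apply: os_rel_ideal => //; rewrite circuit' //; apply/subsetP=> x; rewrite inE => cx.
apply: (allP (cl_mem _ clF)); first by rewrite !all_cat Ea Ec.
by rewrite !mem_cat cx orbT.
Qed.

Let restr_incl : restr *m incl = os_proj F.
Proof.
apply: eq_words => s /andP[_ Es]; rewrite mulmxA word_restr // wordv_proj.
by case: eqP => [clF|]; rewrite ?mul0mx // word_incl // cl_mem.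
Qed.

Let incl_restr : (incl *m restr - 1%:M <= os_ideal em' p)%MS.
Proof.
apply: sub_words => s /andP[/eqP szs Fs]; rewrite ground' in Fs.
have Es : all (mem E) s by apply/allP=> x /(allP Fs) /(subsetP sF).
have sFs : [set y in s] \subset F by apply/subsetP=> x; rewrite inE => /(allP Fs).
rewrite mulmxBr mulmx1 mulmxA word_incl // word_restr //.
case: eqP => [_|nclF]; rewrite ?subrr ?sub0mx // sub0r eqmx_opp.
apply: inI_dependent; rewrite szs ltnNge rank' //; apply/negP=> le.
case: nclF; apply: (mclosureE fF) => //; apply/eqP.
by rewrite eqn_leq mrank_mono //= rkF.
Qed.

Let incl_tens : incl *m tens_mx em p w = tens_mx em' p w' *m incl.
Proof.
apply: eq_words => s /andP[_ Fs]; rewrite ground' in Fs.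
rewrite !mulmxA word_incl // !wordv_tens // word_incl.
  by congr wordv; apply/eq_in_map=> x /(allP Fs) Fx; rewrite act'.
rewrite -ground' all_map; apply/allP=> x /(allP Fs) Fx /=.
by rewrite eact_in // ground'.
Qed.

(** Modulo the ideals, [incl] and [restr] identify the top degree of [em'] with the [F]-part of [em]
    in degree [p]: a word of length [p] over [F] that fails to span [F] is dependent. Leaving [em']
    abstract covers restrictions as well as restrictions of restrictions. *)
Lemma tr_proj_restr :
  \tr (qmx (os_ideal em p) (os_ideal em p) (os_proj F *m tens_mx em p w))
    = os_char em' p w'.
Proof.
rewrite -restr_incl -mulmxA incl_tens.
rewrite -(qmxM _ _ (B := os_ideal em' p)); last first.
  rewrite mulmxA (submx_trans _ incl_ideal) // submxMr //; exact: tens_ideal.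
rewrite mxtrace_mulC qmxM ?restr_ideal // -mulmxA.
rewrite -(qmxM _ _ (B := os_ideal em' p)); last first.
  rewrite mulmxA (submx_trans _ restr_ideal) // submxMr //; exact: incl_ideal.
by rewrite (qmx_eq _ incl_restr) qmx1 mulmx1 os_char_qmx.
Qed.

End Restriction.

Section Decomposition.
Variable w : gT.
Hypothesis Ww : w \in W.

Lemma proj_tens F : os_proj F *m tens_mx em p w
  = tens_mx em p w *m os_proj (setact (eact em) F w).
Proof.
apply: eq_words => s /andP[_ Es]; rewrite !mulmxA wordv_proj wordv_tens //.
rewrite wordv_proj.
have -> : [set y in [seq eact em x w | x <- s]] = setact (eact em) [set y in s] w.
  by apply/setP=> y; rewrite inE; apply/mapP/imsetP=> -[x xs ->]; exists x; rewrite ?inE // in xs *.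
rewrite -setact_mclosure ?valid_sub // (inj_eq (imset_inj (act_inj _ w))).
by case: eqP => _; rewrite ?mul0mx // wordv_tens.
Qed.

(** If [w] moves F, cyclicity of the trace replaces pi_F w by pi_F w pi_F, which is w times the
    product of the projections to two different flats, hence 0. For a flat of rank other than [p]
    the projection itself vanishes modulo the ideal. *)
Lemma os_char_proj : os_char em p w =
  \sum_(F in flats M | (setact (eact em) F w == F) && (mrank M F == p))
    \tr (qmx (os_ideal em p) (os_ideal em p) (os_proj F *m tens_mx em p w)).
Proof.
rewrite os_char_qmx // -{1}[tens_mx em p w]mul1mx -sum_proj mulmx_suml qmx_sum linear_sum.
rewrite [RHS]big_mkcondr; apply: eq_bigr => F; rewrite inE => fF.
have [rkF|nrkF] := altP (mrank M F =P p); last first.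
  rewrite andbF; rewrite (@qmx_eq _ _ _ _ _ _ 0); last first.
    rewrite subr0.
    have h := proj_rank fF nrkF; have h2 := tens_ideal em Ww p.
    exact: submx_trans (submxMr _ h) h2.
  by rewrite qmx0 linear0.
rewrite andbT; case: eqP => // /eqP nfix.
have pI := proj_ideal; have tI := tens_ideal em Ww p.
have -> : os_proj F *m tens_mx em p w = os_proj F *m (os_proj F *m tens_mx em p w).
  by rewrite mulmxA projM eqxx.
rewrite -(qmxM _ _ (B := os_ideal em p)); last first.
  by rewrite mulmxA (submx_trans (submxMr _ (pI F))).
by rewrite /= mxtrace_mulC qmxM // proj_tens -mulmxA projM (negPf nfix) mulmx0 qmx0 mxtrace0.
Qed.

End Decomposition.
End Brieskorn.

(** * Values of graded characters at a group element *)

Section GrValue.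
Variables (gT : finGroupType) (W : {group gT}).
Implicit Types (w : gT) (f g : {poly 'CF(W)}).

Lemma coef_gr_value w f i : (gr_value w f)`_i = f`_i w.
Proof. by rewrite coef_map_id0 // cfunE. Qed.

Lemma gr_valueM w f g : gr_value w (f * g) = gr_value w f * gr_value w g.
Proof.
apply/polyP=> i; rewrite coef_gr_value !coefM sum_cfunE; apply: eq_bigr => j _.
by rewrite !coef_gr_value cfunE.
Qed.

Lemma gr_value_sum w (J : Type) (r : seq J) (Q : pred J) (F : J -> {poly 'CF(W)}) :
  gr_value w (\sum_(j <- r | Q j) F j) = \sum_(j <- r | Q j) gr_value w (F j).
Proof.
apply/polyP=> i; rewrite coef_gr_value !coef_sum sum_cfunE; apply: eq_bigr => j _.
by rewrite coef_gr_value.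
Qed.

Lemma gr_value0 w f : w \notin W -> gr_value w f = 0.
Proof. by move=> nW; apply/polyP=> i; rewrite coef_gr_value coef0 cfun0. Qed.

Lemma size_gr_value w f : (size (gr_value w f) <= size f)%N.
Proof. exact: size_poly. Qed.

End GrValue.

(** * Flats of restrictions and contractions *)

Section Intervals.
Variables (I : finType) (M : matroid I).
Implicit Types (F G A : {set I}).

Lemma flat_restrict F G : flat M F ->
  flat (mrestrict M F) G = flat M G && (G \subset F).
Proof.
move=> fF; have sF := flat_sub fF.
apply/flatP/andP=> /= [[]|[/flatP[sG hG] sGF]].
  rewrite (setIidPr sF) => sGF hG; split=> //.
  apply/flatP; split=> [|x Ex nGx]; first exact: subset_trans sGF sF.
  have [Fx|nFx] := boolP (x \in F); first exact: hG.
  rewrite ltn_neqAle mrank_mono ?subsetUr ?subUset ?sub1set ?Ex ?(subset_trans sGF) // andbT.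
  by apply: contraNneq nFx => eqr; rewrite (mem_flat fF sGF).
split=> [|x]; first by rewrite subsetI sG.
by rewrite inE => /andP[Ex _]; apply: hG.
Qed.

Lemma flat_contract F G : flat M F ->
  flat (mcontract M F) G = (G \subset ground M :\: F) && flat M (G :|: F).
Proof.
move=> fF; have sF := flat_sub fF.
have [sG|nsG] := boolP (G \subset ground M :\: F); last first.
  by apply: contraNF nsG => /flat_sub.
have sGE : G \subset ground M by apply: subset_trans sG (subsetDl _ _).
have lt x : x \in ground M ->
    (mrank (mcontract M F) G < mrank (mcontract M F) (x |: G))%N
      = (mrank M (G :|: F) < mrank M (x |: (G :|: F)))%N.
  move=> Ex; rewrite /= /contract_rank (setIidPr sF) setUA ltn_sub2rE //.
  by rewrite mrank_mono ?subsetUr // subUset sGE.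
apply/flatP/flatP=> -[_ h]; split=> //; first by rewrite subUset sGE.
- move=> x Ex nx; rewrite inE negb_or in nx; case/andP: nx => nGx nFx.
  by rewrite -lt // h // inE nFx.
- move=> x; rewrite inE => /andP[nFx Ex] nGx; rewrite lt // h // inE negb_or nGx //.
Qed.

Lemma mrk_restrict F : flat M F -> mrk (mrestrict M F) = mrank M F.
Proof. by move=> fF; rewrite /mrk /= (setIidPr (flat_sub fF)). Qed.

Lemma mrk_contract F : flat M F -> mrk (mcontract M F) = (mrk M - mrank M F)%N.
Proof.
move=> fF; have sF := flat_sub fF; rewrite /mrk /= /contract_rank (setIidPr sF).
congr (mrank M _ - _)%N; apply/setP=> x; rewrite !inE.
by case: (boolP (x \in F)) => [/(subsetP sF)->|]; rewrite ?orbT ?orbF.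
Qed.

Lemma mrank_contract F G : flat M F -> G \subset ground M :\: F ->
  mrank (mcontract M F) G = (mrank M (G :|: F) - mrank M F)%N.
Proof. by move=> fF _; rewrite /= /contract_rank (setIidPr (flat_sub fF)). Qed.

Hypothesis loopM : loopless M.

Lemma loopless_restrict F : loopless (mrestrict M F).
Proof. by move=> x /setIP[Ex _]; apply: loopM. Qed.

Lemma loopless_contract F : flat M F -> loopless (mcontract M F).
Proof.
move=> fF x; rewrite /= inE /contract_rank (setIidPr (flat_sub fF)) => /andP[nFx Ex].
have sF := flat_sub fF; have sx : [set x] \subset ground M by rewrite sub1set.
have lt : (mrank M F < mrank M ([set x] :|: F))%N by case/flatP: fF => _; apply.
apply/eqP; rewrite eqn_leq subn_gt0 lt andbT leq_subLR addnC.
have := mrank_submod sx sF; rewrite loopM // => le; apply: leq_trans le.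
exact: leq_addr.
Qed.

Lemma flat0 : flat M set0.
Proof.
apply/flatP; split=> [|x Ex _]; first exact: sub0set.
rewrite setU0 loopM // ltnS; have := @mrank_le_card _ M set0 (sub0set _).
by rewrite cards0.
Qed.

Lemma mrank0 : mrank M set0 = 0%N.
Proof. by apply/eqP; have := @mrank_le_card _ M set0 (sub0set _); rewrite cards0 leqn0. Qed.

Lemma mrank_flat_lt F G : flat M F -> flat M G -> F \proper G ->
  (mrank M F < mrank M G)%N.
Proof.
case/flatP=> sF hF fG /properP[sFG [x Gx nFx]].
have Ex := subsetP (flat_sub fG) x Gx; apply: leq_trans (hF x Ex nFx) _.
by apply: mrank_mono; rewrite ?flat_sub // subUset sub1set Gx.
Qed.

Lemma mrank_flat_gt0 F : flat M F -> (0 < mrank M F)%N = (F != set0).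
Proof.
move=> fF; have [->|nz] := eqVneq F set0; first by rewrite mrank0.
by have := mrank_flat_lt flat0 fF; rewrite mrank0 => -> //; rewrite proper0.
Qed.

End Intervals.

Lemma mem_flat_stab (gT : finGroupType) (W : {group gT}) (I : finType)
    (em : equivMatroid W I) (F : {set I}) (v : gT) : (v \in flat_stab em F) =
  (v \in W) && (setact (eact em) F v == F).
Proof.
rewrite inE; apply/andP/andP=> -[Wv h]; split=> //.
  by apply/eqP; apply: astabs_setact.
rewrite /astabs inE Wv /= inE; apply/subsetP=> x Fx.
by move: Fx; rewrite inE -(mem_setact_act em v F) (eqP h).
Qed.

(** * Traces as Moebius numbers of the stable flats *)

Section FlatValues.
Variables (gT : finGroupType) (W : {group gT}) (I : finType).
Variables (em : equivMatroid W I) (w : gT).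
Hypothesis Ww : w \in W.
Local Notation M := (emat em).
Local Notation E := (ground M).
Local Notation act A := (setact (eact em) A w).
Implicit Types (F G A : {set I}) (p : nat).

Lemma os_char_flats p : os_char em p w =
  \sum_(F in flats M | (act F == F) && (mrank M F == p)) os_char (em_local em F) p w.
Proof.
rewrite os_char_proj //; apply: eq_bigr => F.
rewrite inE => /and3P[fF fixF /eqP rkF].
apply: tr_proj_restr => //; first by rewrite mem_flat_stab Ww.
by rewrite /= (setIidPr (flat_sub fF)).
Qed.

(** Both sides are the trace on the [G]-part of [em], by two applications of [tr_proj_restr]. *)
Lemma os_char_local_local F G p : flat M F -> flat M G -> G \subset F ->
  act F = F -> act G = G -> mrank M G = p ->
  os_char (em_local (em_local em F) G) p w = os_char (em_local em G) p w.
Proof.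
move=> fF fG sGF fixF fixG rkG.
have sF : w \in flat_stab em F by rewrite mem_flat_stab Ww fixF eqxx.
rewrite -(@tr_proj_restr _ _ _ em p _ _ (em_local em G) G w w) //; last 2 first.
- by rewrite mem_flat_stab Ww fixG eqxx.
- by rewrite /= (setIidPr (flat_sub fG)).
apply/esym/tr_proj_restr => //.
- by rewrite (mem_flat_stab (em_local em F)) sF; apply/eqP.
- by rewrite /= (setIidPr (flat_sub fF)) (setIidPr sGF).
Qed.

Definition flat_value F : algC := (-1) ^+ mrank M F * os_char (em_local em F) (mrank M F) w.

End FlatValues.

Section FlatValueSums.
Variables (gT : finGroupType) (W : {group gT}) (I : finType).
Implicit Types (em : equivMatroid W I) (w : gT) (F G A : {set I}).

Lemma charpoly_flats em w : w \in W -> loopless (emat em) ->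
  gr_value w (equiv_charpoly em) =
  \sum_(F in flats (emat em) | setact (eact em) F w == F)
     flat_value em w F *: 'X^(mrk (emat em) - mrank (emat em) F).
Proof.
move=> Ww loopM; set M := emat em; set r := mrk M.
rewrite /equiv_charpoly -/M -/r gr_value_sum.
transitivity (\sum_(p < r.+1) \sum_(F in flats M |
    (setact (eact em) F w == F) && (mrank M F == p))
     flat_value em w F *: ('X^(r - mrank M F) : {poly algC})).
  apply: eq_bigr => p _; apply/polyP=> i; rewrite coef_gr_value coefZ coefXn cfunE cfunE.
  have -> : ((-1) ^+ p : 'CF(W)) w = (-1) ^+ p.
    by rewrite -signr_odd -[RHS]signr_odd; case: (odd p); rewrite ?expr1 ?expr0 ?cfunE cfun1E Ww.
  rewrite os_char_flats // mulr_sumr coef_sum.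
  have -> : ((i == r - p)%N%:R : 'CF(W)) w = (i == r - p)%N%:R.
    by case: (i == _); rewrite ?cfunE ?cfun1E ?Ww.
  rewrite mulr_suml; apply: eq_bigr => F /and3P[_ _ /eqP rkF].
  by rewrite coefZ coefXn /flat_value -/M rkF.
rewrite (exchange_big_dep (fun F => (F \in flats M) && (setact (eact em) F w == F))) /=; last first.
  by move=> p F _ /and3P[-> -> _].
apply: eq_bigr => F /andP[]; rewrite inE => fF fixF.
have lt : (mrank M F < r.+1)%N by rewrite ltnS; apply: mrank_mono => //; apply: flat_sub.
rewrite (big_pred1 (Ordinal lt)) // => p.
by rewrite inE fF fixF /= eq_sym.
Qed.

(** This is the vanishing Euler characteristic of the complex, sorted by flats; words longer than
    the rank are dependent, so the complex stops in degree [r]. *)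
Lemma sum_flat_value0 em w : w \in W -> loopless (emat em) ->
  ground (emat em) != set0 ->
  \sum_(F in flats (emat em) | setact (eact em) F w == F) flat_value em w F = 0.
Proof.
move=> Ww loopM /set0Pn[x Ex]; set M := emat em; set r := mrk M.
rewrite -[RHS](@os_char_alternating _ _ _ em _ Ex _ Ww r).
  transitivity (\sum_(p < r.+1) \sum_(F in flats M |
    (setact (eact em) F w == F) && (mrank M F == p)) flat_value em w F); last first.
    apply: eq_bigr => p _; rewrite os_char_flats // mulr_sumr.
    by apply: eq_bigr => F /and3P[_ _ /eqP rkF]; rewrite /flat_value -/M rkF.
  rewrite (exchange_big_dep (fun F => (F \in flats M) && (setact (eact em) F w == F))) /=; last first.
    by move=> p F _ /and3P[-> -> _].
  apply: eq_bigr => F /andP[]; rewrite inE => fF fixF.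
  have lt : (mrank M F < r.+1)%N by rewrite ltnS; apply: mrank_mono => //; apply: flat_sub.
  by rewrite (big_pred1 (Ordinal lt)) // => p; rewrite inE fF fixF /= eq_sym.
move=> u /andP[/eqP szu Eu]; apply: inI_dependent; rewrite szu ltnS.
by apply: mrank_mono; rewrite ?valid_sub.
Qed.

Lemma flat_value_set0 em w : w \in W -> loopless (emat em) ->
  flat_value em w set0 = 1.
Proof.
move=> Ww loopM; rewrite /flat_value mrank0 // expr0 mul1r.
set em' := em_local em set0.
have E0 : ground (emat em') = set0 by rewrite /= setI0.
have Ww' : w \in flat_stab em set0.
  by rewrite mem_flat_stab // Ww; apply/eqP; apply: imset0.
rewrite os_char_qmx //.
have -> : tens_mx em' 0 w = 1%:M.
  apply: eq_words => s /andP[/nilP-> _].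
  by rewrite wordv_tens // mulmx1.
rewrite qmx1 mxtrace1.
(* Circuits are nonempty, so there are no relations over the empty ground set, and the empty word
   spans degree 0. *)
have I0 : os_ideal em' 0 = 0.
  apply/eqP; rewrite -submx0 -[os_ideal em' 0]mulmx1.
  apply: os_ideal_map => [a b i j _ _ Ei _|a b c _ _ _ cc]; first by rewrite E0 inE in Ei.
  have c0 := circuit_sub cc; rewrite E0 subset0 in c0.
  by have := circuit_neq0 cc; rewrite c0.
rewrite mxrank_coker I0 mxrank0 subn0.
suff -> : #|{: gword em' 0}| = 1%N by [].
rewrite card_sig (@eq_card _ _ predT) ?card_tuple ?expn0 // => t.
by rewrite !inE tuple0.
Qed.

Lemma flat_value_local em w F G : w \in W -> flat (emat em) F -> flat (emat em) G ->
  G \subset F -> setact (eact em) F w = F -> setact (eact em) G w = G ->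
  flat_value (em_local em F) w G = flat_value em w G.
Proof.
move=> Ww fF fG sGF fixF fixG; congr (_ * _).
exact: os_char_local_local.
Qed.

End FlatValueSums.

Section LocalValues.
Variables (gT : finGroupType) (W : {group gT}) (I : finType).
Variables (em : equivMatroid W I) (w : gT).
Hypotheses (Ww : w \in W) (loopM : loopless (emat em)).
Local Notation M := (emat em).
Local Notation act A := (setact (eact em) A w).
Implicit Types (F G : {set I}).

Lemma sum_flats_local (V : nmodType) (f : {set I} -> V) F : flat M F ->
  \sum_(G in flats (emat (em_local em F)) | setact (eact (em_local em F)) G w == G) f G
  = \sum_(G in flats M | (act G == G) && (G \subset F)) f G.
Proof.
move=> fF; apply: eq_bigl => G; rewrite !inE /= flat_restrict // -andbA.
by congr (_ && _); apply: andbC.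
Qed.

Lemma charpoly_local F : flat M F -> act F = F ->
  gr_value w (equiv_charpoly (em_local em F)) =
  \sum_(G in flats M | (act G == G) && (G \subset F))
     flat_value em w G *: 'X^(mrank M F - mrank M G).
Proof.
move=> fF fixF; rewrite charpoly_flats.
- rewrite sum_flats_local //; apply: eq_bigr => G /and3P[].
  rewrite inE => fG /eqP fixG sGF; rewrite flat_value_local //.
  by rewrite mrk_restrict.
- by rewrite mem_flat_stab Ww fixF eqxx.
- exact: loopless_restrict.
Qed.

(* Hence flat_value is the Moebius function mu(0, -) of the lattice of w-stable
   flats. *)
Lemma sum_flat_value F : flat M F -> act F = F ->
  \sum_(G in flats M | (act G == G) && (G \subset F)) flat_value em w G
    = (F == set0)%:R.
Proof.
move=> fF fixF; have [->|nz] := eqVneq F set0.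
  rewrite (big_pred1 set0) ?flat_value_set0 // => G; rewrite subset0.
  case: (G =P set0) => [->|/eqP/negPf nz]; last by rewrite !andbF /= nz.
  rewrite andbT inE flat0 //= eqxx.
  by apply/eqP/imset0.
rewrite -sum_flats_local //.
rewrite -[RHS](@sum_flat_value0 _ _ _ (em_local em F) w) //.
- apply: eq_bigr => G /andP[]; rewrite inE /= flat_restrict // => /andP[fG sGF] /eqP fixG.
  by rewrite flat_value_local.
- by rewrite mem_flat_stab Ww fixF eqxx.
- exact: loopless_restrict.
- by rewrite /= (setIidPr (flat_sub fF)).
Qed.

End LocalValues.

(** * Kazhdan-Lusztig polynomials depend only on the lattice of flats *)

(** The two groups are unrelated: only the single elements [w1] and [w2] are matched, because values
    at one group element are to be compared. Off the flats both maps are arbitrary. *)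
Record flat_iso (gT1 : finGroupType) (W1 : {group gT1}) (I1 : finType)
    (em1 : equivMatroid W1 I1) (w1 : gT1)
    (gT2 : finGroupType) (W2 : {group gT2}) (I2 : finType)
    (em2 : equivMatroid W2 I2) (w2 : gT2)
    (phi : {set I1} -> {set I2}) (psi : {set I2} -> {set I1}) : Prop := FlatIso {
  fi_flat : forall F, flat (emat em1) F -> flat (emat em2) (phi F);
  fi_flat_inv : forall G, flat (emat em2) G -> flat (emat em1) (psi G);
  fi_can : forall F, flat (emat em1) F -> psi (phi F) = F;
  fi_can_inv : forall G, flat (emat em2) G -> phi (psi G) = G;
  fi_subset : forall F F', flat (emat em1) F -> flat (emat em1) F' ->
    (phi F \subset phi F') = (F \subset F');
  fi_rank : forall F, flat (emat em1) F -> mrank (emat em2) (phi F) = mrank (emat em1) F;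
  fi_act : forall F, flat (emat em1) F ->
    phi (setact (eact em1) F w1) = setact (eact em2) (phi F) w2 }.

Section FlatIsoTheory.
Variables (gT1 : finGroupType) (W1 : {group gT1}) (I1 : finType).
Variables (em1 : equivMatroid W1 I1) (w1 : gT1).
Variables (gT2 : finGroupType) (W2 : {group gT2}) (I2 : finType).
Variables (em2 : equivMatroid W2 I2) (w2 : gT2).
Variables (phi : {set I1} -> {set I2}) (psi : {set I2} -> {set I1}).
Hypothesis iso : flat_iso em1 w1 em2 w2 phi psi.
Hypotheses (Ww1 : w1 \in W1) (Ww2 : w2 \in W2).
Hypotheses (loop1 : loopless (emat em1)) (loop2 : loopless (emat em2)).
Local Notation M1 := (emat em1).
Local Notation M2 := (emat em2).
Implicit Types (F : {set I1}).

Lemma fi_ground : phi (ground M1) = ground M2.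
Proof.
apply/eqP; rewrite eqEsubset flat_sub ?(fi_flat iso) ?flat_ground //=.
rewrite -{1}(fi_can_inv iso (flat_ground M2)) (fi_subset iso) ?flat_ground //.
  by apply: flat_sub; apply: (fi_flat_inv iso); apply: flat_ground.
by apply: (fi_flat_inv iso); apply: flat_ground.
Qed.

Lemma fi_mrk : mrk M2 = mrk M1.
Proof. by rewrite /mrk -fi_ground (fi_rank iso) // flat_ground. Qed.

Lemma fi_set0 : phi set0 = set0.
Proof.
have f1 := flat0 loop1; have f2 := flat0 loop2; apply/eqP; rewrite -subset0.
rewrite -(fi_can_inv iso f2) (fi_subset iso) ?sub0set //; exact: (fi_flat_inv iso).
Qed.

Lemma fi_eq0 F : flat M1 F -> (phi F == set0) = (F == set0).
Proof.
move=> fF; apply/eqP/eqP=> [h|->]; last exact: fi_set0.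
by rewrite -(fi_can iso fF) h -fi_set0 (fi_can iso) // flat0.
Qed.

Lemma fi_fix F : flat M1 F ->
  (setact (eact em2) (phi F) w2 == phi F) = (setact (eact em1) F w1 == F).
Proof.
move=> fF; rewrite -(fi_act iso) //; apply/eqP/eqP=> [h|-> //].
by rewrite -[RHS](fi_can iso) // -h (fi_can iso) //; apply: setact_flat.
Qed.

Lemma fi_sum (V : nmodType) (f : {set I2} -> V) (P1 : pred {set I1}) (P2 : pred {set I2}) :
  (forall F, flat M1 F -> P1 F = P2 (phi F)) ->
  \sum_(G in flats M2 | P2 G) f G = \sum_(F in flats M1 | P1 F) f (phi F).
Proof.
move=> eqP12; rewrite (reindex_onto phi psi) => [|G /andP[]]; last first.
  by rewrite inE => fG _; apply: (fi_can_inv iso).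
apply: eq_bigl => F; rewrite !inE; apply/andP/andP=> [[/andP[fF PF] /eqP K]|[fF PF]].
  by have := fi_flat_inv iso fF; rewrite K => f1F; rewrite eqP12.
by rewrite (fi_flat iso) // -eqP12 // PF (fi_can iso).
Qed.

(** Strong induction on the size of [F]: [sum_flat_value] determines the value at [F] from those at
    the smaller stable flats. *)
Lemma flat_value_iso F : flat M1 F -> setact (eact em1) F w1 = F ->
  flat_value em2 w2 (phi F) = flat_value em1 w1 F.
Proof.
have [n] := ubnP #|F|; elim: n F => // n IH F leF fF fixF.
have fix2 : setact (eact em2) (phi F) w2 = phi F by apply/eqP; rewrite fi_fix ?fixF.
have := sum_flat_value Ww2 loop2 (fi_flat iso fF) fix2.
have := sum_flat_value Ww1 loop1 fF fixF.
rewrite fi_eq0 // => <-.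
rewrite (fi_sum _ (P1 := fun G : {set I1} => (setact (eact em1) G w1 == G) && (G \subset F))); last first.
  by move=> G fG; rewrite fi_fix // (fi_subset iso).
rewrite (bigD1 F) /= ?inE ?fF ?fixF ?eqxx ?subxx //.
rewrite [in RHS](bigD1 F) /= ?inE ?fF ?fixF ?eqxx ?subxx //.
set s1 := \sum_(i | _) _; set s2 := \sum_(i | _) _.
suff -> : s1 = s2 by apply: addIr.
apply: eq_bigr => G; rewrite -!andbA => /and4P[]; rewrite inE => fG /eqP fixG sGF neGF.
rewrite ltnS in leF; apply: IH => //; apply: leq_trans leF.
by apply: proper_card; rewrite properEneq neGF.
Qed.

Lemma charpoly_iso :
  gr_value w1 (equiv_charpoly em1) = gr_value w2 (equiv_charpoly em2).
Proof.
rewrite !charpoly_flats // fi_mrk.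
rewrite (fi_sum _ (P1 := fun G : {set I1} => setact (eact em1) G w1 == G)); last first.
  by move=> G fG; rewrite fi_fix.
apply: eq_bigr => F /andP[]; rewrite inE => fF /eqP fixF.
by rewrite flat_value_iso // (fi_rank iso).
Qed.

Lemma fi_local F : flat M1 F ->
  flat_iso (em_local em1 F) w1 (em_local em2 (phi F)) w2 phi psi.
Proof.
move=> fF; have f2 := fi_flat iso fF.
have f1E G : flat (emat (em_local em1 F)) G = flat M1 G && (G \subset F) by apply: flat_restrict.
have f2E G : flat (emat (em_local em2 (phi F))) G = flat M2 G && (G \subset phi F) by apply: flat_restrict.
split=> [G|G|G|G|G G'|G|G].
- by rewrite f1E f2E => /andP[fG sGF]; rewrite (fi_flat iso) // (fi_subset iso).
- rewrite f1E f2E => /andP[fG sGF]; rewrite (fi_flat_inv iso) //=.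
  by rewrite -(fi_subset iso) ?(fi_flat_inv iso) // (fi_can_inv iso).
- by rewrite f1E => /andP[fG _]; apply: (fi_can iso).
- by rewrite f2E => /andP[fG _]; apply: (fi_can_inv iso).
- by rewrite !f1E => /andP[fG _] /andP[fG' _]; apply: (fi_subset iso).
- by rewrite f1E => /andP[fG _]; apply: (fi_rank iso).
- by rewrite f1E => /andP[fG _]; apply: (fi_act iso).
Qed.

Lemma fi_contract F : flat M1 F -> setact (eact em1) F w1 = F ->
  flat_iso (em_contract em1 F) w1 (em_contract em2 (phi F)) w2
    (fun G => phi (G :|: F) :\: phi F) (fun G => psi (G :|: phi F) :\: F).
Proof.
move=> fF fixF; have f2 := fi_flat iso fF.
have fix2 : setact (eact em2) (phi F) w2 = phi F by apply/eqP; rewrite fi_fix ?fixF.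
have f1E G : flat (emat (em_contract em1 F)) G =
  (G \subset ground M1 :\: F) && flat M1 (G :|: F) by apply: flat_contract.
have f2E G : flat (emat (em_contract em2 (phi F))) G =
  (G \subset ground M2 :\: phi F) && flat M2 (G :|: phi F) by apply: flat_contract.
have phiU G : flat M1 (G :|: F) -> phi (G :|: F) :\: phi F :|: phi F = phi (G :|: F).
  by move=> fG; rewrite setDE setUIl [~: _ :|: _]setUC setUCr setIT; apply/setUidPl;
     rewrite (fi_subset iso) // subsetUr.
have psiU G : flat M2 (G :|: phi F) -> psi (G :|: phi F) :\: F :|: F = psi (G :|: phi F).
  move=> fG; rewrite setDE setUIl [~: _ :|: _]setUC setUCr setIT; apply/setUidPl.
  by rewrite -(fi_subset iso) ?(fi_flat_inv iso) // (fi_can_inv iso) ?subsetUr.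
have DU (T : finType) (A B E : {set T}) : A \subset E :\: B -> (A :|: B) :\: B = A.
  by rewrite subsetD setDUl setDv setU0 => /andP[_]; rewrite -setI_eq0 setDE -{2}(setIT A) => h;
     apply/setP=> x; move/eqP/setP/(_ x): h; rewrite !inE; case: (x \in A); case: (x \in B).
split=> [G|G|G|G|G G'|G|G].
- rewrite f1E f2E => /andP[sG fG]; rewrite phiU // (fi_flat iso) // andbT.
  by rewrite setSD // flat_sub // (fi_flat iso).
- rewrite f1E f2E => /andP[sG fG]; rewrite psiU // (fi_flat_inv iso) // andbT.
  by rewrite setSD // flat_sub // (fi_flat_inv iso).
- rewrite f1E => /andP[sG fG]; rewrite phiU // (fi_can iso) //; exact: DU sG.
- rewrite f2E => /andP[sG fG]; rewrite psiU // (fi_can_inv iso) //; exact: DU sG.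
- rewrite !f1E => /andP[sG fG] /andP[sG' fG']; apply/idP/idP=> sub.
    rewrite -(DU _ _ _ _ sG) -(DU _ _ _ _ sG') setSD // -(fi_subset iso) //.
    by rewrite -(phiU _ fG) -(phiU _ fG') setSU.
  by rewrite setSD // (fi_subset iso) // setSU.
- rewrite f1E => /andP[sG fG]; rewrite !mrank_contract ?phiU ?(fi_rank iso) //.
  by rewrite setSD // flat_sub // (fi_flat iso).
- rewrite f1E => /andP[sG fG].
  change (phi (setact (eact em1) G w1 :|: F) :\: phi F
    = setact (eact em2) (phi (G :|: F) :\: phi F) w2).
  have -> : setact (eact em1) G w1 :|: F = setact (eact em1) (G :|: F) w1.
    by rewrite [RHS]imsetU -/(setact (eact em1) F w1) fixF.
  rewrite (fi_act iso) //.
  rewrite -{1}fix2; apply/setP=> y; apply/setDP/imsetP => [[/imsetP[x hx ->] ny]|[x]].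
    by exists x => //; rewrite inE hx andbT; apply: contra ny; apply: imset_f.
  rewrite inE => /andP[nx hx] ->; rewrite mem_setact_act; split=> //.
  by rewrite mem_setact_act.
Qed.

End FlatIsoTheory.

(** Translation by [y] matches the action of a conjugate with that of [w]. It is meant for the
    conjugates of [w] in the formula for induced class functions. *)
Lemma fi_conj (gT : finGroupType) (W : {group gT}) (I : finType)
    (em : equivMatroid W I) (w y : gT) : w \in W -> y \in W ->
  flat_iso em (w ^ y)%g em w
    (fun F => setact (eact em) F y^-1%g) (fun F => setact (eact em) F y).
Proof.
move=> Ww Wy; have WV : y^-1%g \in W by rewrite groupV.
split=> [G|G|G|G|G G'|G|G].
- exact: setact_flat.
- exact: setact_flat.
- by move=> _; apply: (actKVin (set_action (eact em)) Wy).
- by move=> _; apply: (actKin (set_action (eact em)) Wy).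
- by move=> _ _; apply: setact_subset.
- by move=> /flat_sub; apply: eact_rank.
- move=> _; rewrite -!(actMin (set_action (eact em))) ?groupM ?groupJ //.
  by rewrite /conjg !mulgA mulgK.
Qed.

Lemma gr_value_Ind (gT : finGroupType) (W H : {group gT}) (f : {poly 'CF(H)}) w :
  H \subset W -> gr_value w (map_poly 'Ind[W, H] f)
    = (#|H|%:R^-1)%:P * \sum_(y in W) gr_value (w ^ y)%g f.
Proof.
move=> sHW; apply/polyP=> i; rewrite coef_gr_value coefCM coef_map cfIndE // coef_sum.
by congr (_ * _); apply: eq_bigr => y _; rewrite coef_gr_value.
Qed.

(** * Induction from stabilizers as a sum over stable flats *)

Section OrbitSum.
Variables (gT : finGroupType) (W : {group gT}) (I : finType).
Variables (em : equivMatroid W I).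
Local Notation act A w := (setact (eact em) A w).
Local Notation orbits := (orbit_transversal (eact em)^* W (flats (emat em))).

Lemma flats_acts : [acts W, on flats (emat em) | (eact em)^*].
Proof.
apply/subsetP=> w Ww; rewrite /astabs inE Ww inE; apply/subsetP=> F.
by rewrite !inE; apply: setact_flat.
Qed.

Lemma sum_orbit_stab (V : nmodType) (g : {set I} -> V) F :
  \sum_(y in W) g (act F y) = \sum_(G in orbit (eact em)^* W F) g G *+ #|flat_stab em F|.
Proof.
rewrite (partition_big (fun y => act F y) (fun G => G \in orbit (eact em)^* W F)) /=; last first.
  by move=> y Wy; apply: mem_orbit.
apply: eq_bigr => G /imsetP[a Wa ->].
rewrite (eq_bigr (fun=> g (act F a))) => [|y /andP[_ /eqP->]//].
rewrite sumr_const; congr (_ *+ _).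
have := @amove_act _ _ _ (eact em)^* W F (subxx _) a Wa; rewrite astab1_set.
move/(congr1 (fun X : {set gT} => #|X|)); rewrite card_rcoset => <-.
by apply: eq_card => y; rewrite !inE.
Qed.

Lemma sum_transversal (V : nmodType) (g : {set I} -> V) (D : pred {set I}) :
  (forall F w, w \in W -> D (act F w) = D F) ->
  \sum_(F in orbits | D F) \sum_(G in orbit (eact em)^* W F) g G
    = \sum_(F in flats (emat em) | D F) g F.
Proof.
move=> invD; have [_ /subsetP sT inT exT] := orbit_transversalP flats_acts.
rewrite (exchange_big_dep (fun F => (F \in flats (emat em)) && D F)) /=; last first.
  move=> F G /andP[/sT fF DF] /imsetP[a Wa ->]; rewrite invD // DF andbT.
  by have := acts_act flats_acts Wa F; rewrite /= fF => ->.
apply: eq_bigr => G /andP[fG DG]; have [a Wa Ta] := exT G fG.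
rewrite (big_pred1 (act G a)) // => F /=.
have oG : G \in orbit (eact em)^* W (act G a).
  by apply/orbit_in_eqP; rewrite ?subxx //; apply/esym/orbit_in_eqP; rewrite ?subxx // mem_orbit.
apply/idP/eqP=> [/andP[/andP[TF _] oF]|->]; last by rewrite Ta invD // DG oG.
apply/eqP; rewrite -inT //.
have <- : orbit (eact em)^* W G = orbit (eact em)^* W F.
  by apply/orbit_in_eqP; rewrite ?subxx.
exact: mem_orbit.
Qed.

(** The conjugate of [w] by y stabilizes F exactly when [w] fixes the translate of F by the inverse
    of y, and every flat in the orbit of F is such a translate for as many y as the stabilizer has
    elements; so the orbit representatives disappear. [D] makes it possible to leave out the empty
    flat, for which the conjugation hypothesis is out of reach of an induction on the rank. *)
Lemma sum_Ind_transversal (chi : forall F, {poly 'CF(flat_stab em F)}) w (D : pred {set I}) :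
  w \in W -> (forall F v, v \in W -> D (act F v) = D F) ->
  (forall F y, flat (emat em) F -> D F -> y \in W -> act F y^-1%g \in flats (emat em) ->
     act (act F y^-1%g) w = act F y^-1%g ->
     gr_value (w ^ y)%g (chi F) = gr_value w (chi (act F y^-1%g))) ->
  \sum_(F in orbits | D F) gr_value w (map_poly 'Ind[W, flat_stab em F] (chi F))
    = \sum_(F in flats (emat em) | D F && (act F w == F)) gr_value w (chi F).
Proof.
move=> Ww invD conj; have [_ /subsetP sT _ _] := orbit_transversalP flats_acts.
pose g F := if act F w == F then gr_value w (chi F) else 0.
transitivity (\sum_(F in flats (emat em) | D F) g F); last first.
  rewrite [RHS](eq_bigl (fun F => ((F \in flats (emat em)) && D F) && (act F w == F))).
    by rewrite [RHS]big_mkcondr.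
  by move=> F; rewrite andbA.
rewrite -sum_transversal //; apply: eq_bigr => F /andP[/sT]; rewrite inE => fF DF.
rewrite gr_value_Ind ?subsetIl //.
have -> : \sum_(y in W) gr_value (w ^ y)%g (chi F) = \sum_(y in W) g (act F y).
  rewrite [RHS](reindex_inj invg_inj) /=; apply: eq_big => [y|y Wy]; first by rewrite groupV.
  have WV : y^-1%g \in W by rewrite groupV.
  have fy : act F y^-1%g \in flats (emat em) by rewrite inE setact_flat.
  rewrite /g; case: eqP => [fix_y|nfix]; first exact: conj.
  rewrite gr_value0 // mem_flat_stab negb_and; apply/orP; right.
  apply: contra_notN nfix => /eqP h.
  rewrite -{2}h -!(actMin (set_action (eact em))) ?groupM ?groupJ //.
  by rewrite /conjg !mulgA mulgK.
rewrite sum_orbit_stab sumrMnl -[X in _ * X]mulr_natl mulrA -polyC_natr -polyCM.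
rewrite mulVf ?polyC1 ?mul1r //.
by rewrite pnatr_eq0 -lt0n cardG_gt0.
Qed.

End OrbitSum.

(** * The recursion evaluated at one group element *)

Section KazhdanLusztig.
Variables (P : KL_assignment) (hP : is_equivariant_KL P).

Definition kl_value (gT : finGroupType) (W : {group gT}) (I : finType)
    (em : equivMatroid W I) (w : gT) : {poly algC} := gr_value w (P em).

Lemma kl_rank0 (gT : finGroupType) (W : {group gT}) (I : finType)
    (em : equivMatroid W I) w : loopless (emat em) -> mrk (emat em) = 0%N -> w \in W ->
  kl_value em w = 1.
Proof.
move=> lM r0 Ww; rewrite /kl_value (eKL_rank0 hP) //; apply/polyP=> i.
by rewrite coef_gr_value !coef1; case: (i == 0)%N; rewrite ?cfun1E ?Ww ?cfunE.
Qed.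

Lemma kl_coef_high (gT : finGroupType) (W : {group gT}) (I : finType)
    (em : equivMatroid W I) i : loopless (emat em) -> (0 < mrk (emat em))%N ->
  (mrk (emat em) <= 2 * i)%N -> (P em)`_i = 0.
Proof.
move=> lM r0 lei; apply: nth_default; have lt := eKL_degree hP lM r0.
have : (2 * (size (P em)).-1 < 2 * i)%N by apply: leq_trans lei.
by rewrite ltn_mul2l /=; case: (size _).
Qed.

Definition kl_term (gT : finGroupType) (W : {group gT}) (I : finType)
    (em : equivMatroid W I) (F : {set I}) : {poly 'CF(flat_stab em F)} :=
  equiv_charpoly (em_local em F) * P (em_contract em F).

Lemma kl_term_value (gT : finGroupType) (W : {group gT}) (I : finType)
    (em : equivMatroid W I) (F : {set I}) w :
  gr_value w (kl_term em F) =
    gr_value w (equiv_charpoly (em_local em F)) * kl_value (em_contract em F) w.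
Proof. exact: gr_valueM. Qed.

(** Isolates what depends on Kazhdan-Lusztig polynomials, namely the equality for the contractions;
    it serves inside the induction that follows and once more after it. *)
Lemma kl_value_iso_contract gT1 (W1 : {group gT1}) I1 (em1 : equivMatroid W1 I1) w1
  gT2 (W2 : {group gT2}) I2 (em2 : equivMatroid W2 I2) w2 phi psi (F : {set I1}) :
  flat_iso em1 w1 em2 w2 phi psi -> w1 \in W1 -> w2 \in W2 ->
  loopless (emat em1) -> loopless (emat em2) ->
  flat (emat em1) F -> setact (eact em1) F w1 = F ->
  kl_value (em_contract em1 F) w1 = kl_value (em_contract em2 (phi F)) w2 ->
  gr_value w1 (kl_term em1 F) = gr_value w2 (kl_term em2 (phi F)).
Proof.
move=> iso Ww1 Ww2 l1 l2 fF fixF eqP12.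
have fix2 : setact (eact em2) (phi F) w2 = phi F by rewrite -(fi_act iso) ?fixF.
rewrite !kl_term_value eqP12; congr (_ * _).
apply: (charpoly_iso (fi_local iso fF)).
- by rewrite mem_flat_stab Ww1 fixF eqxx.
- by rewrite mem_flat_stab Ww2 fix2 eqxx.
- exact: loopless_restrict.
- exact: loopless_restrict.
Qed.

(* Since 2 deg P < rk, the coefficients of t^rk P(t^-1) above rk/2 determine P,
   and the term of the empty flat in the recursion does not contribute to them. *)
Lemma kl_value_iso gT1 (W1 : {group gT1}) I1 (em1 : equivMatroid W1 I1) w1
  gT2 (W2 : {group gT2}) I2 (em2 : equivMatroid W2 I2) w2 phi psi :
  flat_iso em1 w1 em2 w2 phi psi -> w1 \in W1 -> w2 \in W2 ->
  loopless (emat em1) -> loopless (emat em2) ->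
  kl_value em1 w1 = kl_value em2 w2.
Proof.
have [n] := ubnP (mrk (emat em1)).
elim: n gT1 W1 I1 em1 w1 gT2 W2 I2 em2 w2 phi psi => // n IH.
(* Contracting a nonempty flat lowers the rank, so the induction hypothesis covers its term. *)
have step hT1 (V1 : {group hT1}) J1 (m1 : equivMatroid V1 J1) v1
    hT2 (V2 : {group hT2}) J2 (m2 : equivMatroid V2 J2) v2 f g (F : {set J1}) :
    flat_iso m1 v1 m2 v2 f g -> v1 \in V1 -> v2 \in V2 ->
    loopless (emat m1) -> loopless (emat m2) -> (mrk (emat m1) < n.+1)%N ->
    flat (emat m1) F -> setact (eact m1) F v1 = F -> F != set0 ->
    gr_value v1 (kl_term m1 F) = gr_value v2 (kl_term m2 (f F)).
  move=> iso V1v V2v l1 l2 ltn fF fixF nzF.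
  have f2 := fi_flat iso fF.
  have fix2 : setact (eact m2) (f F) v2 = f F by rewrite -(fi_act iso) ?fixF.
  apply: (kl_value_iso_contract iso) => //.
  apply: (IH _ _ _ _ _ _ _ _ _ _ _ _ _ (fi_contract iso V1v fF fixF)).
  - rewrite mrk_contract // -ltnS; apply: leq_trans ltn; rewrite ltnS.
    have rF : (0 < mrank (emat m1) F)%N by rewrite mrank_flat_gt0.
    rewrite ltn_subrL rF /=; apply: leq_trans rF _.
    by apply: mrank_mono => //; apply: flat_sub.
  - by rewrite mem_flat_stab V1v fixF eqxx.
  - by rewrite mem_flat_stab V2v fix2 eqxx.
  - exact: loopless_contract.
  - exact: loopless_contract.
have rhs hT (V : {group hT}) J (m : equivMatroid V J) v i :
    v \in V -> loopless (emat m) -> (mrk (emat m) < n.+1)%N -> (0 < mrk (emat m))%N ->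
    (2 * i < mrk (emat m))%N ->
    (kl_value m v)`_i = (\sum_(F in flats (emat m) | (F != set0) && (setact (eact m) F v == F))
      gr_value v (kl_term m F))`_(mrk (emat m) - i).
  move=> Vv lM ltn r0 lti; set r := mrk (emat m) in ltn r0 lti *.
  have ler : (i <= r)%N by rewrite ltnW // (leq_ltn_trans _ lti) // leq_pmull.
  transitivity (gr_value v (poly_rev r (P m)))`_(r - i).
    by rewrite !coef_gr_value coef_poly ltnS leq_subr subKn.
  rewrite (eKL_recursion hP) // -/(kl_term _ _) gr_value_sum.
  rewrite (bigID (fun F => F != set0)) /= coefD.
  rewrite (@sum_Ind_transversal _ _ _ m (kl_term m)) //; last 2 first.
  - move=> F u Vu; congr (~~ _); apply/eqP/eqP=> [h|->]; last exact: imset0.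
    by apply/eqP; rewrite -cards_eq0 -(card_setact (eact m) F u) h cards0.
  - move=> F y fF nzF Vy _ fix_y.
    have iso := fi_conj m Vv Vy; have Vvy : (v ^ y)%g \in V by rewrite groupJ.
    by apply: (step _ _ _ _ _ _ _ _ _ _ _ _ _ iso) => //;
      apply/eqP; rewrite -(fi_fix iso) // fix_y.
  rewrite [X in _ + X](_ : _ = 0) ?addr0 // coef_sum big1 // => F /andP[_].
  rewrite negbK => /eqP ->; rewrite gr_value_Ind ?subsetIl // coefCM coef_sum.
  rewrite big1 ?mulr0 // => y Vy.
  have [sy|nsy] := boolP ((v ^ y)%g \in flat_stab m set0); last by rewrite gr_value0 ?coef0.
  have f0 := flat0 lM.
  rewrite kl_term_value charpoly_flats //; last exact: loopless_restrict.
  rewrite mrk_restrict // mrank0 //.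
  (* The restriction to the empty flat has rank 0 and a constant characteristic polynomial. What is
     left is the coefficient [r - i] of [P], which lies beyond its degree since [2 * i < r]. *)
  rewrite (eq_bigr (fun F => (flat_value (em_local m set0) (v ^ y)%g F)%:P)); last first.
    by move=> F' _; rewrite sub0n expr0 alg_polyC.
  rewrite -rmorph_sum /= coefCM coef_gr_value kl_coef_high ?cfunE ?mulr0 //.
  - exact: loopless_contract.
  - by rewrite mrk_contract // mrank0 // subn0.
  - rewrite mrk_contract // mrank0 // subn0 mulnBr -/r mul2n -addnn.
    by rewrite -addnBA ?leq_addr // ltnW // mul2n -mul2n.
move=> gT1 W1 I1 em1 w1 gT2 W2 I2 em2 w2 phi psi ltn iso Ww1 Ww2 l1 l2; have eqr := fi_mrk iso.
have [r0|rn0] := eqVneq (mrk (emat em1)) 0%N.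
  by rewrite !kl_rank0 // eqr.
rewrite -lt0n in rn0; apply/polyP=> i.
have [lti|lei] := ltnP (2 * i) (mrk (emat em1)); last first.
  by rewrite !coef_gr_value !kl_coef_high ?eqr // !cfunE.
rewrite !rhs ?eqr //; congr (nth _ (polyseq _) _).
rewrite [RHS](fi_sum iso _ (P1 := fun F => (F != set0) && (setact (eact em1) F w1 == F))).
  apply: eq_bigr => F /and3P[]; rewrite inE => fF nzF /eqP fixF.
  exact: (step _ _ _ _ _ _ _ _ _ _ _ _ _ iso).
by move=> F fF; rewrite (fi_eq0 iso) // (fi_fix iso).
Qed.

Section Recursion.
Variables (gT : finGroupType) (W : {group gT}) (I : finType).
Variables (em : equivMatroid W I) (w : gT).
Hypotheses (Ww : w \in W) (lM : loopless (emat em)).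

(** By [kl_value_iso] the conjugation hypothesis of [sum_Ind_transversal] now holds for every flat,
    the empty one included. *)
Lemma kl_value_recursion :
  gr_value w (poly_rev (mrk (emat em)) (P em)) =
  \sum_(F in flats (emat em) | setact (eact em) F w == F)
     gr_value w (equiv_charpoly (em_local em F)) * kl_value (em_contract em F) w.
Proof.
rewrite (eKL_recursion hP) // gr_value_sum.
transitivity (\sum_(F in orbit_transversal (eact em)^* W (flats (emat em)) | xpredT F)
    gr_value w (map_poly 'Ind[W, flat_stab em F] (kl_term em F))).
  by apply: eq_bigl => F; rewrite andbT.
rewrite sum_Ind_transversal //.
  by apply: eq_bigr => F _; apply: kl_term_value.
move=> F y fF _ Wy _ fix_y.
have iso := fi_conj em Ww Wy; have Wwy : (w ^ y)%g \in W by rewrite groupJ.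
have fixF : setact (eact em) F (w ^ y)%g = F.
  by apply/eqP; rewrite -(fi_fix iso) // fix_y.
apply: (kl_value_iso_contract iso) => //.
apply: (kl_value_iso (fi_contract iso Wwy fF fixF)).
- by rewrite mem_flat_stab Wwy fixF eqxx.
- by rewrite mem_flat_stab Ww fix_y eqxx.
- exact: loopless_contract.
- by apply: loopless_contract => //; apply: setact_flat => //; rewrite groupV.
Qed.
End Recursion.
End KazhdanLusztig.

(** * Braid matroids *)

Section EdgeKernel.
Variable n : nat.
Local Notation M := (braid_matroid n).
Implicit Types (T : eqType) (i j : 'I_n) (F : {set {set 'I_n}}) (w : 'S_n).

(** The flat of the partition of [n] into the fibers of [f]. Partitions are represented by such maps
    throughout. *)
Definition eker T (f : 'I_n -> T) : {set {set 'I_n}} :=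
  [set e in edges n | [forall i in e, forall j in e, f i == f j]].

Lemma mem_edge i j : ([set i; j] \in edges n) = (i != j).
Proof. by rewrite inE cards2; case: (i != j). Qed.

Lemma mem_eker T (f : 'I_n -> T) i j : i != j -> ([set i; j] \in eker f) = (f i == f j).
Proof.
move=> ij; rewrite inE mem_edge ij /=; apply/forall_inP/eqP=> [h|eqf x].
  by apply/eqP; apply: (forall_inP (h i _)); rewrite !inE eqxx ?orbT.
by case/set2P=> ->; apply/forall_inP=> y /set2P[] ->; rewrite ?eqf.
Qed.

Lemma eker_sub T (f : 'I_n -> T) : eker f \subset edges n.
Proof. by apply/subsetP=> e /setIdP[]. Qed.

Lemma edges_ext (A B : {set {set 'I_n}}) : A \subset edges n -> B \subset edges n ->
  (forall i j, i != j -> ([set i; j] \in A) = ([set i; j] \in B)) -> A = B.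
Proof.
move=> sA sB eqAB; apply/setP=> e; have [/edgesP[i [j [ij ->]]]|ne] := boolP (e \in edges n).
  exact: eqAB.
by rewrite !(contraNF (subsetP _ e) ne).
Qed.

Lemma eker_subset T T' (f : 'I_n -> T) (f' : 'I_n -> T') :
  reflect (forall i j, f i = f j -> f' i = f' j) (eker f \subset eker f').
Proof.
apply: (iffP subsetP) => [sub i j eqf|sub e].
  have [->//|ij] := eqVneq i j.
  by apply/eqP; rewrite -mem_eker // sub // mem_eker // eqf.
move=> h; have /edgesP[i [j [ij def_e]]] := subsetP (eker_sub f) e h.
by move: h; rewrite def_e !mem_eker // => /eqP/sub->.
Qed.

Lemma eq_eker T T' (f : 'I_n -> T) (f' : 'I_n -> T') :
  (forall i j, (f i == f j) = (f' i == f' j)) -> eker f = eker f'.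
Proof.
by move=> eqf; apply: edges_ext; rewrite ?eker_sub // => i j ij; rewrite !mem_eker.
Qed.

Lemma adjacent_eker T (f : 'I_n -> T) i j :
  adjacent (eker f) i j = (i != j) && (f i == f j).
Proof.
rewrite /adjacent; have [->|ij] := eqVneq i j; last exact: mem_eker.
by apply: contraTF isT => /(subsetP (eker_sub f)); rewrite mem_edge eqxx.
Qed.

Lemma connect_eker T (f : 'I_n -> T) i j : connect (adjacent (eker f)) i j = (f i == f j).
Proof.
apply/idP/idP=> [|eqf].
  case/connectP=> p; elim: p i => [|k p IH] i /=; first by move=> _ ->.
  by rewrite adjacent_eker => /andP[/andP[_ /eqP->]]; apply: IH.
have [->|ij] := eqVneq i j; first exact: connect0.
by apply: connect1; rewrite adjacent_eker ij.
Qed.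

Lemma n_comp_eker (T : finType) (f : 'I_n -> T) :
  n_comp (adjacent (eker f)) 'I_n = #|f @: 'I_n|.
Proof.
have cs := sym_connect_sym (@adjacent_sym n (eker f)).
have inj : {in roots (adjacent (eker f)) &, injective f}.
  move=> i j /eqP ri /eqP rj eqf.
  by rewrite -ri -rj; apply/eqP; rewrite (root_connect cs) connect_eker eqf.
transitivity #|[predI roots (adjacent (eker f)) & 'I_n]| => //.
rewrite -(@card_in_image _ _ f); last by move=> i j /andP[ri _] /andP[rj _]; apply: inj.
apply: eq_card => y; apply/imageP/imsetP=> [[i _ ->]|[i _ ->]]; first by exists i.
exists (fingraph.root (adjacent (eker f)) i).
  by rewrite !inE andbT; apply: roots_root.
by apply/eqP; rewrite -connect_eker connect_root.
Qed.

Lemma mrank_eker (T : finType) (f : 'I_n -> T) : mrank M (eker f) = (n - #|f @: 'I_n|)%N.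
Proof. by rewrite /= /graph_rank n_comp_eker. Qed.

Lemma card_im_le (T : finType) (f : 'I_n -> T) : (#|f @: 'I_n| <= n)%N.
Proof. by rewrite -[X in (_ <= X)%N]card_ord leq_imset_card. Qed.

Lemma flat_eker (T : eqType) (f : 'I_n -> T) : flat M (eker f).
Proof.
apply/flatP; split=> [|e Ee]; first exact: eker_sub.
have [i [j [ij ->]]] := edgesP Ee; rewrite mem_eker // => nf.
by rewrite /= graph_rank_setU1 // connect_eker nf addn1.
Qed.

Lemma flat_eker_root F : flat M F -> F = eker (fingraph.root (adjacent F)).
Proof.
move=> fF; have cs := sym_connect_sym (@adjacent_sym n F).
apply: edges_ext; rewrite ?eker_sub ?(flat_sub fF) // => i j ij.
rewrite mem_eker // (root_connect cs); apply/idP/idP=> [Fij|cij]; first exact: connect1.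
apply: (mem_flat fF (subxx F)); first by rewrite mem_edge.
by rewrite /= graph_rank_setU1 // cij addn0.
Qed.

Lemma flat_surj F : flat M F ->
  exists k (f : {ffun 'I_n -> 'I_k}),
    [/\ f @: 'I_n = setT, F = eker f & k = (n - mrank M F)%N].
Proof.
move=> fF; have defF := flat_eker_root fF; set r := fingraph.root _ in defF.
pose A := r @: 'I_n.
have cardA : #|A| = (n - mrank M F)%N.
  by rewrite [in RHS]defF mrank_eker subKn // card_im_le.
have Ar i : r i \in A by apply: imset_f.
exists #|A|, [ffun i => enum_rank_in (Ar i) (r i)]; split=> //.
  apply/setP=> k; rewrite inE; apply/imsetP.
  have /imsetP[i _ def_k] := enum_valP k; exists i => //.
  by rewrite ffunE; apply: enum_val_inj; rewrite enum_rankK_in.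
rewrite {1}defF; apply: eq_eker => i j; rewrite !ffunE.
apply/eqP/eqP=> [eqr|/(congr1 enum_val)]; last by rewrite !enum_rankK_in.
by apply: enum_val_inj; rewrite !enum_rankK_in.
Qed.

Lemma braid_loopless : loopless (emat (braid n)).
Proof.
move=> e Ee; have [i [j [ij ->]]] := edgesP Ee; rewrite /=.
have e0 : eker id = set0.
  apply/eqP; rewrite -subset0; apply/subsetP=> e' h.
  have /edgesP[x [y [xy def_e]]] := subsetP (eker_sub id) e' h.
  by move: h; rewrite def_e mem_eker // (negPf xy).
by rewrite -[[set [set i; j]]]setU0 graph_rank_setU1 // graph_rank_set0 -e0 connect_eker ij.
Qed.

Lemma mrk_braid : mrk (emat (braid n)) = n.-1.
Proof.
have -> : mrk (emat (braid n)) = mrank M (eker (fun=> tt : unit)).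
  congr (mrank M); apply: edges_ext; rewrite ?eker_sub // => i j ij.
  by rewrite mem_eker // mem_edge ij.
rewrite mrank_eker; case: n => [|m]; first by [].
rewrite (_ : _ @: _ = [set tt]) ?cards1 ?subn1 //.
by apply/setP=> -[]; rewrite in_set1; apply/imsetP; exists ord0.
Qed.

Lemma mem_edge_act F w i j :
  ([set w i; w j] \in setact (edge_act n) F w) = ([set i; j] \in F).
Proof. exact: adjacent_act. Qed.

Lemma act_eker T (f : 'I_n -> T) w : setact (edge_act n) (eker (f \o w)) w = eker f.
Proof.
apply: edges_ext; rewrite ?eker_sub //.
  change (is_true (setact (eact (braid n)) (eker (f \o w)) w \subset ground (emat (braid n)))).
  by rewrite setact_sub_ground ?inE // eker_sub.
move=> i j ij; rewrite -[i](permKV w) -[j](permKV w) mem_edge_act !mem_eker //=.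
  by rewrite !permKV.
by apply: contraNneq ij => eqi; rewrite -[i](permKV w) eqi permKV.
Qed.

Lemma fix_eker T (f : 'I_n -> T) w :
  (setact (edge_act n) (eker f) w == eker f) = [forall i, forall j, (f (w i) == f (w j)) == (f i == f j)].
Proof.
rewrite -{2}(act_eker f w) (inj_eq (imset_inj (act_inj _ w))).
apply/eqP/forallP=> [eqf i|h]; last first.
  by apply: eq_eker => i j; rewrite (eqP (forallP (h i) j)).
apply/forallP=> j; have [->|ij] := eqVneq i j; first by rewrite !eqxx.
by rewrite -(mem_eker (f \o w) ij) -eqf mem_eker.
Qed.

End EdgeKernel.

(* The map g is conjugate, through the observable r, to the cyclic shift of the
   sequences of length N over D; so g^d has #|D|^d fixed points when d divides N. *)
Record coding (C D : finType) (g : C -> C) (r : C -> D) (N : nat) : Prop := Coding {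
  coding_gt0 : (0 < N)%N;
  coding_period : forall c, iter N g c = c;
  coding_inj : forall c c',
    (forall s, (s < N)%N -> r (iter s g c) = r (iter s g c')) -> c = c';
  coding_surj : forall sigma : nat -> D,
    exists c, forall s, (s < N)%N -> r (iter s g c) = sigma s }.

Lemma iter_fix_modn (T : Type) (g : T -> T) N x s :
  (forall y, iter N g y = y) -> iter (s %% N) g x = iter s g x.
Proof.
move=> per; rewrite {2}(divn_eq s N) addnC iterD; congr iter.
by elim: (s %/ N)%N => [|k IH]; rewrite ?mul0n // mulSn iterD per.
Qed.

(** * Counting equivariant maps *)

Section EquivariantMaps.
Variables (n : nat) (w : 'S_n) (C D : finType) (g : C -> C) (r : C -> D) (N : nat).
Implicit Types (phi : {ffun 'I_n -> C}).
Hypotheses (cod : coding g r N) (wN : forall i, iter N w i = i).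

Definition eqmaps : {set {ffun 'I_n -> C}} := [set phi : {ffun 'I_n -> C} | [forall i, phi (w i) == g (phi i)]].

Lemma eqmapsP phi : reflect (forall i, phi (w i) = g (phi i)) (phi \in eqmaps).
Proof. by rewrite inE; apply: (iffP forallP) => h i; apply/eqP. Qed.

Lemma eqmaps_iter phi s i : phi \in eqmaps -> phi (iter s w i) = iter s g (phi i).
Proof. by move/eqmapsP=> h; elim: s => //= s IH; rewrite h IH. Qed.

Lemma coding_bij : injective g.
Proof.
apply: (can_inj (g := iter N.-1 g)) => c.
by rewrite -iterSr prednK ?(coding_gt0 cod) // (coding_period cod).
Qed.

Lemma fix_eqmaps phi : phi \in eqmaps -> setact (edge_act n) (eker phi) w = eker phi.
Proof.
move=> /eqmapsP h; apply/eqP; rewrite fix_eker; apply/forallP=> i; apply/forallP=> j.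
by rewrite !h (inj_eq coding_bij).
Qed.

Let coding_ex (sigma : nat -> D) :
  exists c, [forall s : 'I_N, r (iter s g c) == sigma s].
Proof.
have [c hc] := coding_surj cod sigma; exists c.
by apply/forallP=> s; rewrite hc.
Qed.

Let code sigma := xchoose (coding_ex sigma).

Let codeP sigma s : (s < N)%N -> r (iter s g (code sigma)) = sigma s.
Proof. by move=> lt; have /forallP/(_ (Ordinal lt))/eqP := xchooseP (coding_ex sigma). Qed.

Let codePn (sigma : nat -> D) s : (forall t, sigma (t %% N)%N = sigma t) ->
  r (iter s g (code sigma)) = sigma s.
Proof.
move=> per; rewrite -(iter_fix_modn _ _ (coding_period cod)) codeP ?per //.
by rewrite ltn_pmod ?(coding_gt0 cod).
Qed.

(** Such a [phi] is given by an arbitrary map [th] from [k] to [D], the observable of [phi] on the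
    fibers of [f]: equivariance forces the observable of g^s (phi i) to be the value of [th] on the
    fiber of w^s i, and these observables determine a point of [C]. They form an [N]-periodic
    sequence because [N] is a period of [w]. *)
Lemma card_eqmaps_const k (f : 'I_n -> 'I_k) : f @: 'I_n = setT ->
  setact (edge_act n) (eker f) w = eker f ->
  #|[set phi in eqmaps | eker f \subset eker phi]| = (#|D| ^ k)%N.
Proof.
move=> surjf /eqP; rewrite fix_eker => /forallP fixf.
have sec b : exists i, f i == b.
  have /imsetP[i _ ->] : b \in f @: 'I_n by rewrite surjf inE.
  by exists i.
pose sc b := xchoose (sec b); have scK b : f (sc b) = b by apply/eqP/(xchooseP (sec b)).
have fiter s i j : f i = f j -> f (iter s w i) = f (iter s w j).
  by move=> eqf; elim: s => //= s IH; apply/eqP; rewrite (eqP (forallP (fixf _) _)) IH.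
pose sg (th : {ffun 'I_k -> D}) i s := th (f (iter s w i)).
have sgP th i t : sg th i (t %% N)%N = sg th i t.
  by rewrite /sg (iter_fix_modn _ _ wN).
pose Phi (th : {ffun 'I_k -> D}) : {ffun 'I_n -> C} := [ffun i => code (sg th i)].
have PhiP th i s : r (iter s g (Phi th i)) = th (f (iter s w i)).
  by rewrite ffunE codePn.
have injPhi : injective Phi.
  move=> th th' eqth; apply/ffunP=> b; rewrite -(scK b).
  by rewrite -[LHS](PhiP th _ 0%N) eqth PhiP.
rewrite -[in RHS](card_ord k) -card_ffun -cardsT -(card_imset _ injPhi).
apply: eq_card => phi; apply/idP/imsetP.
  rewrite inE => /andP[ephi /eker_subset cphi].
  exists [ffun b => r (phi (sc b))] => //; apply/ffunP=> i.
  apply: (coding_inj cod) => s _; rewrite PhiP ffunE -eqmaps_iter //; congr r.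
  by apply: cphi; rewrite scK.
case=> th _ ->; rewrite inE; apply/andP; split.
  apply/eqmapsP=> i; apply: (coding_inj cod) => s _.
  by rewrite -iterSr !PhiP -iterSr.
apply/eker_subset=> i j eqf; apply: (coding_inj cod) => s _.
by rewrite !PhiP; congr (th _); apply: fiter.
Qed.

Local Notation em := (braid n).
Let aval G : algC := flat_value em w G.

(** Each power of [#|D|] counts the equivariant maps that are constant on the parts of [G]. After
    exchanging the sums, a map [phi] contributes the sum of the Moebius numbers below the flat
    [F :&: eker phi], which is 1 or 0. *)
Lemma sum_flats_count F : flat (emat em) F -> setact (eact em) F w = F ->
  \sum_(G in flats (emat em) | (setact (eact em) G w == G) && (G \subset F))
     aval G * (#|D| ^ (n - mrank (emat em) G))%:R
  = #|[set phi in eqmaps | F :&: eker phi == set0]|%:R.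
Proof.
move=> fF fixF; have Ww : w \in [set: 'S_n] by rewrite inE.
transitivity (\sum_(G in flats (emat em) | (setact (eact em) G w == G) && (G \subset F))
   \sum_(phi in eqmaps | G \subset eker phi) aval G).
  apply: eq_bigr => G /and3P[]; rewrite inE => fG /eqP fixG sGF.
  have [k [f [surjf defG <-]]] := flat_surj fG.
  have fixf : setact (eact em) (eker f) w = eker f by rewrite -defG.
  rewrite sumr_const -[RHS]mulr_natr; congr (_ * _%:R).
  rewrite -(card_eqmaps_const surjf fixf).
  rewrite -defG; apply: eq_card => phi; rewrite [LHS]inE.
  by [].
rewrite (exchange_big_dep (mem eqmaps)) /=; last by move=> G phi _ /andP[].
rewrite [RHS](_ : _ = (\sum_(phi in eqmaps) nat_of_bool (F :&: eker phi == set0))%N%:R); last first.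
  by rewrite -sum1_card big_mkcond /= [in RHS]big_mkcond /=; congr (_%:R); apply: eq_bigr => phi _;
     rewrite inE; case: (phi \in eqmaps); case: (_ == set0).
rewrite natr_sum; apply: eq_bigr => phi ephi.
have fI := flatI fF (flat_eker phi).
have fixI : setact (eact em) (F :&: eker phi) w = F :&: eker phi.
  rewrite [LHS]imsetI; first by rewrite -!/(setact _ _ _) fixF fix_eqmaps.
  by move=> x y _ _; apply: act_inj.
rewrite -[RHS](sum_flat_value Ww (@braid_loopless n) fI fixI).
apply: eq_bigl => G; rewrite subsetI ephi /= -!andbA.
by [].
Qed.

Lemma charpoly_local_count F : flat (emat em) F -> setact (eact em) F w = F ->
  (#|D| ^ (n - mrank (emat em) F))%:R
     * (gr_value w (equiv_charpoly (em_local em F))).[#|D|%:R]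
  = #|[set phi in eqmaps | F :&: eker phi == set0]|%:R.
Proof.
move=> fF fixF; have Ww : w \in [set: 'S_n] by rewrite inE.
rewrite (charpoly_local Ww (@braid_loopless n) fF fixF).
rewrite horner_sum mulr_sumr -(sum_flats_count fF fixF); apply: eq_bigr => G.
case/and3P; rewrite inE => fG _ sGF.
have le1 := mrank_mono sGF (flat_sub fF).
have le2 : (mrank (emat em) F <= n)%N by apply: leq_subr.
rewrite hornerZ hornerXn mulrCA -natrX -natrM -expnD; congr (_ * (_ ^ _)%:R).
by rewrite (addnBA _ le1) (subnK le2).
Qed.

(** The case of the full ground set, which has a single part, whence one factor [#|D|]; its
    intersection with the kernel of [phi] is empty exactly when [phi] is injective. *)
Lemma charpoly_braid_count : (0 < n)%N ->
  #|D|%:R * (gr_value w (equiv_charpoly em)).[#|D|%:R]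
  = #|[set phi in eqmaps | injectiveb phi]|%:R.
Proof.
move=> n0; have Ww : w \in [set: 'S_n] by rewrite inE.
rewrite (charpoly_flats Ww (@braid_loopless n)).
have fE := flat_ground (emat em).
have fixE := setact_ground em Ww.
transitivity (#|[set phi in eqmaps | ground (emat em) :&: eker phi == set0]|%:R : algC).
  rewrite horner_sum mulr_sumr -(sum_flats_count fE fixE); apply: eq_big => [G|G].
    by rewrite inE; case fG: (flat _ G); rewrite ?andbF // (flat_sub fG) andbT.
  case/andP; rewrite inE => fG _.
  rewrite hornerZ hornerXn mulrCA -natrX -natrM -expnS; congr (_ * (_ ^ _)%:R).
  have := mrank_mono (flat_sub fG) (subxx _); rewrite -/(mrk _) mrk_braid => le.
  by rewrite -subSn // prednK.
congr (_%:R); apply: eq_card => phi; rewrite !inE; congr (_ && _).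
rewrite (setIidPr (eker_sub phi)); apply/eqP/injectiveP=> [e0 i j eqf|inj].
  have [//|ij] := eqVneq i j.
  by have := in_set0 [set i; j]; rewrite -e0 mem_eker // eqf eqxx.
apply/eqP; rewrite -subset0; apply/subsetP=> e h.
have /edgesP[i [j [ij def_e]]] := subsetP (eker_sub phi) e h.
by move: h; rewrite def_e mem_eker // (inj_eq inj) (negPf ij).
Qed.

End EquivariantMaps.

Lemma surj_fiber (n k : nat) (f : 'I_n -> 'I_k) b : f @: 'I_n = setT -> exists i, f i == b.
Proof.
by move=> sf; have /imsetP[i _ ->] : b \in f @: 'I_n; [rewrite sf inE | exists i].
Qed.

(** * Contraction by a partition into k parts *)

Section BraidContraction.
Variables (n k : nat) (f : 'I_n -> 'I_k) (w : 'S_n) (u : 'S_k).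
Hypotheses (surjf : f @: 'I_n = setT) (fwu : forall i, f (w i) = u (f i)).

Let sec b := xchoose (surj_fiber b surjf).
Let secK b : f (sec b) = b. Proof. exact/eqP/(xchooseP (surj_fiber b surjf)). Qed.

Definition push_edges (A : {set {set 'I_n}}) : {set {set 'I_k}} := [set f @: (e : {set 'I_n}) | e in A].
Definition pull_edges (B : {set {set 'I_k}}) : {set {set 'I_n}} :=
  [set e in edges n | f @: (e : {set 'I_n}) \in B].

Lemma fix_eker_surj : setact (edge_act n) (eker f) w = eker f.
Proof.
apply/eqP; rewrite fix_eker; apply/forallP=> i; apply/forallP=> j.
by rewrite !fwu (inj_eq perm_inj).
Qed.

Lemma im_edge i j : f @: [set i; j] = [set f i; f j].
Proof. by rewrite imsetU !imset_set1. Qed.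

Lemma pull_eker (T : eqType) (h : 'I_k -> T) :
  pull_edges (eker h) = eker (h \o f) :\: eker f.
Proof.
have sub : pull_edges (eker h) \subset edges n by apply/subsetP=> e /setIdP[].
apply: edges_ext => // [|i j ij]; first exact: subset_trans (subsetDl _ _) (eker_sub _).
rewrite in_setD !mem_eker // inE mem_edge ij im_edge /=.
have [eqf|nef] := eqVneq (f i) (f j); last by rewrite mem_eker.
by apply: contraTF isT => /(subsetP (eker_sub h)); rewrite eqf mem_edge eqxx.
Qed.

Lemma push_pull (B : {set {set 'I_k}}) : B \subset edges k -> push_edges (pull_edges B) = B.
Proof.
move=> sB; apply/setP=> e; apply/imsetP/idP=> [[e' /setIdP[_ h] ->]//|Be].
have /edgesP[a [b [ab def_e]]] := subsetP sB e Be.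
exists [set sec a; sec b]; last by rewrite im_edge !secK.
rewrite inE im_edge !secK -def_e Be andbT mem_edge.
by apply: contraNneq ab => eqs; rewrite -(secK a) eqs secK.
Qed.

Let flatC A : flat (emat (em_contract (braid n) (eker f))) A =
  (A \subset edges n :\: eker f) && flat (emat (braid n)) (A :|: eker f).
Proof. by apply: flat_contract; apply: flat_eker. Qed.

Let flat_pull A : flat (emat (em_contract (braid n) (eker f))) A ->
  exists h : 'I_k -> 'I_n, A = pull_edges (eker h).
Proof.
rewrite flatC => /andP[sA fA]; set h' := fingraph.root (adjacent (A :|: eker f)).
have defA := flat_eker_root fA; rewrite -/h' in defA.
have hf i j : f i = f j -> h' i = h' j.
  by move: i j; apply/eker_subset; rewrite -defA subsetUr.
exists (h' \o sec); rewrite pull_eker.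
have -> : eker ((h' \o sec) \o f) = A :|: eker f.
  rewrite [RHS]defA; apply: eq_eker => i j /=.
  by congr (_ == _); apply: hf; rewrite secK.
rewrite setDUl setDv setU0; apply/esym/setDidPl.
by move: sA; rewrite subsetD => /andP[].
Qed.

Let pullU (T : eqType) (h : 'I_k -> T) :
  pull_edges (eker h) :|: eker f = eker (h \o f).
Proof.
rewrite pull_eker; apply/setP=> e; rewrite in_setU in_setD.
case fe: (e \in eker f); rewrite ?orbF //=.
by apply/esym; apply: (subsetP _ e fe); apply/eker_subset=> i j /= ->.
Qed.

Let flat_pullE (T : eqType) (h : 'I_k -> T) :
  flat (emat (em_contract (braid n) (eker f))) (pull_edges (eker h)).
Proof.
rewrite flatC pullU; apply/andP; split; last exact: flat_eker.
by rewrite pull_eker; apply: setSD; apply: eker_sub.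
Qed.

Let flat_braid B : flat (emat (braid k)) B -> exists h : 'I_k -> 'I_k, B = eker h.
Proof. by move=> fB; exists (fingraph.root (adjacent B)); apply: flat_eker_root. Qed.

Let im_comp (T : finType) (h : 'I_k -> T) : (h \o f) @: 'I_n = h @: 'I_k.
Proof. by rewrite imset_comp surjf; apply/setP=> y; apply/imsetP/imsetP=> -[x _ ->]; exists x; rewrite ?inE. Qed.

Let le_kn : (k <= n)%N.
Proof. by have := card_im_le f; rewrite surjf cardsT card_ord. Qed.

(** The contraction has parallel edges in general, one for each pair of vertices above an edge of
    B_k, so only the lattices of flats agree. A flat of the contraction comes from a map on [n] that
    factors through [f]. *)
Lemma braid_contract_iso :
  flat_iso (em_contract (braid n) (eker f)) w (braid k) u push_edges pull_edges.
Proof.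
have pK (T : eqType) (h : 'I_k -> T) : push_edges (pull_edges (eker h)) = eker h.
  by rewrite push_pull // eker_sub.
split=> [A|B|A|B|A A'|A|A].
- by move/flat_pull=> [h ->]; rewrite pK; apply: flat_eker.
- by move/flat_braid=> [h ->]; apply: flat_pullE.
- by move/flat_pull=> [h ->]; rewrite pK.
- by move/flat_braid=> [h ->]; rewrite pK.
- move/flat_pull=> [h ->] /flat_pull[h' ->]; rewrite !pK.
  apply/idP/idP=> sub.
    apply/subsetP=> e /setIdP[Ee he]; apply/setIdP; split=> //.
    exact: (subsetP sub).
  by rewrite -(pK _ h) -(pK _ h'); apply: imsetS.
- move=> fA; have [h defA] := flat_pull fA.
  rewrite [in RHS]mrank_contract ?flat_eker //; last by move: fA; rewrite flatC => /andP[].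
  rewrite defA pK pullU !mrank_eker surjf cardsT card_ord im_comp.
  by rewrite subnAC (subKn le_kn).
- move=> _; change (push_edges (setact (edge_act n) A w) = setact (edge_act k) (push_edges A) u).
  rewrite /push_edges /setact -!imset_comp; apply: eq_imset => e /=.
  rewrite /setact -!imset_comp; apply: eq_imset => i /=.
  exact: fwu.
Qed.

End BraidContraction.

(** * Flats as partitions with labelled parts *)

Section Surjections.
Variable n : nat.

Definition surjections k : {set {ffun 'I_n -> 'I_k}} :=
  [set f : {ffun 'I_n -> 'I_k} | f @: 'I_n == setT].

Lemma surjectionsP k (f : {ffun 'I_n -> 'I_k}) : reflect (f @: 'I_n = setT) (f \in surjections k).
Proof. by rewrite inE; apply: eqP. Qed.

Lemma surj_factor k (f f' : {ffun 'I_n -> 'I_k}) : f \in surjections k ->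
  f' \in surjections k -> (forall i j, (f' i == f' j) = (f i == f j)) ->
  exists u : 'S_k, forall i, f' i = u (f i).
Proof.
move=> /surjectionsP sf /surjectionsP sf' eqff.
pose sec b := xchoose (surj_fiber b sf).
have secK b : f (sec b) = b by apply/eqP/(xchooseP (surj_fiber b sf)).
have inj : injective (fun b => f' (sec b)).
  by move=> a b /eqP; rewrite eqff !secK => /eqP.
by exists (perm inj) => i; rewrite permE; apply/eqP; rewrite eqff secK.
Qed.

Lemma surj_unique k (f : {ffun 'I_n -> 'I_k}) (u v : 'S_k) : f \in surjections k ->
  (forall i, u (f i) = v (f i)) -> u = v.
Proof.
move=> /surjectionsP sf eqf; apply/permP=> b.
by have /eqP <- := xchooseP (surj_fiber b sf).
Qed.

Lemma card_surj_eker k (f : {ffun 'I_n -> 'I_k}) : f \in surjections k ->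
  #|[set f' in surjections k | eker f' == eker f]| = k`!.
Proof.
move=> sf; pose g (u : 'S_k) : {ffun 'I_n -> 'I_k} := [ffun i => u (f i)].
have inj : injective g.
  by move=> u v /ffunP eqg; apply: (surj_unique sf) => i; have := eqg i; rewrite !ffunE.
rewrite -card_Sn -(card_imset _ inj); apply: eq_card => f'.
rewrite inE; apply/andP/imsetP=> [[sf' /eqP eqk]|[u _ ->]].
  have [|u hu] := surj_factor sf sf'; last by exists u; rewrite ?inE //; apply/ffunP=> i; rewrite ffunE.
  move=> i j; apply/eqP/eqP; move: i j; apply/eker_subset; rewrite eqk; exact: subxx.
split; last by apply/eqP/eq_eker => i j; rewrite !ffunE (inj_eq perm_inj).
apply/surjectionsP/setP=> b; rewrite inE; apply/imsetP.
have /surjectionsP sf1 := sf; have /eqP eb := xchooseP (surj_fiber (u^-1%g b) sf1).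
by exists (xchoose (surj_fiber (u^-1%g b) sf1)); rewrite // ffunE eb permKV.
Qed.

(** A stable kernel induces exactly one permutation [u] of its labelled parts and an unstable one
    induces none, so the sum over [u] just tests stability. *)
Lemma sum_surj_perm (V : nmodType) k (w : 'S_n) (f : {ffun 'I_n -> 'I_k}) (x : V) :
  f \in surjections k ->
  \sum_(u : 'S_k | [forall i, f (w i) == u (f i)]) x
    = if setact (edge_act n) (eker f) w == eker f then x else 0.
Proof.
move=> sf; case: ifPn => [fixf|nfix]; last first.
  rewrite big_pred0 // => u; apply: contraNF nfix => /forallP hu; apply/eqP.
  by apply: (fix_eker_surj (u := u)) => i; apply/eqP.
have [||u hu] := @surj_factor k f [ffun i => f (w i)] sf.
- apply/surjectionsP/setP=> b; rewrite inE; apply/imsetP.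
  have /surjectionsP sf1 := sf; have /eqP eb := xchooseP (surj_fiber b sf1).
  by exists (w^-1%g (xchoose (surj_fiber b sf1))); rewrite // ffunE permKV eb.
- move=> i j; rewrite !ffunE; move: fixf; rewrite fix_eker.
  by move/forallP/(_ i)/forallP/(_ j)/eqP.
rewrite (big_pred1 u) // => v; apply/forallP/eqP=> [hv|-> i]; last by rewrite -hu ffunE.
by apply: (surj_unique sf) => i; rewrite -(eqP (hv i)) -hu ffunE.
Qed.

(** A flat with k parts is the kernel of k! surjections onto [k], one for each labelling of its
    parts. The factor 1/k! is also the one in the Frobenius characteristic of Q_k. *)
Lemma sum_flats_surj (V : lmodType algC) (w : 'S_n) (Phi : {set {set 'I_n}} -> V) :
  \sum_(F in flats (emat (braid n)) | setact (edge_act n) F w == F) Phi F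
  = \sum_(k < n.+1) (k`!%:R^-1 : algC) *: \sum_(f in surjections k)
      \sum_(u : 'S_k | [forall i, f (w i) == u (f i)]) Phi (eker f).
Proof.
have [Q QE] : exists Q : pred {set {set 'I_n}}, forall F,
    (F \in flats (emat (braid n))) && (setact (edge_act n) F w == F) = Q F by eexists.
rewrite (eq_bigl _ _ QE); transitivity (\sum_(k < n.+1) \sum_(F | Q F && (n - mrank (emat (braid n)) F == k)%N) Phi F).
  rewrite (exchange_big_dep Q) /=; last by move=> k F _ /andP[].
  apply: eq_bigr => F QF.
  have lt : (n - mrank (emat (braid n)) F < n.+1)%N by rewrite ltnS leq_subr.
  by rewrite (big_pred1 (Ordinal lt)) // => k; rewrite QF /= eq_sym.
apply: eq_bigr => k _.
rewrite (eq_bigr _ (fun (f : {ffun 'I_n -> 'I_k}) sf => sum_surj_perm w (Phi (eker f)) sf)) -big_mkcondr /=.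
have rk (f : {ffun 'I_n -> 'I_k}) : f \in surjections k ->
    (n - mrank (emat (braid n)) (eker f) = k)%N.
  move=> /surjectionsP sf; rewrite mrank_eker subKn ?card_im_le //.
  by rewrite sf cardsT card_ord.
rewrite (partition_big (fun f : {ffun 'I_n -> 'I_k} => eker f)
    (fun F => Q F && (n - mrank (emat (braid n)) F == k)%N)) /=; last first.
  move=> f /andP[sf fixf]; rewrite -QE fixf inE rk // eqxx !andbT.
  exact: flat_eker.
rewrite scaler_sumr; apply: eq_bigr => F /andP[]; rewrite -QE => /andP[fF fixF] /eqP rkF.
rewrite inE in fF; have [k' [f [sf defF def_k]]] := flat_surj fF.
have {}def_k : k' = k by rewrite def_k rkF.
rewrite {k'}def_k in f sf defF; have {}sf : f \in surjections k by apply/surjectionsP.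
rewrite (eq_bigr (fun=> Phi F)) => [|f' /andP[_ /eqP->]//].
rewrite sumr_const -scaler_nat scalerA.
rewrite (@eq_card _ _ [set f' in surjections k | eker f' == eker f]); last first.
  move=> f'; rewrite [RHS]inE -defF [LHS]unfold_in /=.
  rewrite -andbA; congr (_ && _); case: (eker f' =P F) => [->|_]; rewrite ?andbF //.
  by rewrite andbT.
rewrite card_surj_eker // mulVf ?scale1r // pnatr_eq0 -lt0n.
exact: fact_gt0.
Qed.

End Surjections.

Lemma braid_Qbar_value (P : KL_assignment) (hP : is_equivariant_KL P) n (w : 'S_n) :
  gr_value w (braid_Qbar P n) =
  \sum_(k < n.+1) (k`!%:R^-1 : algC) *: \sum_(f in surjections n k)
    \sum_(u : 'S_k | [forall i, f (w i) == u (f i)])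
      gr_value w (equiv_charpoly (em_local (braid n) (eker f))) * gr_value u (braid_Q P k).
Proof.
have Ww : w \in [set: 'S_n] by rewrite inE.
rewrite /braid_Qbar -mrk_braid.
rewrite (kl_value_recursion hP Ww (@braid_loopless n)).
rewrite (@sum_flats_surj _ _ w (fun F => gr_value w (equiv_charpoly (em_local (braid n) F))
  * kl_value P (em_contract (braid n) F) w)).
apply: eq_bigr => k _; congr (_ *: _); apply: eq_bigr => f /surjectionsP sf.
apply: eq_bigr => u /forallP fwu; congr (_ * _).
have {}fwu i : f (w i) = u (f i) by apply/eqP.
have iso := braid_contract_iso sf fwu.
apply: (kl_value_iso hP iso).
- by rewrite mem_flat_stab Ww; apply/eqP/(fix_eker_surj fwu).
- by rewrite inE.
- by apply: loopless_contract; [apply: braid_loopless | apply: flat_eker].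
- exact: braid_loopless.
Qed.

(** * Symmetric functions *)

From mathcomp Require Import finmap monalg.

(** * Plethysm through ring homomorphisms *)

Section MonomEval.
Variables (S : comNzRingType) (v : nat -> S).

Lemma monom_evalEw (d : {fset nat}) (m : {cmonom nat}) : (finsupp m `<=` d)%fset ->
  monom_eval v m = \prod_(i <- d) v i ^+ m i.
Proof.
move=> le; rewrite /monom_eval (big_fset_incl _ le) //= => i _.
by rewrite -cmE_eq0 => /eqP->; rewrite expr0.
Qed.

Lemma monom_eval1 : monom_eval v mone = 1.
Proof. by rewrite /monom_eval mdom1 big_seq_fset0. Qed.

Lemma monom_evalM : {morph monom_eval v : m1 m2 / mmul m1 m2 >-> m1 * m2}.
Proof.
move=> m1 m2; set d := (finsupp m1 `|` finsupp m2)%fset.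
rewrite !(@monom_evalEw d) ?fsubsetUl ?fsubsetUr ?mdomD //.
by rewrite -big_split; apply: eq_bigr => i _; rewrite cmM exprD.
Qed.

Lemma monom_eval_ucm i : monom_eval v (ucm i) = v i.
Proof. by rewrite /monom_eval mdomU big_seq_fset1 cmUU expr1. Qed.

HB.instance Definition _ := isMultiplicative.Build _ _ (monom_eval v)
  (conj monom_evalM monom_eval1).

End MonomEval.

Section Plethysm.
Variable g : symf.

Let pl : {rmorphism symf -> symf} :=
  mmap (@malgC {cmonom nat} {poly algC}) (monom_eval (fun i => psum_plethysm i.+1 g)).

Let plE f : plethysm f g = pl f. Proof. by []. Qed.

Lemma plethysm_sum (J : Type) (r : seq J) (Q : pred J) (F : J -> symf) :
  plethysm (\sum_(j <- r | Q j) F j) g = \sum_(j <- r | Q j) plethysm (F j) g.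
Proof. exact: (rmorph_sum pl). Qed.

Lemma plethysmZ (c : {poly algC}) (f : symf) : plethysm (c *: f) g = c *: plethysm f g.
Proof. by rewrite !plE -!mul_malgC rmorphM /= mmapC. Qed.

Lemma plethysm_prod (J : Type) (r : seq J) (Q : pred J) (F : J -> symf) :
  plethysm (\prod_(j <- r | Q j) F j) g = \prod_(j <- r | Q j) plethysm (F j) g.
Proof. exact: (rmorph_prod pl). Qed.

Lemma plethysm_psum k : (0 < k)%N -> plethysm (psum k) g = psum_plethysm k g.
Proof.
move=> /prednK <-; move: k.-1 => {}k; transitivity ((@malgC {cmonom nat} {poly algC} 1) *
    monom_eval (fun i => psum_plethysm i.+1 g) (ucm k)); first exact: mmapU.
by rewrite rmorph1 mul1r monom_eval_ucm.
Qed.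

End Plethysm.

Section PsumPlethysm.
Variable k : nat.

Let cf : {rmorphism {poly algC} -> symf} :=
  (@malgC {cmonom nat} {poly algC}) \o comp_poly 'X^k.

Let pl : {rmorphism symf -> symf} :=
  mmap cf (monom_eval (fun i => psum (i.+1 * k))).

Let plE f : psum_plethysm k f = pl f. Proof. by []. Qed.

Lemma psum_plethysm_sum (J : Type) (r : seq J) (Q : pred J) (F : J -> symf) :
  psum_plethysm k (\sum_(j <- r | Q j) F j) = \sum_(j <- r | Q j) psum_plethysm k (F j).
Proof. exact: (rmorph_sum pl). Qed.

Lemma psum_plethysmZ (c : {poly algC}) (f : symf) : psum_plethysm k (c *: f) = (c \Po 'X^k) *: psum_plethysm k f.
Proof. by rewrite !plE -!mul_malgC rmorphM /= mmapC. Qed.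

Lemma psum_plethysm_prod (J : Type) (r : seq J) (Q : pred J) (F : J -> symf) :
  psum_plethysm k (\prod_(j <- r | Q j) F j) = \prod_(j <- r | Q j) psum_plethysm k (F j).
Proof. exact: (rmorph_prod pl). Qed.

Lemma psum_plethysm_psum j : (0 < j)%N -> psum_plethysm k (psum j) = psum (j * k).
Proof.
move=> /prednK <-; move: j.-1 => {}j.
transitivity (cf 1 * monom_eval (fun i => psum (i.+1 * k)) (ucm j)).
  exact: (mmapU (f := cf)).
by rewrite rmorph1 mul1r monom_eval_ucm.
Qed.

End PsumPlethysm.

Lemma coef_symf_part n f m :
  (symf_part n f)@_m = if monom_degree m == n then f@_m else 0.
Proof.
rewrite /symf_part raddf_sum /=.
rewrite (eq_bigr (fun m' => if m' == m then f@_m else 0)); last first.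
  by move=> m' _; rewrite mcoeffU; case: eqP => [->|]; rewrite ?mulr1n ?mulr0n.
rewrite -big_mkcondr /=; case: ifPn => dm; last first.
  by rewrite big_pred0 // => m'; case: (m' =P m) => [->|_]; rewrite ?(negPf dm) ?andbF.
rewrite (eq_bigl (pred1 m)); last first.
  by move=> m' /=; case: (m' =P m) => [->|_]; rewrite ?dm ?andbF.
have [ms|nms] := boolP (m \in msupp f).
  by rewrite -big_filter filter_pred1_uniq ?fset_uniq ?big_seq1.
by rewrite mcoeff_outdom // big1.
Qed.

(* Symmetric functions with constant coefficients, the values of those of symf
   at t = q. *)
Definition csym := {malg algC[{cmonom nat}]}.

Definition cpsum (k : nat) : csym := << ucm k.-1 >>.

Section EvalAt.
Variable q : algC.

Definition ev_monom (m : {cmonom nat}) : csym := << m >>.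

Lemma ev_monomM : mmorphism ev_monom.
Proof.
split=> [m1 m2|//]; rewrite /ev_monom.
by rewrite [RHS]malgM_def fgmulUU mulr1.
Qed.

HB.instance Definition _ := isMultiplicative.Build _ _ ev_monom ev_monomM.

Definition ev : {rmorphism symf -> csym} :=
  mmap ((@malgC {cmonom nat} algC) \o horner_eval q) ev_monom.

Lemma coef_ev f m : (ev f)@_m = (f@_m).[q].
Proof.
rewrite /ev /= mmapE raddf_sum /= [in RHS](monalgE f) raddf_sum /= horner_sum.
apply: eq_bigr => m' _; rewrite mcoeffCM !mcoeffU.
by case: eqP => _; rewrite ?mulr1n ?mulr0n ?mulr1 ?mulr0 ?horner0.
Qed.

Lemma evZ (c : {poly algC}) (f : symf) : ev (c *: f) = c.[q] *: ev f.
Proof. by rewrite -!mul_malgC rmorphM /= mmapC. Qed.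

Lemma ev_psum k : ev (psum k) = cpsum k.
Proof. by rewrite /ev /= mmapU /= /horner_eval hornerC mul1r. Qed.

End EvalAt.

(** A nonzero polynomial has finitely many roots. The value q = 0 is left out because the identities
    to be tested carry a factor q^k that has to be cancelled. *)
Lemma poly_eq_nat (f g : {poly algC}) :
  (forall q : nat, (0 < q)%N -> f.[q%:R] = g.[q%:R]) -> f = g.
Proof.
move=> eqfg; apply/eqP; rewrite -subr_eq0; apply: contraT => nz.
pose s : seq algC := [seq i.+1%:R | i <- iota 0 (size (f - g))].
have us : uniq s.
  by rewrite map_inj_uniq ?iota_uniq // => i j /eqP; rewrite eqr_nat eqSS => /eqP.
have rs : all (root (f - g)) s.
  by apply/allP=> _ /mapP[i _ ->]; rewrite /root hornerD hornerN eqfg ?subrr.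
by have := max_poly_roots nz rs us; rewrite size_map size_iota ltnn.
Qed.

(** * Homogeneous elements *)

Lemma monom_degreeEw (d : {fset nat}) (m : {cmonom nat}) : (finsupp m `<=` d)%fset ->
  monom_degree m = (\sum_(i <- d) m i * i.+1)%N.
Proof.
move=> le; rewrite /monom_degree (big_fset_incl _ le) //= => i _.
by rewrite -cmE_eq0 => /eqP->; rewrite mul0n.
Qed.

Lemma monom_degree1 : monom_degree mone = 0%N.
Proof. by rewrite /monom_degree mdom1 big_seq_fset0. Qed.

Lemma monom_degreeM m1 m2 :
  monom_degree (mmul m1 m2) = (monom_degree m1 + monom_degree m2)%N.
Proof.
set d := (finsupp m1 `|` finsupp m2)%fset.
rewrite !(@monom_degreeEw d) ?fsubsetUl ?fsubsetUr ?mdomD //.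
by rewrite -big_split; apply: eq_bigr => i _; rewrite cmM mulnDl.
Qed.

Lemma monom_degree_ucm i : monom_degree (ucm i) = i.+1.
Proof. by rewrite /monom_degree mdomU big_seq_fset1 cmUU mul1n. Qed.

Definition homog (d : nat) (f : csym) : Prop :=
  forall m, monom_degree m != d -> f@_m = 0.

Lemma homog1 : homog 0 1.
Proof.
move=> m; rewrite mcoeff1; case: (m =P mone) => [->|//].
by rewrite monom_degree1.
Qed.

Lemma homogM d1 d2 f1 f2 : homog d1 f1 -> homog d2 f2 -> homog (d1 + d2) (f1 * f2).
Proof.
move=> h1 h2 m ned; rewrite malgME raddf_sum big1 //= => m1 _.
rewrite raddf_sum big1 //= => m2 _; rewrite mcoeffU; case: eqP => [defm|]; last by rewrite mulr0n.
have [e1|n1] := eqVneq (monom_degree m1) d1; last by rewrite h1 // mul0r mul0rn.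
have [e2|n2] := eqVneq (monom_degree m2) d2; last by rewrite h2 // mulr0 mul0rn.
by move: ned; rewrite -defm monom_degreeM e1 e2 eqxx.
Qed.

Lemma homog_cpsum k : (0 < k)%N -> homog k (cpsum k).
Proof.
case: k => // k _ m; rewrite /cpsum mcoeffU1 /=; case: (ucm k =P m) => [<-|//].
by rewrite monom_degree_ucm eqxx.
Qed.

Lemma homog_prod (J : Type) (r : seq J) (Q : pred J) (d : J -> nat) (F : J -> csym) :
  (forall j, Q j -> homog (d j) (F j)) ->
  homog (\sum_(j <- r | Q j) d j) (\prod_(j <- r | Q j) F j).
Proof.
by move=> h; apply: (big_rec2 homog) => [|j x y Qj hxy]; [apply: homog1 | apply: homogM; first exact: h].
Qed.

(** * Cycle types of stable subsets *)

Section CycleSets.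
Variables (Z : finType) (G : {perm Z}).
Implicit Types (S : {set Z}) (e : nat).

Definition pstable S : bool := [forall x in S, G x \in S].

(** For a stable [S] this is the product of power sums for the cycle type of [G] on [S], every index
    being multiplied by [e] as in the plethysm with p_e. *)
Definition cycset e S : csym := \prod_(O in porbits G | O \subset S) cpsum (#|O| * e).

Lemma pstableX S x i : pstable S -> x \in S -> (G ^+ i)%g x \in S.
Proof.
move=> /forall_inP st Sx; elim: i => [|i IH]; first by rewrite expg0 perm1.
by rewrite expgSr permM st.
Qed.

Lemma pstable_porbit S x : pstable S -> x \in S -> porbit G x \subset S.
Proof. by move=> st Sx; apply/subsetP=> y /porbitP[i ->]; apply: pstableX. Qed.

Lemma porbits_gt0 O : O \in porbits G -> (0 < #|O|)%N.
Proof. by case/imsetP=> x _ ->; apply/card_gt0P; exists x; apply: porbit_id. Qed.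

Lemma sum_card_porbits S : pstable S ->
  (\sum_(O in porbits G | O \subset S) #|O|)%N = #|S|.
Proof.
move=> st; rewrite -[RHS]sum1_card.
rewrite [RHS](partition_big (porbit G) (fun O => (O \in porbits G) && (O \subset S))) /=; last first.
  by move=> x Sx; rewrite pstable_porbit // andbT imset_f.
apply: eq_bigr => O /andP[/imsetP[x _ ->] sOS].
rewrite -sum1_card; apply: eq_bigl => y; rewrite eq_porbit_mem.
by case: (boolP (y \in porbit G x)) => [/(subsetP sOS)->|]; rewrite ?andbF ?andbT.
Qed.

Lemma homog_cycset e S : (0 < e)%N -> pstable S -> homog (#|S| * e) (cycset e S).
Proof.
move=> e0 st; rewrite -(sum_card_porbits st) big_distrl /=.
apply: homog_prod => O /andP[/porbits_gt0 O0 _].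
by apply: homog_cpsum; rewrite muln_gt0 O0.
Qed.

Variable n : nat.
Implicit Types (v : 'S_n) (th : {ffun 'I_n -> Z}).

Definition intertwines v th : bool := [forall i, th (v i) == G (th i)].

Lemma intertwinesX v th i j : intertwines v th -> th ((v ^+ j)%g i) = (G ^+ j)%g (th i).
Proof.
move/forallP=> h; elim: j => [|j IH]; first by rewrite !expg0 !perm1.
by rewrite !expgSr !permM (eqP (h _)) IH.
Qed.

Lemma intertwines_porbit v th i : intertwines v th -> th @: porbit v i = porbit G (th i).
Proof.
move=> h; apply/setP=> y; apply/imsetP/porbitP=> [[_ /porbitP[j ->] ->]|[j ->]].
  by exists j; apply: intertwinesX.
by exists ((v ^+ j)%g i); rewrite ?(intertwinesX _ _ h) // mem_porbit.
Qed.

Lemma intertwines_cycset v th e : intertwines v th -> injective th ->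
  \prod_(c in porbits v) cpsum (#|c| * e) = cycset e (th @: 'I_n).
Proof.
move=> h inj; rewrite /cycset.
have injS : injective (fun c : {set 'I_n} => th @: c) by apply: imset_inj.
rewrite (eq_bigr (fun c : {set 'I_n} => cpsum (#|th @: c| * e))); last first.
  by move=> c _; rewrite card_imset.
rewrite -(big_imset (fun O : {set Z} => cpsum (#|O| * e))) /=; last by move=> c c' _ _; apply: injS.
apply: eq_bigl => O; apply/imsetP/andP=> [[_ /imsetP[i _ ->] ->]|[/imsetP[z _ defO] sO]].
  by split; [rewrite (intertwines_porbit _ h) imset_f | apply: imsetS; apply/subsetP].
have /imsetP[i _ def_z] : z \in th @: 'I_n by apply: (subsetP sO); rewrite defO porbit_id.
by exists (porbit v i); rewrite ?imset_f // (intertwines_porbit _ h) -def_z.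
Qed.

(** If the image is stable, [th] transports the restriction of [G] back to [n], and no other
    permutation intertwines. *)
Lemma card_intertwines th : injective th ->
  #|[set v | intertwines v th]| = pstable (th @: 'I_n).
Proof.
move=> inj; have [st|nst] := boolP (pstable _); last first.
  apply: eq_card0 => v; rewrite inE; apply: contraNF nst => /forallP h.
  by apply/forall_inP=> _ /imsetP[i _ ->]; rewrite -(eqP (h i)) imset_f.
have ex i : exists j, th j == G (th i).
  have /imsetP[j _ ->] : G (th i) \in th @: 'I_n by apply: (forall_inP st); rewrite imset_f.
  by exists j.
pose p i := xchoose (ex i); have pE i : th (p i) = G (th i) by apply/eqP/(xchooseP (ex i)).
have injp : injective p.
  by move=> i j eqp; apply/inj/(@perm_inj _ G); rewrite -!pE eqp.
rewrite (_ : [set v | _] = [set perm injp]) ?cards1 //; apply/setP=> v; rewrite !inE.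
apply/forallP/eqP=> [h|-> i]; last by rewrite permE pE.
by apply/permP=> i; apply: inj; rewrite (eqP (h i)) permE pE.
Qed.

Lemma card_inj_im S : #|[set th : {ffun 'I_n -> Z} | injectiveb th & th @: 'I_n == S]|
  = if #|S| == n then n`! else 0%N.
Proof.
case: eqP => [cS|ncS]; last first.
  apply: eq_card0 => th; rewrite inE; apply/negP=> /andP[/injectiveP inj /eqP im].
  by case: ncS; rewrite -im card_imset // card_ord.
have := @card_inj_ffuns_on 'I_n Z (mem S).
rewrite (_ : #|mem S| = n) ?card_ord ?ffactnn; last by rewrite -[RHS]cS; apply: eq_card.
move=> <-; apply: eq_card => th; rewrite !inE andbC.
case: (boolP (injectiveb th)) => [/injectiveP inj|]; rewrite ?andbF ?andbT //.
rewrite eqEcard card_imset // card_ord cS leqnn andbT.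
apply/subsetP/ffun_onP=> [h i|h _ /imsetP[i _ ->]]; last exact: h.
by apply: h; rewrite imset_f.
Qed.

(** A pair of [v] and [th] amounts to a stable set of size [n] with one of its [n!] labellings by
    [n]: [v] is [G] on this set read through the labelling, and has its cycle type. *)
Lemma sum_intertwines e (D : pred {set Z}) :
  \sum_(v : 'S_n) \sum_(th : {ffun 'I_n -> Z} | [&& intertwines v th, injectiveb th & D (th @: 'I_n)])
     \prod_(c in porbits v) cpsum (#|c| * e)
  = (\sum_(S | [&& pstable S, #|S| == n & D S]) cycset e S) *+ n`!.
Proof.
rewrite (exchange_big_dep (fun th : {ffun 'I_n -> Z} => injectiveb th && D (th @: 'I_n))) /=; last first.
  by move=> v th _ /and3P[_ -> ->].
transitivity (\sum_(th : {ffun 'I_n -> Z} | [&& injectiveb th, D (th @: 'I_n) & pstable (th @: 'I_n)])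
    cycset e (th @: 'I_n)).
  rewrite [RHS](eq_bigl (fun th : {ffun 'I_n -> Z} =>
    (injectiveb th && D (th @: 'I_n)) && pstable (th @: 'I_n))) => [|th]; last by rewrite andbA.
  rewrite [RHS]big_mkcondr; apply: eq_bigr => th /andP[/injectiveP inj DI].
  rewrite (eq_bigr (fun=> cycset e (th @: 'I_n))) => [|v /and3P[h _ _]]; last first.
    exact: intertwines_cycset.
  rewrite sumr_const (@eq_card _ _ [set v | intertwines v th]) ?card_intertwines //.
    by case: ifP; rewrite ?mulr1n ?mulr0n.
  move=> v; rewrite [RHS]inE unfold_in /= DI andbT.
  have -> : injectiveb th by apply/injectiveP.
  by rewrite ?andbT.
rewrite (partition_big (fun th : {ffun 'I_n -> Z} => th @: 'I_n) (fun S => D S && pstable S)) /=; last first.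
  by move=> th /and3P[_ -> ->].
rewrite -sumrMnl [RHS](eq_bigl (fun S => (D S && pstable S) && (#|S| == n))); last first.
  by move=> S; case: (pstable S); case: (D S); rewrite ?andbT ?andbF.
rewrite [RHS]big_mkcondr; apply: eq_bigr => S /andP[DS sS].
rewrite (eq_bigr (fun=> cycset e S)) => [|th /andP[_ /eqP->] //].
rewrite sumr_const (@eq_card _ _ [set th : {ffun 'I_n -> Z} | injectiveb th & th @: 'I_n == S]).
  by rewrite card_inj_im; case: ifP; rewrite ?mulr0n.
move=> th; rewrite [RHS]inE unfold_in /=.
by case: eqP => [->|_]; rewrite ?andbF // DS sS !andbT.
Qed.

End CycleSets.

Lemma pstable_imX (Z : finType) (G : {perm Z}) (S : {set Z}) j :
  pstable G S -> (G ^+ j)%g @: S = S.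
Proof.
move=> st; apply/eqP; rewrite eqEcard card_imset ?leqnn ?andbT; last exact: perm_inj.
by apply/subsetP=> _ /imsetP[x Sx ->]; apply: pstableX.
Qed.

Lemma porbit_fix_dvdn (T : finType) (u : {perm T}) a j :
  (u ^+ j)%g a = a -> (#|porbit u a| %| j)%N.
Proof.
set d := #|_|; have d0 : (0 < d)%N by apply/card_gt0P; exists a; apply: porbit_id.
rewrite permX {1}(divn_eq j d) addnC iterD.
have -> : iter (j %/ d * d) u a = a.
  by elim: (j %/ d)%N => [|i IH]; rewrite ?mul0n // mulSn iterD IH iter_porbit.
have := uniq_traject_porbit u a; rewrite -/d /dvdn => un h.
have lt : (j %% d < d)%N by rewrite ltn_pmod.
rewrite -(nth_uniq a _ _ un) ?size_traject // !nth_traject //.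
by rewrite h.
Qed.

Lemma pstable1 (Z : finType) (G : {perm Z}) (S : {set Z}) x :
  pstable G S -> (G x \in S) = (x \in S).
Proof.
move=> st; apply/idP/idP=> [h|/(forall_inP st)//].
have := pstable_imX 1 st; rewrite expg1 => imS.
by move: h; rewrite -{1}imS mem_imset //; apply: perm_inj.
Qed.

(** * Stable subsets of [k] x C over one cycle *)

Section ProductPermutation.
Variables (k : nat) (u : 'S_k) (C : finType) (g : {perm C}).
Local Notation Z := ('I_k * C)%type.
Implicit Types (S : {set Z}) (T : {set C}) (c : {set 'I_k}) (z : Z).

Lemma prod_perm_inj : injective (fun z : Z => (u z.1, g z.2)).
Proof. by move=> [b x] [b' x'] [/perm_inj /= -> /perm_inj ->]. Qed.

Definition prod_perm : {perm Z} := perm prod_perm_inj.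
Local Notation G := prod_perm.

Lemma prod_permX j z : (G ^+ j)%g z = ((u ^+ j)%g z.1, (g ^+ j)%g z.2).
Proof.
elim: j z => [|j IH] [b x]; first by rewrite !expg0 !perm1.
by rewrite !expgSr !permM IH permE.
Qed.

Definition cyl c : {set Z} := [set z | z.1 \in c].

Lemma pstable_cyl c : c \in porbits u -> pstable G (cyl c).
Proof.
case/imsetP=> a _ ->; apply/forall_inP=> z; rewrite !inE permE /= => /porbitP[j ->].
by rewrite -permM -expgSr mem_porbit.
Qed.

Lemma pstableI S S' : pstable G S -> pstable G S' -> pstable G (S :&: S').
Proof.
move=> st st'; apply/forall_inP=> z /setIP[Sz Sz']; rewrite inE.
by rewrite !pstable1 ?Sz.
Qed.

Lemma porbit_cyl z : porbit G z \subset cyl (porbit u z.1).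
Proof. by apply/subsetP=> _ /porbitP[j ->]; rewrite prod_permX inE /= mem_porbit. Qed.

Lemma fst_porbit z : fst @: porbit G z = porbit u z.1.
Proof.
apply/setP=> b; apply/imsetP/porbitP=> [[_ /porbitP[j ->] ->]|[j ->]].
  by exists j; rewrite prod_permX.
by exists ((G ^+ j)%g z); rewrite ?mem_porbit // prod_permX.
Qed.

Lemma bigcup_cyl S : \bigcup_(c in porbits u) (S :&: cyl c) = S.
Proof.
apply/setP=> z; apply/bigcupP/idP=> [[c _ /setIP[]]//|Sz].
by exists (porbit u z.1); rewrite ?imset_f // !inE Sz porbit_id.
Qed.

Lemma cycset_cyl S : cycset G 1 S = \prod_(c in porbits u) cycset G 1 (S :&: cyl c).
Proof.
rewrite {1}/cycset (partition_big (fun O : {set Z} => fst @: O) (fun c => c \in porbits u)) /=; last first.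
  by move=> O /andP[/imsetP[z _ ->] _]; rewrite fst_porbit imset_f.
apply: eq_bigr => c cu; apply: eq_bigl => O; rewrite subsetI -andbA.
case: (boolP (O \in porbits G)) => //= /imsetP[z _ ->].
rewrite fst_porbit; congr (_ && _); apply/eqP/idP=> [<-|/subsetP/(_ z (porbit_id _ _))].
  exact: porbit_cyl.
by rewrite inE; case/imsetP: cu => a _ -> /porbitP[j ->]; apply/eqP; rewrite eq_porbit_mem mem_porbit.
Qed.

Section Fiber.
Variable a : 'I_k.
Local Notation d := #|porbit u a|.
Local Notation B := (cyl (porbit u a)).
Local Notation gd := (g ^+ d)%g.

Definition fib S : {set C} := [set x | (a, x) \in S].
(** Inverse to [fib]: as [d] is the return time of [u] to [a], the subsets stable under [G] over the
    cycle of [a] correspond to the subsets of [C] stable under g^d. *)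
Definition spread T : {set Z} := \bigcup_(x in T) porbit G (a, x).

Lemma gt0_card_porbit : (0 < d)%N.
Proof. by apply/card_gt0P; exists a; apply: porbit_id. Qed.

Lemma porbit_dX i : (u ^+ (d * i))%g a = a.
Proof.
elim: i => [|i IH]; first by rewrite muln0 expg0 perm1.
have e : (u ^+ d)%g a = a by rewrite permX iter_porbit.
by rewrite mulnS expgD permM e.
Qed.

Lemma fiber_porbit x y : ((a, y) \in porbit G (a, x)) = (y \in porbit gd x).
Proof.
apply/porbitP/porbitP=> [[j]|[j ->]].
  rewrite prod_permX /= => -[/esym/porbit_fix_dvdn/dvdnP[i ->] ->].
  by exists i; rewrite -expgM mulnC.
by exists (d * j)%N; rewrite prod_permX /= porbit_dX expgM.
Qed.

Lemma fib_porbit x : fib (porbit G (a, x)) = porbit gd x.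
Proof. by apply/setP=> y; rewrite inE fiber_porbit. Qed.

Lemma pstable_fib S : pstable G S -> pstable gd (fib S).
Proof.
move=> st; apply/forall_inP=> x; rewrite !inE => Sx.
by have := pstableX d st Sx; rewrite prod_permX /= -[X in (u ^+ X)%g]muln1 porbit_dX.
Qed.

Lemma pstable_spread T : pstable G (spread T).
Proof.
apply/forall_inP=> z /bigcupP[x Tx /porbitP[j ->]]; apply/bigcupP; exists x => //.
by rewrite -permM -expgSr mem_porbit.
Qed.

Lemma spread_sub T : spread T \subset B.
Proof. by apply/bigcupsP=> x _; apply: (porbit_cyl (a, x)). Qed.

Lemma spreadK T : pstable gd T -> fib (spread T) = T.
Proof.
move=> st; apply/setP=> y; rewrite inE; apply/bigcupP/idP=> [[x Tx]|Ty].
  by rewrite fiber_porbit; apply: (subsetP (pstable_porbit st Tx)).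
by exists y => //; apply: porbit_id.
Qed.

Lemma sub_porbit_rep S z : pstable G S -> S \subset B -> z \in S ->
  exists2 x, (a, x) \in S & z \in porbit G (a, x).
Proof.
move=> st sB Sz; have := subsetP sB z Sz; rewrite inE => /porbitP[j def_b].
have : z \in (G ^+ j)%g @: S by rewrite pstable_imX.
case/imsetP=> -[b x] Sbx def_z; move: def_b; rewrite def_z prod_permX /= => /perm_inj eb.
by rewrite eb in Sbx *; exists x => //; rewrite -(prod_permX j (a, x)) mem_porbit.
Qed.

Lemma fibK S : pstable G S -> S \subset B -> spread (fib S) = S.
Proof.
move=> st sB; apply/setP=> z; apply/bigcupP/idP=> [[x]|Sz].
  by rewrite inE => Sx; apply: (subsetP (pstable_porbit st Sx)).
by have [x Sx zx] := sub_porbit_rep st sB Sz; exists x; rewrite // inE.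
Qed.

Lemma card_fib S : pstable G S -> S \subset B -> #|S| = (d * #|fib S|)%N.
Proof.
move=> st sB; rewrite -sum1_card (partition_big fst (fun b => b \in porbit u a)) /=; last first.
  by move=> z /(subsetP sB); rewrite inE.
rewrite (eq_bigr (fun=> #|fib S|)) ?sum_nat_const // => b /porbitP[j ->].
have injG : injective (fun x => (G ^+ j)%g (a, x)) by move=> x y /perm_inj[].
rewrite -(card_imset _ injG) -sum1_card; apply: eq_bigl => z.
apply/andP/imsetP=> [[Sz /eqP z1]|[x]].
  have : z \in (G ^+ j)%g @: S by rewrite pstable_imX.
  case/imsetP=> -[b' x] Sbx def_z; move: z1; rewrite def_z prod_permX /= => /perm_inj eb.
  by rewrite eb in Sbx *; exists x; rewrite ?inE // prod_permX.
rewrite inE => Sx ->; rewrite pstableX // prod_permX /=.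
by split.
Qed.

Lemma spread_porbit x : spread (porbit gd x) = porbit G (a, x).
Proof.
rewrite -fib_porbit fibK //; last exact: porbit_cyl.
by apply/forall_inP=> z /porbitP[j ->]; rewrite -permM -expgSr mem_porbit.
Qed.

(** An orbit of g^d of length l in the fiber spreads to an orbit of [G] of length d l. The weight
    [d] is thus the substitution p_j -> p_(jd) of plethysm. *)
Lemma cycset_fib S : pstable G S -> S \subset B -> cycset G 1 S = cycset gd d (fib S).
Proof.
move=> st sB; rewrite /cycset.
have orb_st x : pstable gd (porbit gd x).
  by apply/forall_inP=> z /porbitP[j ->]; rewrite -permM -expgSr mem_porbit.
have orbE O : O \in porbits G -> O \subset S -> exists x, O = porbit G (a, x).
  case/imsetP=> z _ -> sO; have Sz := subsetP sO z (porbit_id _ _).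
  have [x _ zx] := sub_porbit_rep st sB Sz; exists x.
  by apply/eqP; rewrite eq_porbit_mem.
rewrite (reindex_onto spread fib) => [|O /andP[OG sO]]; last first.
  by have [x ->] := orbE O OG sO; rewrite fib_porbit spread_porbit.
apply: eq_big => [O|O /andP[/andP[OG sO] /eqP fO]]; last first.
  by rewrite muln1 (card_fib (pstable_spread O) (spread_sub O)) fO mulnC.
apply/idP/idP=> [/andP[/andP[OG sO] /eqP fO]|/andP[/imsetP[x _ ->] sO]].
  have [x defO] := orbE _ OG sO; rewrite -fO defO fib_porbit imset_f //=.
  rewrite -fib_porbit -defO; apply/subsetP=> y; rewrite !inE.
  exact: (subsetP sO).
rewrite spread_porbit fib_porbit eqxx imset_f //= andbT.
apply: (pstable_porbit st).
by have := subsetP sO x (porbit_id _ _); rewrite inE.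
Qed.

Lemma sum_cycset_fib n :
  \sum_(T | [&& pstable gd T, T != set0 & (#|T| <= n)%N]) cycset gd d T
  = \sum_(S | [&& pstable G S, S \subset B, S != set0 & (#|S| <= d * n)%N]) cycset G 1 S.
Proof.
rewrite [RHS](reindex_onto spread fib) => [|S /and4P[st sB _ _]]; last exact: fibK.
apply: eq_big => [T|T /and3P[st _ _]]; last first.
  by rewrite cycset_fib ?pstable_spread ?spread_sub // spreadK.
rewrite pstable_spread spread_sub /=.
have nz : (spread T != set0) = (T != set0).
  congr (~~ _); apply/eqP/eqP=> [s0|->]; last by rewrite /spread big_set0.
  apply/setP=> x; rewrite inE; apply/negP=> Tx.
  have : (a, x) \in spread T by apply/bigcupP; exists x => //; apply: porbit_id.
  by rewrite s0 inE.
rewrite nz; apply/idP/idP=> [/and3P[st -> le]|/andP[/andP[-> le] /eqP fT]] /=.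
  by rewrite card_fib ?pstable_spread ?spread_sub // spreadK // leq_pmul2l ?gt0_card_porbit // le eqxx.
move: le; rewrite card_fib ?pstable_spread ?spread_sub // fT leq_pmul2l ?gt0_card_porbit // => ->.
by rewrite -fT pstable_fib // pstable_spread.
Qed.

End Fiber.
End ProductPermutation.

(** * From single cycles to the whole product *)

Section ProductOverCycles.
Variables (k : nat) (u : 'S_k) (C : finType) (g : {perm C}) (n : nat).
Local Notation Z := ('I_k * C)%type.
Local Notation G := (prod_perm u g).
Local Notation cyl := (cyl C).
Implicit Types (S : {set Z}) (c : {set 'I_k}).

Let Q c S := [&& pstable G S, S \subset cyl c, S != set0 & (#|S| <= #|c| * n)%N].

(** Expanding the product chooses a stable set over each cycle; the cylinders are disjoint, so the
    choices are recovered from their union. *)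
Lemma prod_cyl_sum :
  \prod_(c in porbits u) \sum_(S | Q c S) cycset G 1 S
  = \sum_(S | [forall c in porbits u, Q c (S :&: cyl c)]) cycset G 1 S.
Proof.
rewrite (big_distr_big_dep (set0 : {set Z})).
pose cut S : {ffun {set 'I_k} -> {set Z}} :=
  [ffun c => if c \in porbits u then S :&: cyl c else set0].
pose glue (f : {ffun {set 'I_k} -> {set Z}}) := \bigcup_(c in porbits u) f c.
rewrite (reindex_onto cut glue) => [|f /pfamilyP[/supportP sf Qf]]; last first.
  apply/ffunP=> c; rewrite ffunE; case: ifPn => [cu|nc]; last by rewrite sf.
  apply/setP=> z; rewrite !inE; apply/andP/idP=> [[/bigcupP[c' cu' fz] zc]|fz].
    suff -> : c = c' by [].
    have /and4P[_ sub _ _] := Qf c' cu'.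
    have := subsetP sub z fz; rewrite inE.
    case/imsetP: cu => b _ def_c; case/imsetP: cu' => b' _ ->.
    move: zc; rewrite def_c -!eq_porbit_mem => /eqP <- /eqP <-.
    by [].
  split; first by apply/bigcupP; exists c.
  by have /and4P[_ sub _ _] := Qf c cu; have := subsetP sub z fz; rewrite inE.
have cutE S c : c \in porbits u -> cut S c = S :&: cyl c by move=> cu; rewrite ffunE cu.
have glueK S : glue (cut S) = S.
  rewrite -[RHS](bigcup_cyl u); apply: eq_bigr => c cu; exact: cutE.
apply: eq_big => [S|S _]; last first.
  by rewrite (cycset_cyl u g); apply: eq_bigr => c cu; rewrite cutE.
rewrite glueK eqxx andbT; apply/pfamilyP/forall_inP=> [[_ h] c cu|h].
  by have := h c cu; rewrite unfold_in /= cutE.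
split; last by move=> c cu; have := h c cu; rewrite -(cutE S c cu).
by apply/supportP=> c nc; rewrite ffunE (negPf nc).
Qed.

(** The projection of a stable set to [k] is a union of cycles of [u], hence everything as soon as
    each cycle is met. For [#|S| = n] the size bounds in [Q] hold automatically. *)
Lemma cyl_onto S : (0 < n)%N -> #|S| = n ->
  [forall c in porbits u, Q c (S :&: cyl c)] = pstable G S && (fst @: S == setT).
Proof.
move=> n0 cS; apply/forall_inP/andP=> [h|[st /eqP onto] c cu].
  split.
    apply/forall_inP=> z Sz; have cu : porbit u z.1 \in porbits u by rewrite imset_f.
    have /and4P[/forall_inP/(_ z) st _ _ _] := h _ cu.
    by have := st; rewrite !inE Sz porbit_id => /(_ isT) /andP[].
  apply/eqP/setP=> b; rewrite inE; have cu : porbit u b \in porbits u by rewrite imset_f.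
  have /and4P[st _ /set0Pn[z]] := h _ cu; rewrite !inE porbit_sym => /andP[Sz /porbitP[j def_b]] _.
  have /(pstableX j st) : z \in S :&: cyl (porbit u b).
    by rewrite !inE Sz def_b porbit_sym mem_porbit.
  rewrite prod_permX -def_b => /setIP[Sz' _].
  by apply/imsetP; exists (b, (g ^+ j)%g z.2).
apply/and4P; split.
- exact: pstableI st (pstable_cyl g cu).
- exact: subsetIr.
- case/imsetP: cu => b _ ->; have : b \in fst @: S by rewrite onto inE.
  by case/imsetP=> z Sz ->; apply/set0Pn; exists z; rewrite !inE Sz porbit_id.
- have le : (#|S :&: cyl c| <= n)%N by rewrite -[X in (_ <= X)%N]cS subset_leq_card ?subsetIl.
  apply: leq_trans le _; rewrite leq_pmull //; exact: porbits_gt0 cu.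
Qed.

(** Sets whose total size differs from [n] are homogeneous of another degree and do not contribute.
    The bound [#|T| <= n] corresponds to the truncation of the series in [cplethysm]. *)
Lemma coef_prod_cycles m : (0 < n)%N -> monom_degree m = n ->
  (\prod_(c in porbits u) \sum_(T | [&& pstable (g ^+ #|c|)%g T, T != set0 & (#|T| <= n)%N])
      cycset (g ^+ #|c|)%g #|c| T)@_m
  = (\sum_(S | [&& pstable G S, #|S| == n & fst @: S == setT]) cycset G 1 S)@_m.
Proof.
move=> n0 dm.
rewrite (eq_bigr (fun c => \sum_(S | Q c S) cycset G 1 S)); last first.
  by move=> c /imsetP[a _ ->]; apply: sum_cycset_fib.
rewrite prod_cyl_sum !raddf_sum /=.
rewrite (bigID (fun S : {set Z} => #|S| == n)) /= [X in _ + X]big1 ?addr0; last first.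
  move=> S /andP[/forall_inP h nS]; have st : pstable G S.
    apply/forall_inP=> z Sz; have cu : porbit u z.1 \in porbits u by rewrite imset_f.
    have /and4P[/forall_inP/(_ z) st _ _ _] := h _ cu.
    by have := st; rewrite !inE Sz porbit_id => /(_ isT) /andP[].
  by apply: (homog_cycset (e := 1) _ st) => //; rewrite muln1 dm eq_sym.
apply: eq_bigl => S; case: (#|S| =P n) => [cS|_]; last by rewrite !andbF.
by rewrite cyl_onto // andbT.
Qed.

End ProductOverCycles.

Lemma sum_card_porbits_setT k (u : 'S_k) : (\sum_(c in porbits u) #|c|)%N = k.
Proof.
have st : pstable u [set: 'I_k] by apply/forall_inP=> i _; rewrite inE.
by rewrite -[RHS]card_ord -cardsT -(sum_card_porbits st); apply: eq_bigl => c; rewrite subsetT andbT.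
Qed.

(** * The plethystic identity *)

Section CyclicShift.
Variables (N' q : nat).
Local Notation N := N'.+1.
Local Notation C := {ffun 'I_N -> 'I_q}.

Definition shift_fun (c : C) : C := [ffun s : 'I_N => c (inord (s.+1 %% N))].

Lemma shift_funX t c (j : 'I_N) : iter t shift_fun c j = c (inord ((j + t) %% N)).
Proof.
elim: t c j => [|t IH] c j; first by rewrite addn0 modn_small // inord_val.
rewrite /= ffunE IH inordK ?ltn_pmod //; congr (c (inord _)).
by rewrite modnDml addSnnS.
Qed.

Lemma shift_fun_period c : iter N shift_fun c = c.
Proof.
by apply/ffunP=> j; rewrite shift_funX modnDr modn_small // inord_val.
Qed.

Lemma shift_fun_inj : injective shift_fun.
Proof. by apply: (can_inj (g := iter N' shift_fun)) => c; rewrite -iterSr shift_fun_period. Qed.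

Definition shift : {perm C} := perm shift_fun_inj.

Lemma shiftX t c (j : 'I_N) : (shift ^+ t)%g c j = c (inord ((j + t) %% N)).
Proof.
rewrite permX -shift_funX; congr ((_ : C) j).
by apply: eq_iter => x; rewrite permE.
Qed.

Lemma iter_shiftX d s c : iter s (shift ^+ d)%g c = (shift ^+ (d * s))%g c.
Proof. by rewrite -permX -expgM. Qed.

Definition shift_window d (c : C) : {ffun 'I_d -> 'I_q} := [ffun j : 'I_d => c (inord j)].

(** The windows seen at the times 0, d, 2d, ... cut a word into N/d blocks of d letters, and g^d
    shifts the sequence of blocks by one. The alphabet of blocks has q^d elements. *)
Lemma shift_coding d : (0 < d)%N -> (d %| N)%N ->
  coding (shift ^+ d)%g (@shift_window d) (N %/ d)%N.
Proof.
move=> d0 dN; have leN s j : (s < N %/ d)%N -> (j < d)%N -> (j + d * s < N)%N.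
  move=> lts ltj; apply: (@leq_trans (d * s.+1)); first by rewrite mulnS ltn_add2r.
  by rewrite mulnC -leq_divRL.
have dleN : (d <= N)%N by apply: dvdn_leq.
have winE s c (j : 'I_d) : (s < N %/ d)%N ->
    shift_window d (iter s (shift ^+ d)%g c) j = c (inord (j + d * s)).
  move=> lts; rewrite ffunE iter_shiftX shiftX inordK ?(leq_trans (ltn_ord j)) //.
  by rewrite modn_small // leN.
split.
- by rewrite divn_gt0.
- by move=> c; apply/ffunP=> j; rewrite iter_shiftX shiftX mulnC divnK // modnDr modn_small // inord_val.
- move=> c c' eqw; apply/ffunP=> t.
  have ltt : (t %/ d < N %/ d)%N by rewrite ltn_divRL // (leq_ltn_trans (leq_trunc_div t d)).
  have /ffunP/(_ (Ordinal (ltn_pmod t d0))) := eqw _ ltt.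
  by rewrite !winE //= addnC mulnC -divn_eq inord_val.
move=> sigma; exists [ffun t : 'I_N => sigma (t %/ d)%N (Ordinal (ltn_pmod t d0))].
move=> s lts; apply/ffunP=> j; rewrite winE // ffunE inordK ?leN //.
have -> : ((j + d * s) %/ d)%N = s by rewrite addnC mulnC divnMDl // divn_small // addn0.
congr (sigma s _); apply: val_inj => /=.
by rewrite addnC mulnC modnMDl modn_small.
Qed.

End CyclicShift.

Lemma iter_perm_fact n (w : 'S_n) M i : (n`! %| M)%N -> iter M w i = i.
Proof.
move=> dM; rewrite -permX; have ow : (#[w]%g %| M)%N.
  apply: dvdn_trans dM; rewrite -card_Sn -cardsT; apply: order_dvdG; exact: in_setT.
by move: ow; rewrite order_dvdn => /eqP ->; rewrite perm1.
Qed.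

(** * Character sums as sums over stable subsets *)

Definition pair_ffun n (A B : finType) (p : {ffun 'I_n -> A} * {ffun 'I_n -> B}) :
  {ffun 'I_n -> A * B} := [ffun i => (p.1 i, p.2 i)].

(** The pair is injective exactly when the two kernels have no edge in common, which turns the count
    for the restriction to [eker f] into one of injections to [k] x C. *)
Lemma pair_cond n k (C : finType) (w : 'S_n) (u : 'S_k) (g : {perm C})
    (f : {ffun 'I_n -> 'I_k}) (phi : {ffun 'I_n -> C}) (th := pair_ffun (f, phi)) :
  [&& intertwines (prod_perm u g) w th, injectiveb th & fst @: (th @: 'I_n) == setT]
  = ((f \in surjections n k) && [forall i, f (w i) == u (f i)])
    && (phi \in [set phi in eqmaps w g | eker f :&: eker phi == set0]).
Proof.
have thE i : th i = (f i, phi i) by rewrite ffunE.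
have -> : intertwines (prod_perm u g) w th = [forall i, f (w i) == u (f i)] && (phi \in eqmaps w g).
  rewrite inE; apply/forallP/andP=> [h|[/forallP h1 /forallP h2] i].
    by split; apply/forallP=> i; have := h i; rewrite !thE permE xpair_eqE => /andP[].
  by rewrite !thE permE xpair_eqE h1 h2.
have -> : injectiveb th = (eker f :&: eker phi == set0).
  apply/injectiveP/eqP=> [inj|e0 i j].
    apply/eqP; rewrite -subset0; apply/subsetP=> e /setIP[ef ephi].
    have /edgesP[i [j [ij def_e]]] := subsetP (eker_sub f) e ef.
    move: ef ephi; rewrite def_e !mem_eker // => /eqP eqf /eqP eqphi.
    by case/eqP: ij; apply: inj; rewrite !thE eqf eqphi.
  rewrite !thE => -[eqf eqphi]; have [//|ij] := eqVneq i j.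
  by have := in_set0 [set i; j]; rewrite -e0 in_setI !mem_eker // eqf eqphi !eqxx.
have -> : fst @: (th @: 'I_n) = f @: 'I_n.
  by rewrite -imset_comp; apply: eq_imset => i /=; rewrite thE.
rewrite !inE -/(eqmaps _ _).
by case: (f @: 'I_n == setT); rewrite ?andbF //= ?andbT -?andbA.
Qed.

Section CodedCounts.
Variables (C D : finType) (g : {perm C}) (r : C -> D) (N : nat).
Hypothesis cod : coding g r N.

Lemma intertwines_eqmaps n (v : 'S_n) (phi : {ffun 'I_n -> C}) :
  intertwines g v phi = (phi \in eqmaps v g).
Proof. by rewrite inE. Qed.

Lemma sum_braid_K n e : (0 < n)%N -> (forall (v : 'S_n) i, iter N v i = i) ->
  \sum_(v : 'S_n) (#|D|%:R * (gr_value v (braid_K n)).[#|D|%:R]) *: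
     \prod_(c in porbits v) cpsum (#|c| * e)
  = (\sum_(T | pstable g T && (#|T| == n)) cycset g e T) *+ n`!.
Proof.
move=> n0 vN; have := @sum_intertwines _ g n e xpredT.
rewrite [in RHS](eq_bigl (fun T => pstable g T && (#|T| == n))); last first.
  by move=> T; rewrite andbT.
move=> <-; apply: eq_bigr => v _.
rewrite (charpoly_braid_count cod (vN v) n0) scaler_nat -sumr_const.
by apply: eq_bigl => th; rewrite inE -intertwines_eqmaps andbT.
Qed.

Lemma sum_braid_local n k (u : 'S_k) : (forall (w : 'S_n) i, iter N w i = i) ->
  \sum_(w : 'S_n) \sum_(f in surjections n k | [forall i, f (w i) == u (f i)])
     (#|D|%:R ^+ k * (gr_value w (equiv_charpoly (em_local (braid n) (eker f)))).[#|D|%:R])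
       *: \prod_(c in porbits w) cpsum #|c|
  = (\sum_(S | [&& pstable (prod_perm u g) S, #|S| == n & fst @: S == setT])
       cycset (prod_perm u g) 1 S) *+ n`!.
Proof.
move=> wN; rewrite -(sum_intertwines (prod_perm u g) n 1 (fun S => fst @: S == setT)).
apply: eq_bigr => w _.
rewrite [RHS](eq_bigr (fun=> \prod_(c in porbits w) cpsum #|c|)); last first.
  move=> th _ /=; apply: eq_bigr => c _; by rewrite muln1.
pose pr := @pair_ffun n 'I_k C.
pose unpr (th : {ffun 'I_n -> 'I_k * C}) : {ffun 'I_n -> 'I_k} * {ffun 'I_n -> C} :=
  ([ffun i => (th i).1], [ffun i => (th i).2]).
have prK : cancel pr unpr.
  by move=> [f phi]; congr (_, _); apply/ffunP=> i; rewrite !ffunE.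
have unprK : cancel unpr pr.
  by move=> th; apply/ffunP=> i; rewrite !ffunE -surjective_pairing.
rewrite [RHS](reindex pr) /=; last by exists unpr => ? _; [apply: prK | apply: unprK].
rewrite [RHS](eq_bigl (fun p => ((p.1 \in surjections n k) && [forall i, p.1 (w i) == u (p.1 i)])
   && (p.2 \in [set phi in eqmaps w g | eker p.1 :&: eker phi == set0]))); last first.
  move=> [f phi] /=; exact: pair_cond.
rewrite -(pair_big_dep (fun f : {ffun 'I_n -> 'I_k} => (f \in surjections n k) && [forall i, f (w i) == u (f i)])
   (fun f phi => phi \in [set phi in eqmaps w g | eker f :&: eker phi == set0])
   (fun _ _ => \prod_(c in porbits w) cpsum #|c|)) /=.
apply: eq_bigr => f /andP[/surjectionsP sf /forallP fwu].
have {}fwu i : f (w i) = u (f i) by apply/eqP.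
have fixF : setact (edge_act n) (eker f) w = eker f := fix_eker_surj fwu.
have := charpoly_local_count cod (wN w) (flat_eker f) fixF.
have -> : (n - mrank (emat (braid n)) (eker f))%N = k.
  by rewrite mrank_eker subKn ?card_im_le // sf cardsT card_ord.
by rewrite natrX => ->; rewrite scaler_nat -sumr_const.
Qed.

End CodedCounts.

Definition inv_fact (k : nat) : {poly algC} := ((k`!%:R : algC)^-1)%:P.

Lemma frob_chE n (f : {poly 'CF([set: 'S_n])}) : frob_ch f =
  inv_fact n *:
    \sum_(w : 'S_n) gr_value w f *: \prod_(c in porbits w) psum #|c|.
Proof. by []. Qed.

Lemma psum_plethysm_frob d i (f : {poly 'CF([set: 'S_i])}) :
  psum_plethysm d (frob_ch f) = inv_fact i *:
    \sum_(v : 'S_i) (gr_value v f \Po 'X^d) *: \prod_(c in porbits v) psum (#|c| * d).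
Proof.
rewrite frob_chE psum_plethysmZ comp_polyC psum_plethysm_sum; congr (_ *: _).
apply: eq_bigr => v _; rewrite psum_plethysmZ psum_plethysm_prod; congr (_ *: _).
by apply: eq_bigr => c /porbits_gt0; apply: psum_plethysm_psum.
Qed.

Lemma ev_psum_plethysm_frob q d i (f : {poly 'CF([set: 'S_i])}) :
  ev q (psum_plethysm d (frob_ch f)) = (i`!%:R^-1) *:
    \sum_(v : 'S_i) (gr_value v f).[q ^+ d] *: \prod_(c in porbits v) cpsum (#|c| * d).
Proof.
rewrite psum_plethysm_frob evZ /inv_fact hornerC rmorph_sum /=; congr (_ *: _).
apply: eq_bigr => v _; rewrite evZ horner_comp hornerXn rmorph_prod /=; congr (_ *: _).
by apply: eq_bigr => c _; rewrite ev_psum.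
Qed.

(** * The plethystic side at t = q *)

Section Coefficients.
Variables (n q : nat).
Hypothesis (q0 : (0 < q)%N).

(** The words have length N = n!^2: a number d up to n divides one factor n!, and the other one
    keeps N/d a multiple of i! for all i up to n, hence a period of every permutation of i letters.
    [shift] takes N - 1 as its argument. *)
Local Notation N' := (n`! * n`!).-1.
Local Notation g := (shift N' q).
Local Notation KK := (\sum_(i < n.+1) ch_series braid_K i).

Let NE : N'.+1 = (n`! * n`!)%N.
Proof. by rewrite prednK // muln_gt0 !fact_gt0. Qed.

Let fact_dvd d i : (0 < d <= n)%N -> (i <= n)%N -> (i`! %| N'.+1 %/ d)%N.
Proof.
move=> dn lei; have dd : (d %| n`!)%N by apply: dvdn_fact.
rewrite NE -divn_mulAC // dvdn_mull //; elim: n lei => [|m IH]; first by rewrite leqn0 => /eqP->.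
by rewrite leq_eqVlt => /orP[/eqP->//|/IH h]; rewrite factS dvdn_mull.
Qed.

(** At t = q the plethysm p_d[K] evaluates K at q^d, the number of blocks by which g^d is coded. The
    factor q^d is the factor [#|D|] of [charpoly_braid_count]. *)
Lemma ev_psum_plethysm_K d : (0 < d <= n)%N ->
  q%:R ^+ d *: ev q%:R (psum_plethysm d KK)
  = \sum_(T | [&& pstable (g ^+ d)%g T, T != set0 & (#|T| <= n)%N]) cycset (g ^+ d)%g d T.
Proof.
move=> dn; have d0 : (0 < d)%N by case/andP: dn.
have dN : (d %| N'.+1)%N by rewrite NE dvdn_mulr // dvdn_fact.
have cod := shift_coding q d0 dN.
have card_D : (#|{ffun 'I_d -> 'I_q}| = q ^ d)%N by rewrite card_ffun !card_ord.
rewrite psum_plethysm_sum rmorph_sum /= scaler_sumr.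
rewrite [RHS](partition_big (fun T : {set {ffun 'I_N'.+1 -> 'I_q}} => inord #|T| : 'I_n.+1) predT) //=.
apply: eq_bigr => i _.
have [i0|i0] := eqVneq (i : nat) 0%N.
  have -> : ch_series braid_K i = 0 by rewrite /ch_series i0.
  have -> : psum_plethysm d 0 = 0.
    by have := @psum_plethysm_sum d nat [::] xpredT (fun=> 0); rewrite !big_nil.
  rewrite rmorph0 scaler0 big_pred0 // => T; apply/negbTE/negP=> /andP[/and3P[_ nz le]] /eqP.
  move/(congr1 val); rewrite /= inordK ?ltnS // i0 => /eqP.
  by rewrite cards_eq0 (negPf nz).
have -> : ch_series braid_K i = frob_ch (braid_K i) by rewrite /ch_series (negPf i0).
rewrite -lt0n in i0.
have vN (v : 'S_i) j : iter (N'.+1 %/ d) v j = j.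
  by apply: iter_perm_fact; apply: fact_dvd => //; rewrite -ltnS.
have := sum_braid_K cod d i0 vN; rewrite card_D => sumK.
rewrite ev_psum_plethysm_frob.
transitivity ((i`!%:R^-1 : algC) *: \sum_(v : 'S_i)
   ((q ^ d)%:R * (gr_value v (braid_K i)).[(q ^ d)%:R])
     *: \prod_(c in porbits v) cpsum (#|c| * d)).
  rewrite scalerA mulrC -scalerA; congr (_ *: _); rewrite scaler_sumr.
  by apply: eq_bigr => v _; rewrite scalerA natrX.
rewrite sumK -scaler_nat scalerA mulVf ?scale1r; last by rewrite pnatr_eq0 -lt0n fact_gt0.
apply: eq_bigl => T; rewrite -andbA; congr (_ && _); apply/eqP/andP=> [cT|[/andP[nz le] /eqP <-]].
  rewrite cT -card_gt0 cT i0 -ltnS ltn_ord; split=> //.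
  by apply/eqP/val_inj; rewrite /= inordK.
by rewrite inordK.
Qed.

Lemma ev_prod_plethysm_K k (u : 'S_k) m : (0 < n)%N -> (k <= n)%N -> monom_degree m = n ->
  q%:R ^+ k * (ev q%:R (\prod_(c in porbits u) psum_plethysm #|c| KK))@_m
  = (\sum_(S | [&& pstable (prod_perm u g) S, #|S| == n & fst @: S == setT])
      cycset (prod_perm u g) 1 S)@_m.
Proof.
move=> n0 lek dm; rewrite -coef_prod_cycles // rmorph_prod -mcoeffZ; congr (_@_m).
(* The cycle lengths of [u] add up to [k], so q^k is distributed over the cycles. *)
rewrite -{1}(sum_card_porbits_setT u) -prodrXr.
rewrite -[LHS]mul_malgC rmorph_prod /= -big_split /=; apply: eq_bigr => c cu.
rewrite mul_malgC ev_psum_plethysm_K // (porbits_gt0 cu) /=.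
by apply: leq_trans lek; rewrite -[X in (_ <= X)%N]card_ord max_card.
Qed.

End Coefficients.

Section BraidPlethysm.
Variable n : nat.
Hypothesis n0 : (0 < n)%N.
Local Notation KK := (\sum_(i < n.+1) ch_series braid_K i).

Lemma ev_sum_surj q k (u : 'S_k) : (0 < q)%N ->
  q%:R ^+ k *: ev q%:R (inv_fact n *:
    \sum_(w : 'S_n) \sum_(f in surjections n k | [forall i, f (w i) == u (f i)])
      gr_value w (equiv_charpoly (em_local (braid n) (eker f)))
        *: \prod_(c in porbits w) psum #|c|)
  = \sum_(S | [&& pstable (prod_perm u (shift (n`! * n`!).-1 q)) S, #|S| == n & fst @: S == setT])
      cycset (prod_perm u (shift (n`! * n`!).-1 q)) 1 S.
Proof.
(* On this side [w] is intertwined with [g] itself, so the coding by single letters, d = 1, is the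
   right one. *)
move=> q0; have cod := shift_coding q (ltn0Sn 0) (dvd1n (n`! * n`!).-1.+1).
have card_D : #|{ffun 'I_1 -> 'I_q}| = q by rewrite card_ffun !card_ord expn1.
rewrite expg1 divn1 in cod.
have wN (w : 'S_n) i : iter (n`! * n`!).-1.+1 w i = i.
  by apply: iter_perm_fact; rewrite prednK ?muln_gt0 ?fact_gt0 // dvdn_mulr.
have := sum_braid_local cod u wN; rewrite card_D => sumS.
rewrite evZ /inv_fact hornerC scalerA mulrC -scalerA rmorph_sum /=.
transitivity ((n`!%:R^-1 : algC) *: (\sum_(w : 'S_n)
   \sum_(f in surjections n k | [forall i, f (w i) == u (f i)])
     (q%:R ^+ k * (gr_value w (equiv_charpoly (em_local (braid n) (eker f)))).[q%:R])
       *: \prod_(c in porbits w) cpsum #|c|)).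
  congr (_ *: _); rewrite scaler_sumr; apply: eq_bigr => w _.
  rewrite rmorph_sum scaler_sumr; apply: eq_bigr => f _.
  rewrite evZ scalerA rmorph_prod; congr (_ *: _); apply: eq_bigr => c _.
  exact: ev_psum.
by rewrite sumS -scaler_nat scalerA mulVf ?scale1r // pnatr_eq0 -lt0n fact_gt0.
Qed.

(** At t = q and after multiplication by q^k, both sides become in degree [n] the sum of [cycset]
    over the stable subsets of [k] x C of size [n] that meet every fiber over [k]. *)
Lemma sum_surj_plethysm k (u : 'S_k) : (k <= n)%N ->
  inv_fact n *:
    \sum_(w : 'S_n) \sum_(f in surjections n k | [forall i, f (w i) == u (f i)])
      gr_value w (equiv_charpoly (em_local (braid n) (eker f)))
        *: \prod_(c in porbits w) psum #|c|
  = symf_part n (\prod_(c in porbits u) psum_plethysm #|c| KK).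
Proof.
move=> lek; apply/malgP=> m; apply: poly_eq_nat => q q0.
have qk : q%:R ^+ k != 0 :> algC by rewrite expf_neq0 // pnatr_eq0 -lt0n.
have gen (a b : algC) : q%:R ^+ k * a = q%:R ^+ k * b -> a = b by move/(mulfI qk).
apply: gen.
rewrite -[X in _ * X = _]coef_ev -[LHS]mcoeffZ ev_sum_surj // coef_symf_part.
case: eqP => [dm|/eqP ndm]; first by rewrite -coef_ev ev_prod_plethysm_K.
rewrite horner0 mulr0 raddf_sum big1 //= => S /and3P[st /eqP cS _].
by apply: (homog_cycset (e := 1) _ st) => //; rewrite muln1 cS.
Qed.

End BraidPlethysm.

Lemma symf_part_sum n (J : Type) (r : seq J) (Q : pred J) (F : J -> symf) :
  symf_part n (\sum_(j <- r | Q j) F j) = \sum_(j <- r | Q j) symf_part n (F j).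
Proof.
apply/malgP=> m; rewrite coef_symf_part !raddf_sum /=.
rewrite [RHS](eq_bigr (fun j => if monom_degree m == n then (F j)@_m else 0)) => [|j _]; last first.
  exact: coef_symf_part.
by case: ifP => // _; rewrite big1.
Qed.

Lemma symf_partZ n (c : {poly algC}) (f : symf) : symf_part n (c *: f) = c *: symf_part n f.
Proof.
have eqif (b : bool) (x : {poly algC}) : (if b then c * x else 0) = c * (if b then x else 0).
  by case: b; rewrite ?mulr0.
apply/malgP=> m; transitivity (c * (symf_part n f)@_m); last exact/esym/mcoeffZ.
transitivity (if monom_degree m == n then (c *: f)@_m else 0); first exact: coef_symf_part.
transitivity (if monom_degree m == n then c * f@_m else 0); first by rewrite mcoeffZ.
transitivity (c * (if monom_degree m == n then f@_m else 0)); first exact: eqif.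
congr (_ * _); exact/esym/coef_symf_part.
Qed.

Lemma plethysm_frob k (f : {poly 'CF([set: 'S_k])}) g :
  plethysm (frob_ch f) g = inv_fact k *:
    \sum_(u : 'S_k) gr_value u f *: \prod_(c in porbits u) psum_plethysm #|c| g.
Proof.
rewrite frob_chE plethysmZ plethysm_sum; congr (_ *: _).
apply: eq_bigr => u _.
rewrite plethysmZ.
congr (_ *: _).
rewrite plethysm_prod.
apply: eq_bigr => c /porbits_gt0.
exact: plethysm_psum.
Qed.

Lemma plethysm0 g : plethysm 0 g = 0.
Proof. by have := @plethysm_sum g nat [::] xpredT (fun=> 0); rewrite !big_nil. Qed.

Lemma symf_part0 n : symf_part n 0 = 0.
Proof. by have := @symf_part_sum n nat [::] xpredT (fun=> 0); rewrite !big_nil. Qed.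

Lemma ch_series0 F : ch_series F 0 = 0.
Proof. by []. Qed.

Lemma ch_series_gt0 F n : (0 < n)%N -> ch_series F n = frob_ch (F n).
Proof. by case: n. Qed.

Lemma cplethysmE f g n : cplethysm f g n =
  symf_part n (plethysm (\sum_(i < n.+1) f i) (\sum_(i < n.+1) g i)).
Proof. by []. Qed.

Lemma symf_scale4 (a b c d : {poly algC}) (x : symf) :
  b *: (c *: (a *: (d *: x))) = a *: ((b * (c * d)) *: x).
Proof.
rewrite !scalerA.
rewrite -!mulrA [c * (a * d)]mulrCA [b * (a * _)]mulrCA.
reflexivity.
Qed.

(** * Summation over the number of parts *)

Section ChSeriesPlethysm.
Local Opaque symf_part plethysm psum_plethysm frob_ch ch_series cplethysm
  braid_K braid_Q braid_Qbar.

Let surj_term n k (u : 'S_k) : symf := \sum_(w : 'S_n)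
  \sum_(f in surjections n k | [forall i, f (w i) == u (f i)])
     gr_value w (equiv_charpoly (em_local (braid n) (eker f)))
       *: \prod_(c in porbits w) psum #|c|.

Lemma symf_part_plethysm_frob n k (f : {poly 'CF([set: 'S_k])}) :
  (0 < n)%N -> (k <= n)%N ->
  symf_part n (plethysm (frob_ch f) (\sum_(i < n.+1) ch_series braid_K i))
  = inv_fact k *: \sum_(u : 'S_k) gr_value u f *:
      (inv_fact n *: surj_term n u).
Proof.
move=> n0 lek.
rewrite plethysm_frob.
rewrite symf_partZ.
rewrite symf_part_sum.
apply: (congr1 (fun x : symf => inv_fact k *: x)).
apply: eq_bigr => u _.
rewrite symf_partZ -(sum_surj_plethysm n0 u lek).
reflexivity.
Qed.

Lemma surj_term0 n (u : 'S_0) : (0 < n)%N -> surj_term n u = 0.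
Proof.
move=> n0; apply: big1 => w _; apply: big1 => f _.
by have := ltn_ord (f (Ordinal n0)).
Qed.

Lemma frob_ch_Qbar (P : KL_assignment) (hP : is_equivariant_KL P) n :
  frob_ch (braid_Qbar P n) = \sum_(k < n.+1) inv_fact k *:
    \sum_(u : 'S_k) gr_value u (braid_Q P k) *: (inv_fact n *: surj_term n u).
Proof.
rewrite frob_chE.
transitivity (\sum_(k < n.+1) \sum_(w : 'S_n) \sum_(u : 'S_k)
   \sum_(f in surjections n k | [forall i, f (w i) == u (f i)])
   inv_fact n *: ((inv_fact k * (gr_value u (braid_Q P k)
       * gr_value w (equiv_charpoly (em_local (braid n) (eker f)))))
      *: \prod_(c in porbits w) psum #|c|)).
  rewrite exchange_big scaler_sumr; apply: eq_bigr => w _ /=.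
  rewrite (braid_Qbar_value hP) scaler_suml scaler_sumr; apply: eq_bigr => k _.
  rewrite -mul_polyC -/(inv_fact k) -scalerA; rewrite (exchange_big_dep (mem (surjections n k))) /=; last first.
    by move=> u f _ /andP[].
  rewrite scaler_suml !scaler_sumr; apply: eq_bigr => f sf.
  rewrite scaler_suml !scaler_sumr.
  apply: eq_big => [u|u _].
    by rewrite sf.
  apply: (congr1 (fun x : symf => inv_fact n *: x)).
  rewrite (mulrC (gr_value u _)); exact: scalerA.
apply: eq_bigr => k _; rewrite exchange_big scaler_sumr; apply: eq_bigr => u _ /=.
rewrite /surj_term [inv_fact n *: _]scaler_sumr.
rewrite [gr_value u _ *: _]scaler_sumr [RHS]scaler_sumr.
apply: eq_bigr => w _.
rewrite [inv_fact n *: _]scaler_sumr [gr_value u _ *: _]scaler_sumr [RHS]scaler_sumr.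
apply: eq_bigr => f _.
exact/esym/symf_scale4.
Qed.

Lemma ch_series_plethysm (P : KL_assignment) (hP : is_equivariant_KL P) n :
  ch_series (braid_Qbar P) n = cplethysm (ch_series (braid_Q P)) (ch_series braid_K) n.
Proof.
rewrite cplethysmE; have [->|n0] := posnP n.
  have s0 : \sum_(i < 1) ch_series (braid_Q P) i = 0 :> symf.
    rewrite big_ord1.
    exact: ch_series0.
  transitivity (0 : symf); first exact: ch_series0.
  transitivity (symf_part 0 (plethysm 0 (\sum_(i < 1) ch_series braid_K i))).
    by rewrite plethysm0 symf_part0.
  exact: (congr1 (fun f => symf_part 0 (plethysm f _)) (esym s0)).
rewrite (ch_series_gt0 _ n0) (frob_ch_Qbar hP) plethysm_sum symf_part_sum.
apply: eq_bigr => k _; have lek : (k <= n)%N by rewrite -ltnS.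
(* For [k = 0] the series of Q has no term, and on the other side a nonempty set has no map to the
   empty one. *)
have [k0|k0] := posnP k; last first.
  rewrite (ch_series_gt0 _ k0) (symf_part_plethysm_frob _ n0 lek).
  reflexivity.
rewrite k0 ch_series0 plethysm0 symf_part0 big1 ?scaler0 // => u _.
by rewrite surj_term0 // !scaler0.
Qed.

End ChSeriesPlethysm.

(** * Graded dimensions *)

Section RationalFunctions.

Definition const_ratfun : {rmorphism algC -> ratfun} :=
  (@tofrac {poly algC}) \o (@polyC algC).

Lemma map_const_ratfun (f : {poly algC}) :
  map_poly (fun c : algC => tofrac c%:P) f = map_poly const_ratfun f.
Proof. by []. Qed.

Lemma horner_tvar (f : {poly algC}) : (map_poly const_ratfun f).[tvar] = tofrac f.
Proof.
rewrite -{2}[f]coefK poly_def rmorph_sum horner_coef size_map_poly /=.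
apply: eq_bigr => i _; rewrite coef_map /= -mul_polyC rmorphM rmorphXn.
by [].
Qed.

Lemma tvar_neq0 : tvar != 0.
Proof. by rewrite /tvar tofrac_eq0 polyX_eq0. Qed.

Lemma dim_egf_gt0 F u n : (0 < n)%N ->
  dim_egf F u n = (map_poly const_ratfun (gr_dim (F n))).[u] / n`!%:R.
Proof. by case: n. Qed.

(** Ensures that the reversal in degree n - 1 loses no coefficient. *)
Lemma size_braid_Q (P : KL_assignment) (hP : is_equivariant_KL P) n :
  (0 < n)%N -> (size (braid_Q P n) <= n)%N.
Proof.
move=> n0; have lM := @braid_loopless n; have rE := mrk_braid n.
have [n1|n1] := leqP n 1.
  rewrite /braid_Q (eKL_rank0 hP lM); first by rewrite size_poly1.
  by rewrite rE; apply/eqP; rewrite -leqn0 -ltnS prednK.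
have r0 : (0 < mrk (emat (braid n)))%N by rewrite rE -ltnS prednK.
have := eKL_degree hP lM r0; rewrite rE -/(braid_Q P n); move: (size _) => s.
case: s => // s; rewrite /= => lt; rewrite -[n]prednK // ltnS.
by apply: leq_trans (ltnW lt); rewrite leq_pmull.
Qed.

Lemma comp_poly_scaleX (R : comNzRingType) (p : {poly R}) c n :
  (p \Po (c *: 'X))`_n = p`_n * c ^+ n.
Proof.
rewrite comp_polyE coef_sum.
rewrite (eq_bigr (fun i : 'I_(size p) => if i == n :> nat then p`_n * c ^+ n else 0)); last first.
  move=> i _; rewrite coefZ exprZn coefZ coefXn eq_sym.
  by case: eqP => [->|_]; rewrite ?mulr1 ?mulr0.
rewrite -big_mkcond /=; have [lt|le] := ltnP n (size p).
  by rewrite (big_pred1 (Ordinal lt)).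
rewrite big_pred0 ?nth_default ?mul0r // => i.
by apply/negbTE/eqP=> eq_i; have := ltn_ord i; rewrite eq_i ltnNge le.
Qed.

Lemma gr_value_rev (gT : finGroupType) (W : {group gT}) (w : gT) k (f : {poly 'CF(W)}) :
  gr_value w (poly_rev k f) = poly_rev k (gr_value w f).
Proof.
apply/polyP=> i; rewrite coef_gr_value [in LHS]coef_poly [RHS]coef_poly.
by case: ifP; rewrite ?coef_gr_value ?cfunE.
Qed.

Lemma horner_rev (K : fieldType) k (f : {poly K}) x : (size f <= k.+1)%N -> x != 0 ->
  (poly_rev k f).[x] = x ^+ k * f.[x^-1].
Proof.
move=> szf nx; rewrite (horner_coef_wide _ (size_poly _ _)) (horner_coef_wide _ szf).
rewrite mulr_sumr (reindex_inj rev_ord_inj) /=; apply: eq_bigr => i _.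
have lei : (i <= k)%N by rewrite -ltnS.
rewrite coef_poly subSS ltnS leq_subr subKn // mulrCA; congr (_ * _).
by rewrite exprVn -exprB // unitfE.
Qed.

Lemma map_poly_rev (K L : fieldType) (h : {rmorphism K -> L}) k (f : {poly K}) :
  map_poly h (poly_rev k f) = poly_rev k (map_poly h f).
Proof.
apply/polyP=> i; rewrite coef_map /= [in LHS]coef_poly [RHS]coef_poly.
by case: ifP => _; rewrite ?coef_map ?rmorph0.
Qed.

Lemma dim_egf_reverse (P : KL_assignment) (hP : is_equivariant_KL P) :
  fps_scale tvar^-1 (fps_comp (dim_egf (braid_Q P) tvar^-1) (fps_cz tvar))
    =1 dim_egf (braid_Qbar P) tvar.
Proof.
move=> n; rewrite /fps_scale /fps_comp.
have [->|n0] := posnP n.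
  rewrite [X in X \Po _](_ : _ = 0) ?comp_poly0 ?coef0 ?mulr0 //.
  by rewrite poly_def big_ord1 scale0r.
have -> : \poly_(i < n.+1) fps_cz tvar i = tvar *: 'X.
  apply/polyP=> i; rewrite coef_poly coefZ coefX /fps_cz.
  case: (i =P 1%N) => [->|_]; rewrite ?mulr1 ?mulr0 ?if_same //.
  by rewrite ltnS n0.
rewrite comp_poly_scaleX coef_poly ltnSn !dim_egf_gt0 // /gr_dim gr_value_rev map_poly_rev.
rewrite horner_rev ?tvar_neq0 //; last first.
  rewrite prednK // (leq_trans (size_poly _ _)) // (leq_trans (size_gr_value _ _)) //.
  exact: size_braid_Q.
have -> : tvar ^+ n = tvar * tvar ^+ n.-1 by rewrite -exprS prednK.
by rewrite [_ / _ * _]mulrC !mulrA mulVf ?tvar_neq0 // mul1r.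
Qed.

End RationalFunctions.

(* Plethysm of symmetric functions becomes composition of series under p_1 = z
   and p_k = 0 for k > 1, and ch becomes dim z^n / n!. *)
Section FirstPowerSum.

Definition first_psum (i : nat) : {poly ratfun} := if i == 0%N then 'X else 0.

Definition spec : {rmorphism symf -> {poly ratfun}} :=
  mmap ((@polyC ratfun) \o (@tofrac {poly algC})) (monom_eval first_psum).

Lemma specZ (c : {poly algC}) (f : symf) : spec (c *: f) = tofrac c *: spec f.
Proof. by rewrite -mul_malgC rmorphM /= mmapC /= mul_polyC. Qed.

Lemma spec_psum k : (0 < k)%N -> spec (psum k) = if k == 1%N then 'X else 0.
Proof.
move=> /prednK <-; move: k.-1 => {}k.
transitivity (((@polyC ratfun) \o (@tofrac {poly algC})) 1 * monom_eval first_psum (ucm k)).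
  exact: (mmapU (f := (@polyC ratfun) \o (@tofrac {poly algC}))).
by rewrite rmorph1 mul1r monom_eval_ucm.
Qed.

(** Only powers of p_1 survive [spec], and the degree of such a power is the exponent of z. *)
Lemma spec_symf_part n f : spec (symf_part n f) = (spec f)`_n *: 'X^n.
Proof.
have specU m (c : {poly algC}) : spec << c *g m >> =
    (if all (fun i => i == 0%N) (finsupp m) then tofrac c else 0) *: 'X^(monom_degree m).
  transitivity (((@polyC ratfun) \o (@tofrac {poly algC})) c * monom_eval first_psum m).
    exact: (mmapU (f := (@polyC ratfun) \o (@tofrac {poly algC}))).
  rewrite /= mul_polyC; case: ifPn => [/allP h|/allPn[i im ni]]; last first.
    rewrite /monom_eval (big_rem i) //= {1}/first_psum (negPf ni) expr0n.
    by rewrite -cmE_neq0 in im; rewrite (negPf im) mul0r scaler0 scale0r.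
  congr (_ *: _); rewrite /monom_eval /monom_degree -prodrXr.
  rewrite big_seq [RHS]big_seq; apply: eq_bigr => i /h /eqP ->.
  by rewrite muln1.
rewrite [in RHS](monalgE f) /symf_part !rmorph_sum coef_sum scaler_suml.
rewrite [RHS](bigID (fun m => monom_degree m == n)) /= [X in _ + X]big1 ?addr0; last first.
  move=> m /negPf dm; rewrite specU coefZ coefXn eq_sym dm mulr0 scale0r.
  by [].
apply: eq_bigr => m /eqP dm.
by rewrite specU coefZ coefXn dm eqxx mulr1.
Qed.

(** The identity is the only permutation whose cycles all have length 1. The element [y] will be z,
    K(t,z) or 0. *)
Lemma sum_perm_fixed (R : comNzRingType) (V : comAlgType R) k (a : 'S_k -> R) (y : V) :
  \sum_(w : 'S_k) a w *: \prod_(c in porbits w) (if #|c| == 1%N then y else 0)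
    = a 1%g *: y ^+ k.
Proof.
have orb1 (i : 'I_k) : #|porbit (1 : 'S_k)%g i| = 1%N.
  rewrite -(cards1 i); apply: eq_card => j; rewrite inE.
  by apply/porbitP/eqP=> [[m ->]|->]; [rewrite expg1n perm1 | exists 0%N; rewrite perm1].
rewrite (bigD1 1%g) //= [X in _ + X]big1 ?addr0 => [|w nw].
  congr (_ *: _); rewrite (eq_bigr (fun=> y)); last by move=> c /imsetP[i _ ->]; rewrite orb1.
  rewrite prodr_const -[in RHS](sum_card_porbits_setT (1 : 'S_k)%g) -sum1_card; congr (_ ^+ _).
  by apply: eq_bigr => c /imsetP[i _ ->]; rewrite orb1.
have [i ni] : exists i, w i != i.
  by apply/existsP; apply: contraR nw => /existsPn h; apply/eqP/permP=> i; rewrite perm1; apply/eqP; rewrite -[_ == _]negbK h.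
rewrite (bigD1 (porbit w i)) ?imset_f //= ifN ?mul0r ?scaler0 //.
rewrite -(cards1 i); apply/negP=> /eqP c1.
have s1 : [set i] \subset porbit w i by rewrite sub1set porbit_id.
have /eqP e1 : [set i] == porbit w i by rewrite eqEcard s1 c1 leqnn.
by case/negP: ni; rewrite -in_set1 e1 -{1}[w]expg1 mem_porbit.
Qed.

Lemma tofrac_inv_fact n : tofrac (inv_fact n) = n`!%:R^-1.
Proof. by rewrite -[LHS]/(const_ratfun (n`!%:R^-1)) fmorphV rmorph_nat. Qed.

Lemma spec_frob n (f : {poly 'CF([set: 'S_n])}) :
  spec (frob_ch f) = (tofrac (gr_dim f) / n`!%:R) *: 'X^n.
Proof.
rewrite frob_chE.
rewrite specZ.
rewrite tofrac_inv_fact.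
rewrite rmorph_sum.
have := sum_perm_fixed (fun w => tofrac (gr_value w f)) ('X : {poly ratfun}).
rewrite -/(gr_dim f).
rewrite mulrC -scalerA => <-.
congr (_ *: _).
apply: eq_bigr => w _.
rewrite specZ rmorph_prod.
congr (_ *: _).
apply: eq_bigr => c /porbits_gt0.
exact: spec_psum.
Qed.

(** For d > 1 every p_(jd) is sent to 0, and [0 < n] guarantees that each product over cycles has a
    factor. *)
Lemma spec_psum_plethysm_frob d n (f : {poly 'CF([set: 'S_n])}) :
  (0 < d)%N -> (0 < n)%N ->
  spec (psum_plethysm d (frob_ch f)) = if d == 1%N then spec (frob_ch f) else 0.
Proof.
move=> d0 n0.
rewrite psum_plethysm_frob.
rewrite [LHS]specZ.
have [->|nd] := eqVneq d 1%N.
  rewrite frob_chE /=.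
  rewrite [RHS]specZ.
  apply: (congr1 (fun x => tofrac (inv_fact n) *: spec x)).
  apply: eq_bigr => w _; rewrite expr1 comp_polyXr.
  apply: (congr1 (fun x : symf => gr_value w f *: x)).
  by apply: eq_bigr => c _; rewrite muln1.
rewrite rmorph_sum /=.
have := sum_perm_fixed (fun w => tofrac (gr_value w f \Po 'X^d)) (0 : {poly ratfun}).
rewrite expr0n eqn0Ngt n0 scaler0 => s0.
rewrite -[RHS](scaler0 _ (tofrac (inv_fact n))); congr (_ *: _); rewrite -[RHS]s0.
apply: eq_bigr => w _; rewrite specZ rmorph_prod; congr (_ *: _).
apply: eq_bigr => c /porbits_gt0 c0; rewrite /= spec_psum ?muln_gt0 ?c0 // if_same.
by rewrite muln_eq1 (negPf nd) andbF.
Qed.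

Variable n : nat.
Local Notation KK := (\sum_(i < n.+1) ch_series braid_K i).

Let kappa : {poly ratfun} := \poly_(i < n.+1) dim_egf braid_K tvar i.

Lemma dim_egf_tvar F k : dim_egf F tvar k = if k == 0%N then 0 else tofrac (gr_dim (F k)) / k`!%:R.
Proof. by rewrite /dim_egf map_const_ratfun horner_tvar. Qed.

Lemma spec_psum_plethysm_K d : (0 < d)%N ->
  spec (psum_plethysm d KK) = if d == 1%N then kappa else 0.
Proof.
move=> d0; rewrite psum_plethysm_sum rmorph_sum /=.
transitivity (\sum_(i < n.+1) if d == 1%N then dim_egf braid_K tvar i *: 'X^i else 0).
  apply: eq_bigr => i _; rewrite dim_egf_tvar.
  have [i0|i0] := posnP i.
    rewrite i0 ch_series0 scale0r if_same -[RHS](rmorph0 spec).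
    apply: (congr1 spec).
    by have := @psum_plethysm_sum d nat [::] xpredT (fun=> 0); rewrite !big_nil.
  by rewrite ch_series_gt0 // spec_psum_plethysm_frob // spec_frob.
by case: eqP => _; [rewrite /kappa poly_def | rewrite big1].
Qed.

Lemma spec_plethysm_frob k (f : {poly 'CF([set: 'S_k])}) :
  spec (plethysm (frob_ch f) KK) = (tofrac (gr_dim f) / k`!%:R) *: kappa ^+ k.
Proof.
rewrite plethysm_frob specZ tofrac_inv_fact rmorph_sum /=.
have := sum_perm_fixed (fun w => tofrac (gr_value w f)) kappa.
rewrite -/(gr_dim f) mulrC -scalerA => <-; congr (_ *: _); apply: eq_bigr => w _.
rewrite specZ rmorph_prod; congr (_ *: _); apply: eq_bigr => c /porbits_gt0.
exact: spec_psum_plethysm_K.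
Qed.

Lemma dim_egf_plethysm (P : KL_assignment) (hP : is_equivariant_KL P) :
  dim_egf (braid_Qbar P) tvar n
    = fps_comp (dim_egf (braid_Q P) tvar) (dim_egf braid_K tvar) n.
Proof.
rewrite /fps_comp -/kappa.
have [n0|n0] := posnP n.
  rewrite n0 [X in X \Po _](_ : _ = 0) ?comp_poly0 ?coef0 //.
  by rewrite poly_def big_ord1 scale0r.
have E : frob_ch (braid_Qbar P n)
    = symf_part n (plethysm (\sum_(i < n.+1) ch_series (braid_Q P) i) KK).
  exact: etrans (esym (ch_series_gt0 _ n0)) (ch_series_plethysm hP n).
(* The formula is the coefficient of z^n in the image under [spec] of the degree [n] part of the
   plethystic identity. *)
have := etrans (esym (spec_frob _)) (etrans (congr1 spec E) (spec_symf_part _ _)).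
move/(congr1 (fun p : {poly ratfun} => p`_n)); rewrite !coefZ coefXn eqxx !mulr1.
rewrite dim_egf_tvar eqn0Ngt n0 => ->.
apply: (congr1 (fun p : {poly ratfun} => p`_n)).
rewrite plethysm_sum rmorph_sum poly_def [RHS](raddf_sum (comp_poly kappa)).
apply: eq_bigr => k _; rewrite [RHS]comp_polyZ comp_Xn_poly dim_egf_tvar.
have [k0|k0] := posnP k; last first.
  exact: etrans (congr1 (fun x => spec (plethysm x KK)) (ch_series_gt0 _ k0)) (spec_plethysm_frob _).
have z : ch_series (braid_Q P) k = 0 by rewrite k0; apply: ch_series0.
rewrite scale0r; apply: etrans (congr1 (fun x => spec (plethysm x KK)) z) _.
by rewrite plethysm0 rmorph0.
Qed.

End FirstPowerSum.

Theorem mainTheorem5 (P : KL_assignment) (hP : is_equivariant_KL P) :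
  [/\ fps_scale tvar^-1 (fps_comp (dim_egf (braid_Q P) tvar^-1) (fps_cz tvar))
        =1 dim_egf (braid_Qbar P) tvar,
      dim_egf (braid_Qbar P) tvar
        =1 fps_comp (dim_egf (braid_Q P) tvar) (dim_egf braid_K tvar)
    & ch_series (braid_Qbar P)
        =1 cplethysm (ch_series (braid_Q P)) (ch_series braid_K)].
Proof.
split=> [|n|n].
- exact: dim_egf_reverse.
- exact: dim_egf_plethysm.
- exact: ch_series_plethysm.
Qed.
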